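(* Let $(x_k)_{k\ge 0}$ be a uniformly ergodic Markov chain on a Borel space $\mathcal X$ with transition kernel $P$, unique stationary distribution $\pi$, and $x_0\sim\pi$. Let $A:\mathcal X\to\mathbb R^{d\times d}$ and $b:\mathcal X\to\mathbb R^d$ satisfy $A_{\max}:=\sup_{x}\|A(x)\|\le 1$ and $b_{\max}:=\sup_{x}\|b(x)\|<\infty$, and suppose $\bar A:=\mathbb E_{x\sim\pi}[A(x)]$ is Hurwitz. Let $\theta_{k+1}=\theta_k+\alpha\big(A(x_k)\theta_k+b(x_k)\big)$, $k\ge 0$, with a constant stepsize $\alpha>0$ satisfying $\alpha\tau_\alpha<\frac{0.05}{95\gamma_{\max}}$, and let $\theta_\infty$ be the limit of $\theta_k$. Then for all $k\ge\tau_\alpha$, $$\big\|\mathbb E[\theta_k]-\mathbb E[\theta_\infty]\big\|\le C\Big(1-\frac{0.9\alpha}{\gamma_{\max}}\Big)^{k/2}\quad\text{and}\quad\big\|\mathbb E[\theta_k\theta_k^\top]-\mathbb E[\theta_\infty\theta_\infty^\top]\big\|\le C'\Big(1-\frac{0.9\alpha}{\gamma_{\max}}\Big)^{k/2},$$ for some $C\equiv C(A,b,\pi)$ and $C'\equiv C'(A,b,\pi)$ that are independent of $\alpha$ and $k$.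
   Context: Norms: $\|\cdot\|$ is the Euclidean norm for vectors and the spectral norm for matrices. Chain and initialization: uniformly ergodic means $\sup_{x\in\mathcal X}\|P^n(x,\cdot)-\pi\|_{TV}\to0$ as $n\to\infty$, where $\|\cdot\|_{TV}$ is the total variation norm. $A,b$ are deterministic functions. The initial distribution of $\theta_0$ may depend on $x_0$, but $\theta_0$ is independent of $(x_k)_{k\ge1}$ given $x_0$. Lyapunov constants: Hurwitz means all eigenvalues have strictly negative real parts. $\Gamma$ is the symmetric positive definite matrix with $\bar A^\top\Gamma+\Gamma\bar A=-I$; $\gamma_{\max}$ is its maximum eigenvalue. Mixing time: let $\bar b:=\mathbb E_{x\sim\pi}[b(x)]$. For $\epsilon\in(0,1)$, $\tau_\epsilon$ is the smallest number $\tau_\epsilon\ge1$ such that for all $x\in\mathcal X$ and all $k\ge\tau_\epsilon$: $\|\mathbb E[A(x_k)\mid x_0=x]-\bar A\|\le\epsilon A_{\max}$ and $\|\mathbb E[b(x_k)\mid x_0=x]-\bar b\|\le\epsilon b_{\max}$. $\tau_\alpha$ is this quantity with $\epsilon=\alpha$. Limit: under these hypotheses, under all initial distributions of $\theta_0$, the sequence $(x_k,\theta_k)_{k\ge0}$ converges to a unique limit $(x_\infty,\theta_\infty)$ in the Wasserstein-2 distance on $\mathcal X\times\mathbb R^d$ with respect to the metric $\sqrt{\mathbf 1\{x\ne x'\}+\|\theta-\theta'\|^2}$; $\theta_\infty$ is the second component of this limit. Constants: the notation $C(A,b,\pi)$, $C'(A,b,\pi)$ denotes quantities depending on $A$, $b$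 and $\pi$, but not on other properties of $P$ (such as its mixing time or spectral gap).
   Formalization: The initial vector θ_0 is assumed to have finite second moment, and C, C' may depend on a bound M for E‖θ_0‖² besides A, b, π; constants independent of θ_0 are impossible (A=-1, b=0, d=1, θ_0=N large). *)

(* Defs.v *)
From HB Require Import structures.
From mathcomp Require Import all_boot all_order all_algebra.
From mathcomp Require Import complex.
From mathcomp Require Import all_classical all_reals all_analysis.
Import Order.TTheory GRing.Theory Num.Theory.
Import numFieldNormedType.Exports.

Set Implicit Arguments.
Unset Strict Implicit.
Unset Printing Implicit Defensive.

Local Open Scope classical_set_scope.
Local Open Scope ring_scope.

(* Matrices carry the Borel sigma-algebra of their usual topology. *)
Section matrix_borel.
Context (R : realType) (m n : nat).

Definition mx_borel : set (set 'M[R]_(m, n)) := <<s @open 'M[R]_(m, n) >>.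

Let mx_borel0 : mx_borel set0.
Proof. exact: sigma_algebra0. Qed.

Let mx_borelC (U : set 'M[R]_(m, n)) : mx_borel U -> mx_borel (~` U).
Proof. by move=> mU; rewrite -setTD; exact: sigma_algebraCD. Qed.

Let mx_borel_bigcup (F : (set 'M[R]_(m, n))^nat) :
  (forall i, mx_borel (F i)) -> mx_borel (\bigcup_i F i).
Proof. exact: sigma_algebra_bigcup. Qed.

HB.instance Definition _ := @isMeasurable.Build default_measure_display
  'M[R]_(m, n) mx_borel mx_borel0 mx_borelC mx_borel_bigcup.

End matrix_borel.

Section linear_algebra.
Context (R : realType).

Definition eucl_norm d (v : 'cV[R]_d) : R :=
  Num.sqrt (\sum_(i < d) v i ord0 ^+ 2).

Definition spectral_norm m n (M : 'M[R]_(m, n)) : R :=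
  sup [set eucl_norm (M *m v) | v in [set v | eucl_norm v <= 1]].

Definition hurwitz d (M : 'M[R]_d) : Prop :=
  forall z : R[i], eigenvalue (map_mx (real_complex R) M) z -> complex.Re z < 0.

Definition sym_posdef d (G : 'M[R]_d) : Prop :=
  G^T = G /\ forall v : 'cV[R]_d, v != 0 -> 0 < (v^T *m G *m v) ord0 ord0.

Definition is_max_eigenvalue d (G : 'M[R]_d) (g : R) : Prop :=
  eigenvalue G g /\ forall a, eigenvalue G a -> a <= g.

End linear_algebra.

(* Borel isomorphic to a Borel subset of the real line. *)
Definition borel_space (R : realType) dX (X : measurableType dX) : Prop :=
  exists f : X -> R, [/\ injective f, measurable_fun [set: X] f
    & forall U, measurable U -> measurable (f @` U)].

Definition expect_mx (R : realType) dT (T : measurableType dT) m n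
    (mu : {measure set T -> \bar R}) (f : T -> 'M[R]_(m, n)) : 'M[R]_(m, n) :=
  \matrix_(i, j) \int[mu]_t f t i j.

(* Total mass of the variation of a charge; by uniqueness of the Jordan
   decomposition it does not depend on the chosen Hahn decomposition. *)
Definition tv_norm (R : realType) dT (T : measurableType dT)
    (nu : {charge set T -> \bar R}) : \bar R :=
  let hP := cid (Hahn_decomposition nu) in
  let hN := cid (svalP hP) in
  charge_variation (svalP hN) [set: T].

Section markov_kernels.
Context (R : realType) dX (X : measurableType dX).
Implicit Types (P : R.-pker X ~> X) (pi : probability X R).

(* [kpow P n x] is P^n(x, .), the law of x_n given x_0 = x. *)
Fixpoint kpow P (n : nat) : R.-spker X ~> X :=
  if n is n'.+1 then mkcomp_noparam (kpow P n') P
  else kdirac (@measurable_id _ X [set: X]).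

Definition kpow_at P n x : set X -> \bar R := kpow P n x.

HB.instance Definition _ P n x := Measure.on (kpow_at P n x).

Let kpow_at_fin P n x : fin_num_fun (kpow_at P n x).
Proof. exact: finite_kernel_measure. Qed.

HB.instance Definition _ P n x :=
  @Measure_isFinite.Build _ _ _ (kpow_at P n x) (kpow_at_fin P n x).

Definition stationary P pi : Prop :=
  forall U, measurable U -> (\int[pi]_x P x U = pi U)%E.

Definition unique_stationary P pi : Prop :=
  stationary P pi /\
  forall nu : probability X R, stationary P nu ->
    forall U, measurable U -> nu U = pi U.

Definition tv_gap P pi n x : \bar R :=
  tv_norm (cadd (charge_of_finite_measure (kpow_at P n x))
                (copp (charge_of_finite_measure pi))).

Definition uniformly_ergodic P pi : Prop :=
  ereal_sup [set tv_gap P pi n x | x in [set: X]] @[n --> \oo] --> 0%E.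

End markov_kernels.

(* Suprema over the state space are taken in the extended reals, so that an
   unbounded function gets norm +oo. *)
Definition sup_spectral (R : realType) (X : Type) m n (A : X -> 'M[R]_(m, n)) :
    \bar R :=
  ereal_sup [set (spectral_norm (A x))%:E | x in [set: X]].

Definition sup_eucl (R : realType) (X : Type) d (b : X -> 'cV[R]_d) : \bar R :=
  ereal_sup [set (eucl_norm (b x))%:E | x in [set: X]].

Section mixing_time.
Context (R : realType) dX (X : measurableType dX) (d : nat).
Variables (A : X -> 'M[R]_d) (b : X -> 'cV[R]_d).
Variables (pi : probability X R) (P : R.-pker X ~> X).

Definition mixed_after (eps : R) (t : nat) : Prop :=
  forall (x : X) (k : nat), (t <= k)%N ->
    ((spectral_norm (expect_mx (kpow P k x) A - expect_mx pi A))%:E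
       <= eps%:E * sup_spectral A)%E /\
    ((eucl_norm (expect_mx (kpow P k x) b - expect_mx pi b))%:E
       <= eps%:E * sup_eucl b)%E.

Definition is_mixing_time (eps : R) (tau : nat) : Prop :=
  [/\ (1 <= tau)%N, mixed_after eps tau
    & forall t, (1 <= t)%N -> mixed_after eps t -> (tau <= t)%N].

End mixing_time.

Section processes.
Context (R : realType) dO (Omega : measurableType dO) (Pr : probability Omega R).
Context dX (X : measurableType dX).
Implicit Types (G H : set (set Omega)) (x : nat -> {RV Pr >-> X}).

Definition sigma_of x (I : set nat) : set (set Omega) :=
  <<s \bigcup_(i in I) g_sigma_algebra_preimage (x i) >>.

Definition markov_chain (P : R.-pker X ~> X) x : Prop :=
  forall (k : nat) (D : set Omega) (U : set X),
    sigma_of x [set i | (i <= k)%N] D -> measurable U ->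
    (Pr (D `&` x k.+1 @^-1` U) = \int[Pr]_(w in D) P (x k w) U)%E.

(* [g \o z] is a version of the conditional probability of [B] given [z]. *)
Definition is_cond_prob (z : Omega -> X) (B : set Omega) (g : X -> R) : Prop :=
  [/\ measurable_fun [set: X] g,
      Pr.-integrable [set: Omega] (EFin \o g \o z)
    & forall V, measurable V ->
        (Pr (B `&` z @^-1` V) = \int[Pr]_(w in z @^-1` V) (g (z w))%:E)%E].

Definition cond_independent (z : Omega -> X) G H : Prop :=
  forall B E g h, G B -> H E -> is_cond_prob z B g -> is_cond_prob z E h ->
    is_cond_prob z (B `&` E) (g \* h).

End processes.

Section pair_of_random_variables.
Context dO (Omega : measurableType dO).
Context d1 (T1 : measurableType d1) d2 (T2 : measurableType d2).
Variables (f : {mfun Omega >-> T1}) (g : {mfun Omega >-> T2}).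

Definition rv_pair (w : Omega) : T1 * T2 := (f w, g w).

Let measurable_rv_pair : measurable_fun [set: Omega] rv_pair.
Proof. exact: measurable_fun_pair. Qed.

HB.instance Definition _ := isMeasurableFun.Build _ _ _ _ rv_pair
  measurable_rv_pair.

End pair_of_random_variables.

Section wasserstein.
Context (R : realType) dT (T : measurableType dT).

Definition is_coupling (mu nu : probability T R)
    (kappa : probability (T * T)%type R) : Prop :=
  forall U, measurable U ->
    kappa (fst @^-1` U) = mu U /\ kappa (snd @^-1` U) = nu U.

Definition wasserstein2 (dist : T -> T -> R) (mu nu : probability T R) :
    \bar R :=
  poweR (ereal_inf [set (\int[kappa]_z (dist z.1 z.2 ^+ 2)%:E)%E
                   | kappa in is_coupling mu nu]) 2^-1.

End wasserstein.

Definition joint_dist (R : realType) dX (X : measurableType dX) d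
    (p q : X * 'cV[R]_d) : R :=
  Num.sqrt ((p.1 != q.1)%:R + eucl_norm (p.2 - q.2) ^+ 2).

(* Main.v *)
(* For bounded measurable [F] on the state space, E[Y F(x_(n+1))] = E[Y (P F)(x_n)]
   whenever [Y] depends on theta_0 and x_0, .., x_n only. Hence
   E[theta_(n+k)^T Q theta_(n+k) + q . theta_(n+k)] is the mean of an affine
   quadratic function of [theta_n] whose coefficients, functions of [x_n], come
   from iterating linear operators backwards in time. Expanding
   [theta^T Gam theta] over one step after tau steps of mixing, the Lyapunov
   equation makes the operator on quadratic forms contract at the rate
   1 - 0.9 alpha / gmax; a Cauchy-Schwarz argument along the chain gives the
   square root of this rate for the linear coefficient. The constant coefficient
   does not decay, but by stationarity its mean is the same at all starting times
   [n], so it cancels in the difference between the moments at times [k] and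
   [n + k]. Finally [n] goes to infinity: Wasserstein-2 convergence carries the
   first two moments to the limit. The constants never see tau because
   rate ^ tau >= 1/2. *)

Require Import Defs.
From HB Require Import structures.
From mathcomp Require Import all_boot all_order all_algebra.
From mathcomp Require Import complex ring lra.
From mathcomp Require Import all_classical all_reals all_analysis.
From mathcomp Require Import measurable_realfun.
Import Order.TTheory GRing.Theory Num.Theory.
Import numFieldNormedType.Exports.

Set Implicit Arguments.
Unset Strict Implicit.
Unset Printing Implicit Defensive.

Local Open Scope classical_set_scope.
Local Open Scope ring_scope.

(** Working backwards lets mixing act on a deterministic object. [theta_n] and [x_n] are dependent,
    but the coefficients are functions of the state alone; the deviation [N] of the Lyapunov form
    from its mean is one such function. Each step matrix is within [alpha] of the identity, so [tau]
    backward steps applied to [N] stay close to its plain [tau]-fold average under the kernel, which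
    mixing makes small. The constants are free of [alpha] for the following reason. Let [s] be the
    square root of the rate. Every backward step feeds the linear and constant coefficients a source
    of size [alpha] times a power of [s]. These sources sum to order [alpha / (1 - s)], and
    [alpha <= 3 * gmax * (1 - s)]. Factors [1 - s ^+ k] in the bounds let an induction carry out
    this geometric summation. One functional, [affine_mean], serves three times: with a vector [q]
    for the mean, with a rank-one [Q] for the second moment, and with [Q = 1] for a bound on all
    second moments, which the passage to the limit needs. *)

Section euclidean_space.
Context (R : realType).

(** * Euclidean norm, Cauchy-Schwarz, and bounds on bilinear forms *)

Definition dot d (u v : 'cV[R]_d) : R := (u^T *m v) ord0 ord0.

Lemma dotE d (u v : 'cV[R]_d) : dot u v = \sum_i u i ord0 * v i ord0.
Proof. by rewrite /dot mxE; apply: eq_bigr => i _; rewrite mxE. Qed.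

Lemma dotC d (u v : 'cV[R]_d) : dot u v = dot v u.
Proof. by rewrite !dotE; apply: eq_bigr => i _; rewrite mulrC. Qed.

Lemma dotDr d (u v w : 'cV[R]_d) : dot u (v + w) = dot u v + dot u w.
Proof. by rewrite /dot mulmxDr mxE. Qed.

Lemma dotDl d (u v w : 'cV[R]_d) : dot (u + v) w = dot u w + dot v w.
Proof. by rewrite dotC dotDr !(dotC w). Qed.

Lemma dotZr d a (u v : 'cV[R]_d) : dot u (a *: v) = a * dot u v.
Proof. by rewrite /dot -scalemxAr mxE. Qed.

Lemma dotZl d a (u v : 'cV[R]_d) : dot (a *: u) v = a * dot u v.
Proof. by rewrite dotC dotZr dotC. Qed.

Lemma dotNr d (u v : 'cV[R]_d) : dot u (- v) = - dot u v.
Proof. by rewrite -scaleN1r dotZr mulN1r. Qed.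

Lemma dotBr d (u v w : 'cV[R]_d) : dot u (v - w) = dot u v - dot u w.
Proof. by rewrite dotDr dotNr. Qed.

Lemma dotBl d (u v w : 'cV[R]_d) : dot (u - v) w = dot u w - dot v w.
Proof. by rewrite dotC dotBr !(dotC w). Qed.

Lemma dot_mulmx m n (u : 'cV[R]_m) (M : 'M[R]_(m, n)) (v : 'cV[R]_n) :
  dot u (M *m v) = dot (M^T *m u) v.
Proof. by rewrite /dot trmx_mul trmxK mulmxA. Qed.

Lemma eucl_norm_ge0 d (u : 'cV[R]_d) : 0 <= eucl_norm u.
Proof. exact: sqrtr_ge0. Qed.

Lemma sqr_eucl_norm d (u : 'cV[R]_d) : eucl_norm u ^+ 2 = dot u u.
Proof.
rewrite sqr_sqrtr ?sumr_ge0// => [|i _]; last exact: sqr_ge0.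
by rewrite dotE; apply: eq_bigr => i _; rewrite expr2.
Qed.

Lemma dot_ge0 d (u : 'cV[R]_d) : 0 <= dot u u.
Proof. by rewrite -sqr_eucl_norm sqr_ge0. Qed.

Lemma eucl_norm_sqrt d (u : 'cV[R]_d) : eucl_norm u = Num.sqrt (dot u u).
Proof. by rewrite -sqr_eucl_norm sqrtr_sqr ger0_norm// eucl_norm_ge0. Qed.

Lemma eucl_normZ d a (u : 'cV[R]_d) : eucl_norm (a *: u) = `|a| * eucl_norm u.
Proof.
rewrite !eucl_norm_sqrt dotZl dotZr mulrA -expr2 sqrtrM ?sqr_ge0//.
by rewrite sqrtr_sqr.
Qed.

Lemma eucl_norm0 d : eucl_norm (0 : 'cV[R]_d) = 0.
Proof. by rewrite -(scale0r 0) eucl_normZ normr0 mul0r. Qed.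

Lemma coord_le_eucl_norm d (u : 'cV[R]_d) i : `|u i ord0| <= eucl_norm u.
Proof.
rewrite -sqrtr_sqr ler_wsqrtr// (bigD1 i)//= lerDl sumr_ge0// => j _.
exact: sqr_ge0.
Qed.

Lemma eucl_norm_eq0 d (u : 'cV[R]_d) : eucl_norm u = 0 -> u = 0.
Proof.
move=> u0; apply/colP => i; rewrite mxE; apply/eqP; rewrite -normr_le0.
by rewrite -u0 coord_le_eucl_norm.
Qed.

Lemma dot_eq0 d (u : 'cV[R]_d) : dot u u = 0 -> u = 0.
Proof. by move=> u0; apply: eucl_norm_eq0; rewrite eucl_norm_sqrt u0 sqrtr0. Qed.

(** Optimising the weight at [t = q / p] turns a family of weighted sums into the product. Every
    Cauchy-Schwarz type bound below goes through this, so a domination by sums of squares is all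
    that must be propagated. *)
Lemma le_mul_scale (p q x : R) : 0 <= p -> 0 <= q ->
  (forall t, 0 < t -> 2 * x <= t * p ^+ 2 + t^-1 * q ^+ 2) -> x <= p * q.
Proof.
rewrite le_eqVlt => /predU1P[<- q0 h|p0]; last first.
  rewrite le_eqVlt => /predU1P[<- h|q0 h]; last first.
    have := h (q / p) (divr_gt0 q0 p0).
    have -> : q / p * p ^+ 2 + (q / p)^-1 * q ^+ 2 = 2 * (p * q).
      by field; rewrite !gt_eqF.
    by rewrite ler_pM2l.
  rewrite mulr0 leNgt; apply/negP => x0.
  (* For [q = 0] this weight makes the right-hand side [x], which is below [2 * x]. *)
  have t0 : 0 < x / p ^+ 2 by rewrite divr_gt0 ?exprn_gt0.
  have := h _ t0; rewrite divfK ?gt_eqF ?exprn_gt0// expr0n/= mulr0 addr0.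
  by lra.
rewrite mul0r leNgt; apply/negP => x0.
(* For [p = 0] a large weight gives the contradiction; the [+ 1] keeps it positive when [q] vanishes
   too. *)
have t0 : 0 < q ^+ 2 / x + 1 by rewrite ltr_wpDl ?divr_ge0 ?sqr_ge0// ltW.
have := h _ t0; rewrite expr0n/= mulr0 add0r => hx.
have : 2 * x * (q ^+ 2 / x + 1) <= q ^+ 2.
  by rewrite mulrC -ler_pdivlMl.
have -> : 2 * x * (q ^+ 2 / x + 1) = 2 * q ^+ 2 + 2 * x.
  by field; rewrite gt_eqF.
by have := sqr_ge0 q; lra.
Qed.

(** Nonnegativity of the form at [t *: w - v] for all [t > 0] is the premise of [le_mul_scale].
    Allowing a degenerate form matters: it is applied to [l - G] at a vector where that form
    vanishes. *)
Lemma psd_cauchy_schwarz d (M : 'M[R]_d) (u v : 'cV[R]_d) : M^T = M ->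
  (forall w, 0 <= dot w (M *m w)) ->
  `|dot u (M *m v)| <= Num.sqrt (dot u (M *m u)) * Num.sqrt (dot v (M *m v)).
Proof.
move=> sM M0.
suff cs w : dot w (M *m v) <=
    Num.sqrt (dot w (M *m w)) * Num.sqrt (dot v (M *m v)).
  rewrite ler_norml cs andbT lerNl -mulN1r -dotZl.
  apply: (le_trans (cs _)).
  by rewrite -scalemxAr dotZl dotZr mulrA mulrNN !mul1r.
apply: le_mul_scale; rewrite ?sqrtr_ge0// => t t0.
rewrite !sqr_sqrtr//; have := M0 (t *: w - v).
rewrite mulmxBr -scalemxAr dotBl !dotBr !dotZr !dotZl.
have -> : dot v (M *m w) = dot w (M *m v) by rewrite dot_mulmx sM dotC.
move=> h; rewrite -(ler_pM2l t0) mulrDr (mulrA t t^-1) mulfV ?gt_eqF// mul1r.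
by lra.
Qed.

Lemma cauchy_schwarz d (u v : 'cV[R]_d) :
  `|dot u v| <= eucl_norm u * eucl_norm v.
Proof.
have := @psd_cauchy_schwarz d 1%:M u v; rewrite !mul1mx -!eucl_norm_sqrt.
by apply; [rewrite trmx1|move=> w; rewrite mul1mx dot_ge0].
Qed.

Lemma eucl_normD d (u v : 'cV[R]_d) :
  eucl_norm (u + v) <= eucl_norm u + eucl_norm v.
Proof.
rewrite -(@ler_pXn2r _ 2)// ?nnegrE ?addr_ge0 ?eucl_norm_ge0//.
rewrite sqrrD !sqr_eucl_norm dotDl !dotDr (dotC v u).
have := le_trans (ler_norm _) (cauchy_schwarz u v).
by rewrite -!sqr_eucl_norm; lra.
Qed.

Lemma eucl_normN d (u : 'cV[R]_d) : eucl_norm (- u) = eucl_norm u.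
Proof. by rewrite -scaleN1r eucl_normZ normrN normr1 mul1r. Qed.

Lemma eucl_norm_le_sum d (u : 'cV[R]_d) : eucl_norm u <= \sum_i `|u i ord0|.
Proof.
rewrite -(@ler_pXn2r _ 2)// ?nnegrE ?eucl_norm_ge0 ?sumr_ge0//.
rewrite sqr_eucl_norm dotE expr2 mulr_suml; apply: ler_sum => i _.
apply: (le_trans (ler_norm _)); rewrite normrM ler_wpM2l//.
by rewrite (bigD1 i)//= lerDl sumr_ge0.
Qed.

(** The operator norm bound in weak form: for fixed [u], [v] it concerns a scalar that is linear in
    [M], so it passes through integrals over the state space. *)
Definition form_bounded d (M : 'M[R]_d) c :=
  forall u v, `|dot u (M *m v)| <= c * eucl_norm u * eucl_norm v.

Lemma form_bounded_mulmx d (M : 'M[R]_d) c v : form_bounded M c -> 0 <= c ->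
  eucl_norm (M *m v) <= c * eucl_norm v.
Proof.
move=> /(_ (M *m v) v) + c0; rewrite -sqr_eucl_norm ger0_norm ?sqr_ge0//.
have := eucl_norm_ge0 (M *m v); rewrite le_eqVlt => /predU1P[<- _|Mv0].
  by rewrite mulr_ge0 ?eucl_norm_ge0.
by rewrite expr2 (mulrC c) -mulrA ler_pM2l.
Qed.

Lemma spectral_norm_form_bounded d (M : 'M[R]_d) c :
  spectral_norm M <= c -> form_bounded M c.
Proof.
move=> Mc; set S := [set eucl_norm (M *m v) | v in [set v | eucl_norm v <= 1]].
(* A real [sup] bounds its set only if the set is bounded above, which the norms of the rows
   ensure. *)
have ubS : has_ubound S.
  exists (\sum_i eucl_norm (row i M)^T) => _ [v /= v1 <-].
  apply: (le_trans (eucl_norm_le_sum _)); apply: ler_sum => i _.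
  have -> : (M *m v) i ord0 = dot (row i M)^T v.
    by rewrite /dot trmxK -row_mul [RHS]mxE.
  apply: (le_trans (cauchy_schwarz _ _)).
  by rewrite ler_piMr ?eucl_norm_ge0.
have opn v : eucl_norm (M *m v) <= c * eucl_norm v.
  have [v0|v0] := eqVneq (eucl_norm v) 0.
    by rewrite (eucl_norm_eq0 v0) mulmx0 eucl_norm0 mulr0.
  have vp : 0 < eucl_norm v by rewrite lt_neqAle eq_sym v0 eucl_norm_ge0.
  rewrite -ler_pdivrMr//; apply: le_trans Mc; apply: ub_le_sup => //.
  exists ((eucl_norm v)^-1 *: v); last first.
    by rewrite -scalemxAr eucl_normZ ger0_norm ?invr_ge0 ?ltW// mulrC.
  by rewrite /= eucl_normZ ger0_norm ?invr_ge0 ?(ltW vp)// mulVf.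
move=> u v; apply: (le_trans (cauchy_schwarz _ _)).
rewrite (mulrC c) -mulrA; apply: ler_wpM2l; [exact: eucl_norm_ge0|exact: opn].
Qed.

Lemma form_bounded_spectral_norm d (M : 'M[R]_d) c : 0 <= c ->
  form_bounded M c -> spectral_norm M <= c.
Proof.
move=> c0 Mc; apply: ge_sup.
  by exists (eucl_norm (M *m 0)), 0 => //=; rewrite eucl_norm0.
move=> _ [v /= v1 <-]; apply: (le_trans (form_bounded_mulmx v Mc c0)).
by rewrite ler_piMr.
Qed.

Lemma form_boundedD d (M N : 'M[R]_d) c e :
  form_bounded M c -> form_bounded N e -> form_bounded (M + N) (c + e).
Proof.
move=> Mc Ne u v; rewrite mulmxDl dotDr.
by apply: (le_trans (ler_normD _ _)); rewrite !mulrDl lerD.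
Qed.

Lemma form_boundedZ d (M : 'M[R]_d) c a :
  form_bounded M c -> form_bounded (a *: M) (`|a| * c).
Proof.
move=> Mc u v; rewrite -scalemxAl dotZr normrM -!mulrA ler_wpM2l//.
by rewrite mulrA; exact: Mc.
Qed.

Lemma form_bounded_tr d (M : 'M[R]_d) c :
  form_bounded M c -> form_bounded M^T c.
Proof.
by move=> Mc u v; rewrite dot_mulmx trmxK dotC mulrAC; exact: Mc.
Qed.

Lemma form_boundedM d (M N : 'M[R]_d) c e : 0 <= c -> 0 <= e ->
  form_bounded M c -> form_bounded N e -> form_bounded (M *m N) (c * e).
Proof.
move=> c0 e0 Mc Ne u v; rewrite -mulmxA.
apply: (le_trans (Mc _ _)); rewrite -mulrA mulrAC -!mulrA ler_wpM2l//.
rewrite (mulrC (eucl_norm v)) mulrCA ler_wpM2l ?eucl_norm_ge0//.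
exact: form_bounded_mulmx.
Qed.

Lemma form_bounded1 d : form_bounded (1%:M : 'M[R]_d) 1.
Proof. by move=> u v; rewrite mul1mx mul1r cauchy_schwarz. Qed.

Lemma form_bounded_le d (M : 'M[R]_d) c e :
  c <= e -> form_bounded M c -> form_bounded M e.
Proof.
move=> ce Mc u v; apply: (le_trans (Mc u v)).
by rewrite -!mulrA ler_wpM2r// mulr_ge0 ?eucl_norm_ge0.
Qed.

End euclidean_space.

(** * The largest eigenvalue of a symmetric matrix *)

Section lyapunov_matrix.
Context (R : realType).

Let quad_continuous d (G : 'M[R]_d) :
  continuous (fun v : 'rV[R]_d => dot v^T (G *m v^T)).
Proof.
have -> : (fun v : 'rV[R]_d => dot v^T (G *m v^T)) =
    fun v : 'rV[R]_d =>
      \sum_i v ord0 i * \sum_j G i j * v ord0 j.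
  apply/funext => v; rewrite dotE; apply: eq_bigr => i _.
  by rewrite !mxE; congr (_ * _); apply: eq_bigr => j _; rewrite mxE.
apply: continuous_big => [|i _]; first exact: add_continuous.
have ci : continuous (fun v : 'rV[R]_d => \sum_j G i j * v ord0 j).
  apply: continuous_big => [|j _]; first exact: add_continuous.
  move=> v; apply: (@continuous_comp _ _ _ (fun v : 'rV[R]_d => v ord0 j)).
    exact: coord_continuous.
  exact: mulrl_continuous.
move=> v; apply: (@continuous2_cvg _ _ _ _ _ (nbhs_filter v)
  (fun v : 'rV[R]_d => v ord0 i) (fun v => \sum_j G i j * v ord0 j) *%R).
- exact: (@mul_continuous R (_, _)).
- exact: coord_continuous.
- exact: ci.
Qed.

(** [g] is only compared with eigenvalues, so the maximum [l] of the form on the compact unit sphere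
    has to be exhibited as one. Row vectors are used because [eigenvalue] refers to left
    eigenvectors. *)
Lemma rayleigh d (G : 'M[R]_d) g : G^T = G -> is_max_eigenvalue G g ->
  forall v, dot v (G *m v) <= g * dot v v.
Proof.
move=> sG [_ gmax] v.
have [->|v0] := eqVneq v 0; first by rewrite mulmx0 /dot mulmx0 mxE mulr0.
pose S := [set w : 'rV[R]_d | dot w^T w^T = 1].
have unit_norm (u : 'cV[R]_d) : u != 0 -> S ((eucl_norm u)^-1 *: u)^T.
  move=> u0; rewrite /S/= trmxK dotZl dotZr -sqr_eucl_norm.
  by field; apply: contra_neq u0; exact: eucl_norm_eq0.
have S0 : S !=set0 by eexists; exact: unit_norm v0.
have cS : compact S.
  apply: bounded_closed_compact.
    exists 1; split; first by rewrite num_real.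
    move=> t t1 w Sw; apply: ltW; apply: le_lt_trans t1.
    rewrite /Num.Def.normr/= mx_normrE; apply/bigmax_leP; split => // -[i j] _ /=.
    have := coord_le_eucl_norm w^T j; rewrite eucl_norm_sqrt Sw sqrtr1 mxE.
    by rewrite (ord1 i).
  have -> : S = (fun w : 'rV[R]_d => dot w^T (1%:M *m w^T)) @^-1` [set 1].
    by apply/seteqP; split => w /=; rewrite /S/= mul1mx.
  by apply: closed_comp => [w _|]; [exact: quad_continuous|exact: closed_eq].
have [w Sw wmax] : exists2 w : 'rV[R]_d, S w &
    forall u, S u -> dot u^T (G *m u^T) <= dot w^T (G *m w^T).
  have [|w /set_mem Sw wmax] := @EVT_max_rV R d
      (fun v : 'rV[R]_d => dot v^T (G *m v^T)) S S0 cS.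
    by apply: continuous_subspaceT => x; exact: quad_continuous.
  by exists w => // u /mem_set; exact: wmax.
set l := dot w^T (G *m w^T) in wmax.
have lmax (u : 'cV[R]_d) : dot u (G *m u) <= l * dot u u.
  have [->|u0] := eqVneq u 0; first by rewrite mulmx0 /dot mulmx0 mxE mulr0.
  have := wmax _ (unit_norm _ u0).
  rewrite trmxK -scalemxAr dotZl dotZr mulrA -invfM -expr2 sqr_eucl_norm.
  rewrite mulrC ler_pdivrMr// lt_neqAle dot_ge0 andbT eq_sym.
  by apply: contra_neq u0; exact: dot_eq0.
apply: (le_trans (lmax v)); apply: ler_wpM2r; first exact: dot_ge0.
apply: gmax; apply/eigenvalueP; exists w; last first.
  apply/eqP => w0; move: Sw; rewrite /S/= w0 trmx0 /dot mulmx0 mxE => /esym/eqP.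
  by rewrite oner_eq0.
(* at a maximiser the positive form [l - G] degenerates, so [l w = G w] *)
pose B := l%:M - G.
have sB : B^T = B by rewrite /B linearB/= tr_scalar_mx sG.
have BE u : dot u (B *m u) = l * dot u u - dot u (G *m u).
  by rewrite /B mulmxBl mul_scalar_mx dotBr dotZr.
have B0 u : 0 <= dot u (B *m u) by rewrite BE subr_ge0.
have Bw : B *m w^T = 0.
  apply: dot_eq0; apply/eqP; rewrite -normr_le0.
  apply: (le_trans (psd_cauchy_schwarz _ _ sB B0)).
  by rewrite (BE w^T) Sw mulr1 subrr sqrtr0 mulr0.
move: Bw; rewrite /B mulmxBl mul_scalar_mx => /subr0_eq /(congr1 trmx).
by rewrite linearZ/= trmx_mul trmxK sG => ->.
Qed.

End lyapunov_matrix.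

(** * Two-sided bounds on the Lyapunov matrix *)

Section lyapunov_bounds.
Context (R : realType) (d : nat) (Gam Abar : 'M[R]_d) (g : R).
Hypotheses (d_gt0 : (0 < d)%N) (Gam_posdef : sym_posdef Gam)
  (Gam_lyapunov : Abar^T *m Gam + Gam *m Abar = - 1%:M)
  (g_max : is_max_eigenvalue Gam g) (Abar_bounded : form_bounded Abar 1).

Lemma posdef_quad_ge0 v : 0 <= dot v (Gam *m v).
Proof.
have [->|v0] := eqVneq v 0; first by rewrite mulmx0 /dot mulmx0 mxE.
by apply: ltW; rewrite /dot mulmxA; exact: (proj2 Gam_posdef).
Qed.

Lemma max_eigenvalue_gt0 : 0 < g.
Proof.
have [/eigenvalueP[v vg v0] _] := g_max.
have [sG Gp] := Gam_posdef.
have u0 : v^T != 0 by rewrite trmx_eq0.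
have Gu : Gam *m v^T = g *: v^T by rewrite -[Gam]sG -trmx_mul vg linearZ.
have := Gp _ u0; rewrite -mulmxA -/(dot _ _) Gu dotZr.
by rewrite pmulr_lgt0// lt_neqAle dot_ge0 andbT eq_sym (contra_neq _ u0)//; exact: dot_eq0.
Qed.

Let g_ge0 : 0 <= g. Proof. exact: ltW max_eigenvalue_gt0. Qed.

Lemma posdef_form_bounded : form_bounded Gam g.
Proof.
have [sG _] := Gam_posdef.
have sq w : Num.sqrt (dot w (Gam *m w)) <= Num.sqrt g * eucl_norm w.
  by rewrite eucl_norm_sqrt -sqrtrM// ler_wsqrtr// rayleigh.
move=> u v; apply: (le_trans (psd_cauchy_schwarz u v sG posdef_quad_ge0)).
apply: (le_trans (ler_pM (sqrtr_ge0 _) (sqrtr_ge0 _) (sq u) (sq v))).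
by rewrite mulrACA -expr2 sqr_sqrtr// mulrA.
Qed.

Let lyapunov_quad v : dot v v = - 2 * dot v (Gam *m (Abar *m v)).
Proof.
have [sG _] := Gam_posdef.
have := congr1 (fun M => dot v (M *m v)) Gam_lyapunov.
rewrite mulmxDl dotDr mulNmx mul1mx dotNr -!mulmxA.
rewrite [in X in X + _ = _]dot_mulmx trmxK.
by rewrite [in X in X + _ = _]dot_mulmx sG dotC; lra.
Qed.

(** The Lyapunov equation gives [|v|^2 = -2 <v, Gam Abar v> <= 2 g |v|^2], and [0 < d] supplies a
    nonzero [v]. This converts smallness of [alpha * tau * g] into smallness of [alpha * tau]. *)
Lemma max_eigenvalue_ge : 1 / 2 <= g.
Proof.
pose v : 'cV[R]_d := const_mx 1.
have v0 : 0 < dot v v.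
  rewrite lt_neqAle dot_ge0 andbT eq_sym; apply/eqP => /dot_eq0.
  move=> /colP/(_ (Ordinal d_gt0)); rewrite !mxE => /eqP.
  by rewrite oner_eq0.
have : dot v v <= 2 * g * dot v v.
  have h1 : `|dot v (Gam *m (Abar *m v))| <= g * dot v v.
    apply: (le_trans (posdef_form_bounded _ _)).
    rewrite -sqr_eucl_norm expr2 mulrA ler_wpM2l ?mulr_ge0 ?eucl_norm_ge0//.
    by rewrite -[leRHS]mul1r form_bounded_mulmx.
  have := ler_norm (- dot v (Gam *m (Abar *m v))).
  by rewrite normrN {1}lyapunov_quad => h2; lra.
by rewrite -{1}[dot v v]mul1r ler_pM2r// => h; lra.
Qed.

(* The Lyapunov equation with [|Abar| <= 1] also bounds [Gam] from below:
   [|v|^2 = -2 <v, Gam Abar v> <= 2 |v|_Gam |Abar v|_Gam]. *)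
Lemma lyapunov_lower_bound v : dot v v <= 4 * g * dot v (Gam *m v).
Proof.
have [sG _] := Gam_posdef.
have [v0|v0] := eqVneq (eucl_norm v) 0.
  by rewrite (eucl_norm_eq0 v0) mulmx0 /dot mulmx0 mxE mulr0.
have vp : 0 < eucl_norm v by rewrite lt_neqAle eq_sym v0 eucl_norm_ge0.
set W := dot v (Gam *m v); have W0 : 0 <= W := posdef_quad_ge0 v.
have hA : Num.sqrt (dot (Abar *m v) (Gam *m (Abar *m v))) <=
    Num.sqrt g * eucl_norm v.
  rewrite eucl_norm_sqrt -sqrtrM// ler_wsqrtr//.
  apply: (le_trans (rayleigh sG g_max _)); rewrite ler_wpM2l//.
  rewrite -!sqr_eucl_norm ler_pXn2r ?nnegrE ?eucl_norm_ge0//.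
  by rewrite -[leRHS]mul1r form_bounded_mulmx.
have h : eucl_norm v <= 2 * (Num.sqrt W * Num.sqrt g).
  rewrite -(ler_pM2r vp) -expr2 sqr_eucl_norm lyapunov_quad.
  have := psd_cauchy_schwarz v (Abar *m v) sG posdef_quad_ge0.
  have := ler_wpM2l (sqrtr_ge0 W) hA.
  have := ler_norm (- dot v (Gam *m (Abar *m v))).
  by rewrite normrN -/W mulrA; lra.
rewrite -sqr_eucl_norm; have -> : 4 * g * W = (2 * (Num.sqrt W * Num.sqrt g)) ^+ 2.
  by rewrite !exprMn !sqr_sqrtr//; ring.
by rewrite ler_pXn2r// ?nnegrE ?eucl_norm_ge0// !mulr_ge0 ?sqrtr_ge0.
Qed.

End lyapunov_bounds.

(** * Expectations of matrix-valued functions *)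

Section expectations.
Context (R : realType) dT (T : measurableType dT).
Variable mu : {measure set T -> \bar R}.

Definition mx_integrable m n (G : T -> 'M[R]_(m, n)) :=
  forall i j, mu.-integrable setT (EFin \o (fun x => G x i j)).

Lemma integrable_sumEFin (I : Type) (s : seq I) (h : I -> T -> R) :
  (forall i, mu.-integrable setT (EFin \o h i)) ->
  mu.-integrable setT (EFin \o (fun x => \sum_(i <- s) h i x)).
Proof.
move=> hi.
apply: (@eq_integrable _ _ _ mu setT measurableT
  (fun x => \sum_(i <- s) (h i x)%:E)%E) => [x _|].
  by rewrite /= sumEFin.
by apply: integrable_sum => // i _; exact: hi.
Qed.

Lemma Rintegral_sum (I : Type) (s : seq I) (h : I -> T -> R) :
  (forall i, mu.-integrable setT (EFin \o h i)) ->
  \int[mu]_x (\sum_(i <- s) h i x) = \sum_(i <- s) \int[mu]_x h i x.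
Proof.
move=> hi; elim: s => [|i s IHs].
  under eq_Rintegral do rewrite big_nil; rewrite big_nil.
  by rewrite Rintegral_cst// mul0r.
under eq_Rintegral do rewrite big_cons.
by rewrite RintegralD// ?IHs ?big_cons//; exact: integrable_sumEFin.
Qed.

Lemma integrableZlR a (h : T -> R) : mu.-integrable setT (EFin \o h) ->
  mu.-integrable setT (EFin \o (fun x => a * h x)).
Proof.
move=> hi; apply: (@eq_integrable _ _ _ mu setT measurableT
  (fun x => a%:E * (h x)%:E)%E) => [x _//|].
exact: integrableZl.
Qed.

Lemma integrableDR (f h : T -> R) : mu.-integrable setT (EFin \o f) ->
  mu.-integrable setT (EFin \o h) ->
  mu.-integrable setT (EFin \o (fun x => f x + h x)).
Proof.
move=> fi hi; apply: (@eq_integrable _ _ _ mu setT measurableT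
  ((EFin \o f) \+ (EFin \o h))%E) => [x _//|].
exact: integrableD.
Qed.

Lemma mx_integrableMl m n p (M : 'M[R]_(p, m)) (G : T -> 'M[R]_(m, n)) :
  mx_integrable G -> mx_integrable (fun x => M *m G x).
Proof.
move=> Gi i j; under [X in _.-integrable _ X]eq_fun do rewrite /= mxE.
by apply: integrable_sumEFin => k; exact: integrableZlR.
Qed.

Lemma mx_integrable_tr m n (G : T -> 'M[R]_(m, n)) :
  mx_integrable G -> mx_integrable (fun x => (G x)^T).
Proof.
by move=> Gi i j; under [X in _.-integrable _ X]eq_fun do rewrite /= mxE; exact: Gi.
Qed.

Lemma mx_integrableMr m n p (M : 'M[R]_(n, p)) (G : T -> 'M[R]_(m, n)) :
  mx_integrable G -> mx_integrable (fun x => G x *m M).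
Proof.
move=> Gi; have -> : (fun x => G x *m M) = fun x => (M^T *m (G x)^T)^T.
  by apply/funext => x; rewrite trmx_mul !trmxK.
by apply/mx_integrable_tr/mx_integrableMl/mx_integrable_tr.
Qed.

Lemma expect_mxD m n (G H : T -> 'M[R]_(m, n)) :
  mx_integrable G -> mx_integrable H ->
  expect_mx mu (fun x => G x + H x) = expect_mx mu G + expect_mx mu H.
Proof.
move=> Gi Hi; apply/matrixP => i j; rewrite !mxE -RintegralD//.
by apply: eq_Rintegral => x _; rewrite mxE.
Qed.

Lemma expect_mxMl m n p (M : 'M[R]_(p, m)) (G : T -> 'M[R]_(m, n)) :
  mx_integrable G ->
  expect_mx mu (fun x => M *m G x) = M *m expect_mx mu G.
Proof.
move=> Gi; apply/matrixP => i j; rewrite !mxE.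
under eq_Rintegral do rewrite mxE.
rewrite Rintegral_sum => [|k]; last exact: integrableZlR.
by apply: eq_bigr => k _; rewrite mxE RintegralZl.
Qed.

Lemma expect_mx_tr m n (G : T -> 'M[R]_(m, n)) :
  expect_mx mu (fun x => (G x)^T) = (expect_mx mu G)^T.
Proof.
apply/matrixP => i j; rewrite !mxE.
by apply: eq_Rintegral => x _; rewrite mxE.
Qed.

Lemma expect_mxMr m n p (M : 'M[R]_(n, p)) (G : T -> 'M[R]_(m, n)) :
  mx_integrable G ->
  expect_mx mu (fun x => G x *m M) = expect_mx mu G *m M.
Proof.
move=> Gi; apply: trmx_inj; rewrite -expect_mx_tr trmx_mul.
rewrite -expect_mx_tr -expect_mxMl; last exact: mx_integrable_tr.
by congr expect_mx; apply/funext => x; rewrite trmx_mul.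
Qed.

Lemma expect_mxZ m n a (G : T -> 'M[R]_(m, n)) : mx_integrable G ->
  expect_mx mu (fun x => a *: G x) = a *: expect_mx mu G.
Proof.
move=> Gi; rewrite -mul_scalar_mx -expect_mxMl//.
by congr expect_mx; apply/funext => x; rewrite mul_scalar_mx.
Qed.

Lemma expect_mx_cst m n (M : 'M[R]_(m, n)) : mu setT = 1%E ->
  expect_mx mu (fun=> M) = M.
Proof.
by move=> mu1; apply/matrixP => i j; rewrite mxE Rintegral_cst// mu1 mulr1.
Qed.

Lemma dot_expect_mx m u (f : T -> 'cV[R]_m) : mx_integrable f ->
  dot u (expect_mx mu f) = \int[mu]_x dot u (f x).
Proof. by move=> fi; rewrite /dot -expect_mxMl// mxE. Qed.

Lemma form_expect_mx m u v (G : T -> 'M[R]_m) : mx_integrable G ->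
  dot u (expect_mx mu G *m v) = \int[mu]_x dot u (G x *m v).
Proof.
move=> Gi; rewrite -expect_mxMr// dot_expect_mx//.
exact: mx_integrableMr.
Qed.

End expectations.

(** * Bounded measurable functions and their images under the kernel *)

Section bounded_measurable.
Context (R : realType) dT (T : measurableType dT).

Definition bmeas (f : T -> R) :=
  measurable_fun setT f /\ exists c, forall x, `|f x| <= c.

Lemma bmeas_cst c : bmeas (fun=> c).
Proof. by split; [exact: measurable_cst|exists `|c|]. Qed.

Lemma bmeasD f g : bmeas f -> bmeas g -> bmeas (fun x => f x + g x).
Proof.
move=> [mf [c fc]] [mg [e ge]]; split; first exact: measurable_funD.
by exists (c + e) => x; apply: (le_trans (ler_normD _ _)); exact: lerD.
Qed.

Lemma bmeasM f g : bmeas f -> bmeas g -> bmeas (fun x => f x * g x).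
Proof.
move=> [mf [c fc]] [mg [e ge]]; split; first exact: measurable_funM.
by exists (c * e) => x; rewrite normrM ler_pM.
Qed.

Lemma bmeas_sum (I : Type) (s : seq I) (f : I -> T -> R) :
  (forall i, bmeas (f i)) -> bmeas (fun x => \sum_(i <- s) f i x).
Proof.
move=> fb; elim: s => [|i s IHs].
  by under eq_fun do rewrite big_nil; exact: bmeas_cst.
by under eq_fun do rewrite big_cons; exact: bmeasD.
Qed.

Lemma bmeas_integrable (mu : {measure set T -> \bar R}) f :
  (mu setT < +oo)%E -> bmeas f -> mu.-integrable setT (EFin \o f).
Proof.
move=> mufin [mf [c fc]]; apply: measurable_bounded_integrable => //.
by exists c; split; [exact: num_real|move=> x cx y _; exact: le_trans (fc y) (ltW cx)].
Qed.

Definition bmeas_mx m n (G : T -> 'M[R]_(m, n)) :=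
  forall i j, bmeas (fun x => G x i j).

Lemma bmeas_mx_cst m n (M : 'M[R]_(m, n)) : bmeas_mx (fun=> M).
Proof. by move=> i j; exact: bmeas_cst. Qed.

Lemma bmeas_mxD m n (G H : T -> 'M[R]_(m, n)) :
  bmeas_mx G -> bmeas_mx H -> bmeas_mx (fun x => G x + H x).
Proof. by move=> Gb Hb i j; under eq_fun do rewrite mxE; exact: bmeasD. Qed.

Lemma bmeas_mxM m n p (G : T -> 'M[R]_(m, n)) (H : T -> 'M[R]_(n, p)) :
  bmeas_mx G -> bmeas_mx H -> bmeas_mx (fun x => G x *m H x).
Proof.
move=> Gb Hb i j; under eq_fun do rewrite mxE.
by apply: bmeas_sum => k; exact: bmeasM.
Qed.

Lemma bmeas_mx_tr m n (G : T -> 'M[R]_(m, n)) :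
  bmeas_mx G -> bmeas_mx (fun x => (G x)^T).
Proof. by move=> Gb i j; under eq_fun do rewrite mxE; exact: Gb. Qed.

Lemma bmeas_mxZ m n a (G : T -> 'M[R]_(m, n)) :
  bmeas_mx G -> bmeas_mx (fun x => a *: G x).
Proof.
move=> Gb i j; under eq_fun do rewrite mxE.
by apply: bmeasM; [exact: bmeas_cst|exact: Gb].
Qed.

Lemma bmeas_dot m (f g : T -> 'cV[R]_m) : bmeas_mx f -> bmeas_mx g ->
  bmeas (fun x => dot (f x) (g x)).
Proof. by move=> /bmeas_mx_tr fb gb; exact: (bmeas_mxM fb gb). Qed.

Lemma bmeas_mx_integrable (mu : {measure set T -> \bar R}) m n
    (G : T -> 'M[R]_(m, n)) :
  (mu setT < +oo)%E -> bmeas_mx G -> mx_integrable mu G.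
Proof. by move=> mufin Gb i j; exact: bmeas_integrable. Qed.

Lemma Rintegral_le_cst (mu : {measure set T -> \bar R}) f c :
  mu setT = 1%E -> bmeas f -> (forall x, `|f x| <= c) ->
  `|\int[mu]_x f x| <= c.
Proof.
move=> mu1 fb fc; have mufin : (mu setT < +oo)%E by rewrite mu1 ltry.
have fi := bmeas_integrable mufin fb.
have ci := bmeas_integrable mufin (bmeas_cst c).
have fn : bmeas (fun x => `|f x|).
  case: fb => mf [e fe]; split; first exact: measurableT_comp.
  by exists e => x; rewrite normr_id.
apply: (le_trans (le_normr_Rintegral _ fi)) => //.
have -> : c = \int[mu]_x c by rewrite Rintegral_cst// mu1 mulr1.
by apply: le_Rintegral => //; exact: bmeas_integrable.
Qed.

End bounded_measurable.
Arguments bmeas_cst {R dT T} c.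
Arguments bmeas_mx_cst {R dT T m n} M.

Section kernel_operator.
Context (R : realType) dX (X : measurableType dX) (P : R.-pker X ~> X).

Lemma pker_fin x : (P x setT < +oo)%E.
Proof. by rewrite prob_kernel ltry. Qed.

Lemma bmeas_kernel (f : X -> R) : bmeas f -> bmeas (fun x => \int[P x]_y f y).
Proof.
move=> fb; have [mf [c fc]] := fb.
split; last by exists c => x; apply: Rintegral_le_cst => //; exact: prob_kernel.
(* The shift makes the integrand nonnegative, as measurability of a kernel integral requires; the
   kernel has mass one, so the shift is undone by subtracting [c]. *)
have fcb : bmeas (fun y => f y + c) by apply: bmeasD => //; exact: bmeas_cst.
have fc0 y : 0 <= f y + c by have := fc y; rewrite ler_norml => /andP[h _]; lra.
have -> : (fun x => \int[P x]_y f y) =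
    (fun x => fine (\int[P x]_y (f y + c)%:E)%E - c).
  apply/funext => x; rewrite -/(Rintegral (P x) setT (fun y => f y + c)).
  have Pi := @bmeas_integrable _ _ _ (P x) _ (pker_fin x).
  rewrite RintegralD//; [|exact: Pi|exact/Pi/bmeas_cst].
  by rewrite Rintegral_cst// [P x setT]prob_kernel/= mulr1 addrK.
apply: measurable_funB; last exact: measurable_cst.
apply: measurableT_comp; first exact: fine_measurable.
apply: measurable_fun_integral_kernel => [U mU|y|].
- exact: measurable_kernel.
- by rewrite lee_fin.
- by apply/measurable_EFinP; case: fcb.
Qed.

Lemma bmeas_mx_kernel m n (G : X -> 'M[R]_(m, n)) :
  bmeas_mx G -> bmeas_mx (fun x => expect_mx (P x) G).
Proof.
by move=> Gb i j; under eq_fun do rewrite mxE; exact: bmeas_kernel.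
Qed.

Lemma kernel_mx_integrable m n (G : X -> 'M[R]_(m, n)) x :
  bmeas_mx G -> mx_integrable (P x) G.
Proof. by apply: bmeas_mx_integrable; exact: pker_fin. Qed.

End kernel_operator.

(** * Backward operators on quadratic and linear forms *)

Section backward_operators.
Context (R : realType) dX (X : measurableType dX) (P : R.-pker X ~> X).
Context (d : nat) (A : X -> 'M[R]_d) (alpha : R).

Definition averaged m n (G : X -> 'M[R]_(m, n)) x := expect_mx (P x) G.

Definition step_mx x : 'M[R]_d := 1%:M + alpha *: A x.

(* If [w_(k+1) = step_mx (x_k) w_k], then [w_1^T G(x_1) w_1] and [f(x_1)^T w_1]
   have conditional expectations [w_0^T (quad_step G x_0) w_0] and
   [(lin_step f x_0)^T w_0]. *)
Definition quad_step (G : X -> 'M[R]_d) x : 'M[R]_d :=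
  (step_mx x)^T *m averaged G x *m step_mx x.

Definition lin_step (f : X -> 'cV[R]_d) x : 'cV[R]_d :=
  (step_mx x)^T *m averaged f x.

Hypotheses (Ab : bmeas_mx A) (A1 : forall x, form_bounded (A x) 1).
Hypothesis alpha_ge0 : 0 <= alpha.

Lemma bmeas_step_mx : bmeas_mx step_mx.
Proof. by apply: bmeas_mxD; [exact: bmeas_mx_cst|exact: bmeas_mxZ]. Qed.

Lemma bmeas_averaged m n (G : X -> 'M[R]_(m, n)) :
  bmeas_mx G -> bmeas_mx (averaged G).
Proof. exact: bmeas_mx_kernel. Qed.

Lemma bmeas_quad_step G : bmeas_mx G -> bmeas_mx (quad_step G).
Proof.
move=> Gb; apply: bmeas_mxM; last exact: bmeas_step_mx.
by apply: bmeas_mxM; [exact/bmeas_mx_tr/bmeas_step_mx|exact: bmeas_averaged].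
Qed.

Lemma bmeas_lin_step f : bmeas_mx f -> bmeas_mx (lin_step f).
Proof.
by move=> fb; apply: bmeas_mxM; [exact/bmeas_mx_tr/bmeas_step_mx|exact: bmeas_averaged].
Qed.

Lemma bmeas_iter_quad n G : bmeas_mx G -> bmeas_mx (iter n quad_step G).
Proof. by move=> Gb; elim: n => //= n; exact: bmeas_quad_step. Qed.

Lemma bmeas_iter_lin n f : bmeas_mx f -> bmeas_mx (iter n lin_step f).
Proof. by move=> fb; elim: n => //= n; exact: bmeas_lin_step. Qed.

Lemma bmeas_iter_averaged k m n (G : X -> 'M[R]_(m, n)) :
  bmeas_mx G -> bmeas_mx (iter k (@averaged m n) G).
Proof. by move=> Gb; elim: k => //= k; exact: bmeas_averaged. Qed.

Lemma averaged_form u v (G : X -> 'M[R]_d) x : bmeas_mx G ->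
  dot u (averaged G x *m v) = \int[P x]_y dot u (G y *m v).
Proof. by move=> Gb; rewrite form_expect_mx//; exact: kernel_mx_integrable. Qed.

Lemma averaged_dot u (f : X -> 'cV[R]_d) x : bmeas_mx f ->
  dot u (averaged f x) = \int[P x]_y dot u (f y).
Proof. by move=> fb; rewrite dot_expect_mx//; exact: kernel_mx_integrable. Qed.

Lemma bmeas_form u v (G : X -> 'M[R]_d) : bmeas_mx G -> bmeas (fun y => dot u (G y *m v)).
Proof.
move=> Gb; apply: (bmeas_dot (bmeas_mx_cst u)).
by apply: bmeas_mxM => //; exact: bmeas_mx_cst.
Qed.

Lemma averagedD m n (G H : X -> 'M[R]_(m, n)) : bmeas_mx G -> bmeas_mx H ->
  averaged (fun x => G x + H x) = fun x => averaged G x + averaged H x.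
Proof.
by move=> Gb Hb; apply/funext => x; rewrite /averaged expect_mxD//; exact: kernel_mx_integrable.
Qed.

Lemma averagedZ m n a (G : X -> 'M[R]_(m, n)) : bmeas_mx G ->
  averaged (fun x => a *: G x) = fun x => a *: averaged G x.
Proof.
by move=> Gb; apply/funext => x; rewrite /averaged expect_mxZ//; exact: kernel_mx_integrable.
Qed.

Lemma averaged_cst m n (M : 'M[R]_(m, n)) : averaged (fun=> M) = fun=> M.
Proof. by apply/funext => x; rewrite /averaged expect_mx_cst//; exact: prob_kernel. Qed.

Lemma quad_stepD G H : bmeas_mx G -> bmeas_mx H ->
  quad_step (fun x => G x + H x) = fun x => quad_step G x + quad_step H x.
Proof.
move=> Gb Hb; apply/funext => x.
by rewrite /quad_step averagedD//= (mulmxDr _ (averaged G x)) mulmxDl.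
Qed.

Lemma quad_stepZ a G : bmeas_mx G ->
  quad_step (fun x => a *: G x) = fun x => a *: quad_step G x.
Proof.
by move=> Gb; apply/funext => x; rewrite /quad_step averagedZ//= -scalemxAr -scalemxAl.
Qed.

Lemma lin_stepD f g : bmeas_mx f -> bmeas_mx g ->
  lin_step (fun x => f x + g x) = fun x => lin_step f x + lin_step g x.
Proof. by move=> fb gb; apply/funext => x; rewrite /lin_step averagedD//= mulmxDr. Qed.

Lemma lin_stepZ a f : bmeas_mx f ->
  lin_step (fun x => a *: f x) = fun x => a *: lin_step f x.
Proof. by move=> fb; apply/funext => x; rewrite /lin_step averagedZ//= -scalemxAr. Qed.

Lemma iter_quadD n G H : bmeas_mx G -> bmeas_mx H ->
  iter n quad_step (fun x => G x + H x) =
  fun x => iter n quad_step G x + iter n quad_step H x.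
Proof.
by move=> Gb Hb; elim: n => //= n ->; rewrite quad_stepD//; exact: bmeas_iter_quad.
Qed.

Lemma iter_quadZ n a G : bmeas_mx G ->
  iter n quad_step (fun x => a *: G x) = fun x => a *: iter n quad_step G x.
Proof.
by move=> Gb; elim: n => //= n ->; rewrite quad_stepZ//; exact: bmeas_iter_quad.
Qed.

Lemma iter_linD n f g : bmeas_mx f -> bmeas_mx g ->
  iter n lin_step (fun x => f x + g x) =
  fun x => iter n lin_step f x + iter n lin_step g x.
Proof.
by move=> fb gb; elim: n => //= n ->; rewrite lin_stepD//; exact: bmeas_iter_lin.
Qed.

Lemma iter_linZ n a f : bmeas_mx f ->
  iter n lin_step (fun x => a *: f x) = fun x => a *: iter n lin_step f x.
Proof.
by move=> fb; elim: n => //= n ->; rewrite lin_stepZ//; exact: bmeas_iter_lin.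
Qed.

(** The Loewner order, pointwise in the state. Only the diagonal of the forms is compared, so it
    also makes sense for nonsymmetric values. *)
Definition form_le (G H : X -> 'M[R]_d) :=
  forall x v, dot v (G x *m v) <= dot v (H x *m v).

Lemma form_le_trans G H K : form_le G H -> form_le H K -> form_le G K.
Proof. by move=> GH HK x v; exact: le_trans (GH x v) (HK x v). Qed.

Lemma quad_step_form G x u v :
  dot u (quad_step G x *m v) = dot (step_mx x *m u) (averaged G x *m (step_mx x *m v)).
Proof. by rewrite /quad_step -!mulmxA dot_mulmx trmxK. Qed.

Lemma quad_step_le G H : bmeas_mx G -> bmeas_mx H ->
  form_le G H -> form_le (quad_step G) (quad_step H).
Proof.
move=> Gb Hb GH x v; rewrite !quad_step_form !averaged_form//.
have Pi := @bmeas_integrable _ _ _ (P x) _ (pker_fin P x).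
by apply: le_Rintegral => //; exact/Pi/bmeas_form.
Qed.

Lemma iter_quad_le n G H : bmeas_mx G -> bmeas_mx H ->
  form_le G H -> form_le (iter n quad_step G) (iter n quad_step H).
Proof.
by move=> Gb Hb GH; elim: n => //= n; apply: quad_step_le; exact: bmeas_iter_quad.
Qed.

Definition forms_bounded (G : X -> 'M[R]_d) c := forall x, form_bounded (G x) c.

Lemma averaged_bounded G c : bmeas_mx G ->
  forms_bounded G c -> forms_bounded (averaged G) c.
Proof.
move=> Gb Gc x u v; rewrite averaged_form//.
by apply: Rintegral_le_cst; [exact: prob_kernel|exact: bmeas_form|move=> y; exact: Gc].
Qed.

Lemma step_mx_bounded x : form_bounded (step_mx x) (1 + alpha).
Proof.
apply: form_boundedD; first exact: form_bounded1.
by rewrite -[X in form_bounded _ X](ger0_norm alpha_ge0) -[`|_|]mulr1; exact: form_boundedZ.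
Qed.

Lemma quad_step_bounded G c : 0 <= c -> bmeas_mx G -> forms_bounded G c ->
  forms_bounded (quad_step G) ((1 + alpha) ^+ 2 * c).
Proof.
move=> c0 Gb Gc x; have a0 : 0 <= 1 + alpha by rewrite addr_ge0.
rewrite expr2 mulrAC; apply: form_boundedM => //; last exact: step_mx_bounded.
  exact: mulr_ge0.
apply: form_boundedM => //; last exact: averaged_bounded.
exact/form_bounded_tr/step_mx_bounded.
Qed.

Lemma iter_quad_bounded n G c : 0 <= c -> bmeas_mx G -> forms_bounded G c ->
  forms_bounded (iter n quad_step G) ((1 + alpha) ^+ (2 * n) * c).
Proof.
move=> c0 Gb Gc; elim: n => [|n IHn]; first by rewrite muln0 expr0 mul1r.
rewrite mulnS exprD -mulrA; apply: quad_step_bounded => //.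
  by rewrite mulr_ge0// exprn_ge0// addr_ge0.
exact: bmeas_iter_quad.
Qed.

Lemma quad_step_sub_averaged G c : 0 <= c -> bmeas_mx G -> forms_bounded G c ->
  forms_bounded (fun x => quad_step G x - averaged G x) (((1 + alpha) ^+ 2 - 1) * c).
Proof.
move=> c0 Gb Gc x; have Ga := averaged_bounded Gb Gc x.
have -> : quad_step G x - averaged G x =
    alpha *: (averaged G x *m A x) + (alpha *: ((A x)^T *m averaged G x) +
    (alpha ^+ 2) *: ((A x)^T *m averaged G x *m A x)).
  rewrite /quad_step /step_mx [X in X *m _ *m _]linearD/= linearZ/= trmx1 mulmxDl mul1mx.
  rewrite mulmxDr mulmx1 !mulmxDl -!scalemxAr -!scalemxAl scalerA -expr2.
  by rewrite -(addrA (averaged G x)) [X in X - _]addrC addrK addrCA.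
have -> : ((1 + alpha) ^+ 2 - 1) * c =
    `|alpha| * (c * 1) + (`|alpha| * (1 * c) + `|alpha ^+ 2| * (1 * c * 1)).
  by rewrite normrX ger0_norm//; ring.
have At := form_bounded_tr (A1 x).
apply: form_boundedD; first exact/form_boundedZ/form_boundedM.
apply: form_boundedD; apply: form_boundedZ; first exact: form_boundedM.
by apply: form_boundedM => //; [rewrite mul1r|exact: form_boundedM].
Qed.

(** Telescoping: with [L] for [quad_step] and [P] for averaging, [L^(n+1) G - P^(n+1) G] is
    [(L - P)(L^n G)] plus [P (L^n G - P^n G)]. Over [n] steps the dynamics thus differ from pure
    averaging by about [2 * n * alpha]. *)
Lemma iter_quad_sub_averaged n G c : 0 <= c -> bmeas_mx G -> forms_bounded G c ->
  forms_bounded (fun x => iter n quad_step G x - iter n (@averaged d d) G x)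
    (((1 + alpha) ^+ (2 * n) - 1) * c).
Proof.
move=> c0 Gb Gc; elim: n => [|n IHn].
  by move=> x u v; rewrite subrr mul0mx /dot mulmx0 mxE normr0 muln0 expr0 subrr !mul0r.
have c1 : 0 <= (1 + alpha) ^+ (2 * n) * c by rewrite mulr_ge0// exprn_ge0// addr_ge0.
have LGb := bmeas_iter_quad n Gb; have PGb := bmeas_iter_averaged n Gb.
have LPb : bmeas_mx (fun x => iter n quad_step G x - iter n (@averaged d d) G x).
  apply: bmeas_mxD => //; under [X in bmeas_mx X]eq_fun do rewrite -scaleN1r.
  exact: bmeas_mxZ.
have h1 := quad_step_sub_averaged c1 LGb (iter_quad_bounded n c0 Gb Gc).
have h2 := averaged_bounded LPb IHn.
move=> x /=.
have -> : quad_step (iter n quad_step G) x -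
    averaged (iter n (@averaged d d) G) x =
  (quad_step (iter n quad_step G) x - averaged (iter n quad_step G) x) +
  averaged (fun x => iter n quad_step G x - iter n (@averaged d d) G x) x.
  have -> : (fun x => iter n quad_step G x - iter n (@averaged d d) G x) =
      fun x => iter n quad_step G x + (-1) *: iter n (@averaged d d) G x.
    by apply/funext => y; rewrite scaleN1r.
  rewrite averagedD//; last exact: bmeas_mxZ.
  by rewrite averagedZ// scaleN1r addrA subrK.
have -> : ((1 + alpha) ^+ (2 * n.+1) - 1) * c =
    ((1 + alpha) ^+ 2 - 1) * ((1 + alpha) ^+ (2 * n) * c) +
    ((1 + alpha) ^+ (2 * n) - 1) * c.
  by rewrite mulnS exprD; ring.
exact: form_boundedD.
Qed.

Lemma step_mx_expand x v : alpha <= 1 ->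
  (1 - alpha) ^+ 2 * dot v v <= dot (step_mx x *m v) (step_mx x *m v).
Proof.
move=> a1; rewrite -!sqr_eucl_norm -exprMn.
rewrite ler_pXn2r ?nnegrE ?mulr_ge0 ?subr_ge0 ?eucl_norm_ge0//.
have := eucl_normD (step_mx x *m v) (- (alpha *: (A x *m v))).
rewrite {1}/step_mx mulmxDl mul1mx -scalemxAl addrK eucl_normN eucl_normZ.
rewrite ger0_norm//.
have := form_bounded_mulmx v (A1 x) ler01; rewrite mul1r => /(ler_wpM2l alpha_ge0).
by lra.
Qed.

Lemma iter_quad1_ge n : alpha <= 1 ->
  form_le (fun=> ((1 - alpha) ^+ (2 * n))%:M) (iter n quad_step (fun=> 1%:M)).
Proof.
move=> a1; elim: n => [|n IHn]; first by move=> x v; rewrite muln0 expr0.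
have := quad_step_le (bmeas_mx_cst _) (bmeas_iter_quad n (bmeas_mx_cst _)) IHn.
apply: form_le_trans => x v; rewrite quad_step_form averaged_cst.
rewrite !mul_scalar_mx !dotZr mulnS exprD mulrAC mulrC.
by rewrite ler_wpM2l ?step_mx_expand// exprn_ge0// subr_ge0.
Qed.

(* Both relations below pass from [H] to [quad_step H] because [quad_step] and
   [lin_step] are averages against the same nonnegative kernel; they play the
   role of the Cauchy-Schwarz inequality along the chain. *)
Lemma iter_quad_dominated n G H c : bmeas_mx G -> bmeas_mx H ->
  (forall x u v, `|dot u (G x *m v)| <=
     c * (dot u (H x *m u) + dot v (H x *m v))) ->
  forall x u v, `|dot u (iter n quad_step G x *m v)| <=
     c * (dot u (iter n quad_step H x *m u) + dot v (iter n quad_step H x *m v)).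
Proof.
move=> Gb Hb GH; elim: n => //= n IHn x u v.
have GLb := bmeas_iter_quad n Gb; have HLb := bmeas_iter_quad n Hb.
have Pi := @bmeas_integrable _ _ _ (P x) _ (pker_fin P x).
rewrite !quad_step_form !averaged_form//.
set u' := _ *m u; set v' := _ *m v.
have Hu := bmeas_form u' u' HLb; have Hv := bmeas_form v' v' HLb.
have GG := bmeas_form u' v' GLb.
rewrite -RintegralD//; [|exact: Pi..].
rewrite -RintegralZl//; last exact/Pi/bmeasD.
apply: (le_trans (le_normr_Rintegral _ (Pi _ GG))) => //.
apply: le_Rintegral => //.
  case: GG => mG [e Ge]; apply: Pi; split; first exact: measurableT_comp.
  by exists e => y; rewrite normr_id.
by apply: Pi; apply: bmeasM; [exact: bmeas_cst|exact: bmeasD].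
Qed.

Lemma iter_lin_dominated n f H c : bmeas_mx f -> bmeas_mx H ->
  (forall x v, `|dot v (f x)| <= c * (1 + dot v (H x *m v))) ->
  forall x v, `|dot v (iter n lin_step f x)| <=
     c * (1 + dot v (iter n quad_step H x *m v)).
Proof.
move=> fb Hb fH; elim: n => //= n IHn x v.
have fLb := bmeas_iter_lin n fb; have HLb := bmeas_iter_quad n Hb.
have Pi := @bmeas_integrable _ _ _ (P x) _ (pker_fin P x).
rewrite quad_step_form averaged_form// /lin_step dot_mulmx trmxK averaged_dot//.
set v' := _ *m v.
have Hv := bmeas_form v' v' HLb.
have ff := bmeas_dot (bmeas_mx_cst v') fLb.
have -> : c * (1 + \int[P x]_y dot v' (iter n quad_step H y *m v')) =
    \int[P x]_y (c * (1 + dot v' (iter n quad_step H y *m v'))).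
  rewrite RintegralZl//; last by apply/Pi/bmeasD => //; exact: bmeas_cst.
  rewrite RintegralD//; [|exact/Pi/bmeas_cst|exact: Pi].
  by rewrite Rintegral_cst// [P x setT]prob_kernel mulr1.
apply: (le_trans (le_normr_Rintegral _ (Pi _ ff))) => //.
apply: le_Rintegral => //.
  case: ff => mG [e Ge]; apply: Pi; split; first exact: measurableT_comp.
  by exists e => y; rewrite normr_id.
apply: Pi; apply: bmeasM; first exact: bmeas_cst.
by apply: bmeasD => //; exact: bmeas_cst.
Qed.

(** The decay of the single iterate started at the identity controls every bounded starting form,
    including nonsymmetric ones such as [u *m v^T]. *)
Lemma iter_quad_decay n h G c : 0 <= c -> 0 <= h -> bmeas_mx G ->
  (forall x v, dot v (iter n quad_step (fun=> 1%:M) x *m v) <= h ^+ 2 * dot v v) ->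
  forms_bounded G c -> forms_bounded (iter n quad_step G) (h ^+ 2 * c).
Proof.
move=> c0 h0 Gb hn Gc x u v.
have -> : h ^+ 2 * c * eucl_norm u * eucl_norm v =
    (Num.sqrt c * (h * eucl_norm u)) * (Num.sqrt c * (h * eucl_norm v)).
  by rewrite -[in LHS](sqr_sqrtr c0); ring.
apply: le_mul_scale; rewrite ?mulr_ge0 ?sqrtr_ge0 ?eucl_norm_ge0// => t t0.
have s0 : 0 < Num.sqrt t by rewrite sqrtr_gt0.
(* The value at [(u, v)] is unchanged when [u] is multiplied and [v] divided by the square root of
   [t]; varying [t] turns the sum of the two diagonal terms into their geometric mean. *)
have dom := @iter_quad_dominated n G (fun=> 1%:M) (c / 2) Gb (bmeas_mx_cst _).
have {}dom := dom _ x (Num.sqrt t *: u) ((Num.sqrt t)^-1 *: v).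
have : `|dot u (iter n quad_step G x *m v)| <=
    c / 2 * (t * (h ^+ 2 * dot u u) + t^-1 * (h ^+ 2 * dot v v)).
  have -> : dot u (iter n quad_step G x *m v) =
      dot (Num.sqrt t *: u) (iter n quad_step G x *m ((Num.sqrt t)^-1 *: v)).
    by rewrite -scalemxAr dotZr dotZl mulrA mulVf ?gt_eqF// mul1r.
  apply: (le_trans (dom _)) => [y u' v'|].
    apply: (le_trans (Gc _ _ _)); rewrite !mul1mx -!sqr_eucl_norm.
    have := mulr_ge0 c0 (sqr_ge0 (eucl_norm u' - eucl_norm v')).
    by rewrite sqrrB; lra.
  rewrite ler_wpM2l ?divr_ge0// lerD// -scalemxAr dotZr dotZl mulrA.
    by rewrite -expr2 sqr_sqrtr ?(ltW t0)// ler_wpM2l ?(ltW t0).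
  by rewrite -expr2 exprVn sqr_sqrtr ?(ltW t0)// ler_wpM2l ?invr_ge0 ?(ltW t0).
rewrite !exprMn !sqr_eucl_norm !sqr_sqrtr// => dd.
apply: (le_trans (ler_wpM2l _ dd)) => //; rewrite le_eqVlt; apply/orP; left.
by apply/eqP; field; rewrite gt_eqF.
Qed.

(** The comparison is with [1] plus a quadratic form. Averaging preserves the [1] while the form
    shrinks by [h ^+ 2]; the geometric mean of the two leaves only one factor [h]. *)
Lemma iter_lin_decay n h f c : 0 <= c -> 0 <= h -> bmeas_mx f ->
  (forall x v, dot v (iter n quad_step (fun=> 1%:M) x *m v) <= h ^+ 2 * dot v v) ->
  (forall x, eucl_norm (f x) <= c) ->
  forall x, eucl_norm (iter n lin_step f x) <= h * c.
Proof.
move=> c0 h0 fb hn fc x.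
suff H v : `|dot v (iter n lin_step f x)| <= eucl_norm v * (h * c).
  have := H (iter n lin_step f x); rewrite -sqr_eucl_norm ger0_norm ?sqr_ge0//.
  set e := eucl_norm _; have : 0 <= e := eucl_norm_ge0 _.
  rewrite le_eqVlt => /predU1P[<- _|e0]; first exact: mulr_ge0.
  by rewrite expr2 ler_pM2l.
have -> : eucl_norm v * (h * c) = (Num.sqrt c * (h * eucl_norm v)) * Num.sqrt c.
  by rewrite -[in LHS](sqr_sqrtr c0); ring.
apply: le_mul_scale; rewrite ?mulr_ge0 ?sqrtr_ge0 ?eucl_norm_ge0// => t t0.
have dom := @iter_lin_dominated n f (fun=> 1%:M) (c / 2) fb (bmeas_mx_cst _).
have {}dom := dom _ x (t *: v).
have : t * `|dot v (iter n lin_step f x)| <= c / 2 * (1 + t ^+ 2 * (h ^+ 2 * dot v v)).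
  rewrite -[X in X * `|_|](gtr0_norm t0) -normrM -dotZl.
  apply: (le_trans (dom _)) => [y v'|].
    apply: (le_trans (cauchy_schwarz _ _)); rewrite mul1mx -!sqr_eucl_norm.
    have := ler_wpM2l (eucl_norm_ge0 v') (fc y).
    have := mulr_ge0 c0 (sqr_ge0 (eucl_norm v' - 1)).
    by rewrite sqrrB; lra.
  rewrite ler_wpM2l ?divr_ge0// lerD2l -scalemxAr dotZr dotZl mulrA -expr2.
  by rewrite ler_wpM2l ?sqr_ge0.
rewrite !exprMn !sqr_eucl_norm !sqr_sqrtr// => dd.
rewrite -(ler_pM2l t0) [leLHS]mulrCA.
apply: (le_trans (ler_wpM2l _ dd)) => //; rewrite le_eqVlt; apply/orP; left.
by apply/eqP; field; rewrite gt_eqF.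
Qed.

End backward_operators.

(** * Bernoulli bounds on powers *)

Section powers.
Context (R : realFieldType).
Implicit Types (a : R) (n : nat).

Lemma bernoulli_le a n : 0 <= a -> a <= 1 -> 1 - n%:R * a <= (1 - a) ^+ n.
Proof.
move=> a0 a1; elim: n => [|n IHn]; first by rewrite mul0r subr0 expr0.
have h : 0 <= 1 - a by rewrite subr_ge0.
rewrite exprS; apply: le_trans (ler_wpM2l h IHn).
have : 0 <= n%:R * a * a by rewrite !mulr_ge0.
by rewrite -natr1; lra.
Qed.

(** By Bernoulli the product is at most [(1 - a ^+ 2) ^+ n]. This is an upper bound on
    [(1 + a) ^+ n] free of exponentials. *)
Lemma exp1D_le a n : 0 <= a -> a <= 1 -> (1 + a) ^+ n * (1 - n%:R * a) <= 1.
Proof.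
move=> a0 a1; have h : 0 <= (1 + a) ^+ n by rewrite exprn_ge0// addr_ge0.
apply: (le_trans (ler_wpM2l h (bernoulli_le n a0 a1))).
rewrite -exprMn exprn_ile1//; first by rewrite mulr_ge0 ?subr_ge0 ?addr_ge0.
by have := sqr_ge0 a; lra.
Qed.

End powers.

(** * Contraction from the Lyapunov equation and mixing *)

Section contraction.
Context (R : realType) dX (X : measurableType dX) (P : R.-pker X ~> X).
Context (d : nat) (A : X -> 'M[R]_d) (Abar Gam : 'M[R]_d) (alpha g : R).
Context (tau : nat).
Hypotheses (Ab : bmeas_mx A) (A1 : forall x, form_bounded (A x) 1).
Hypotheses (alpha_gt0 : 0 < alpha) (tau_gt0 : (1 <= tau)%N).
Hypothesis small_step : alpha * tau%:R < (5 / 100) / (95 * g).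
Hypotheses (g_ge : 1 / 2 <= g) (Gamg : form_bounded Gam g).
Hypothesis lower : forall v, dot v v <= 4 * g * dot v (Gam *m v).
Hypothesis lyapunov : Abar^T *m Gam + Gam *m Abar = - 1%:M.
Hypothesis mixing :
  forall x, form_bounded (iter tau (@averaged _ _ _ P d d) A x - Abar) alpha.

Let g_gt0 : 0 < g. Proof. by have := g_ge; lra. Qed.

Definition rate := 1 - 9 / 10 * alpha / g.

(** Here [1900] is [95 / 0.05]; all numerical slack below is drawn from this bound and from
    [1 / 2 <= g]. *)
Let gs : alpha * tau%:R * g < 1 / 1900.
Proof. by move: small_step; rewrite ltr_pdivlMr ?mulr_gt0//; lra. Qed.

Let alpha_le_s : alpha <= alpha * tau%:R.
Proof. by rewrite ler_peMr ?(ltW alpha_gt0)// ler1n. Qed.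

Let s_lt : alpha * tau%:R < 1 / 950.
Proof.
have : alpha * tau%:R * (1 / 2) <= alpha * tau%:R * g.
  by rewrite ler_wpM2l// mulr_ge0 ?(ltW alpha_gt0).
by have := gs; lra.
Qed.

Let ag : alpha * g < 1 / 1900.
Proof. by apply: le_lt_trans gs; rewrite ler_wpM2r ?(ltW g_gt0). Qed.

Let alpha_lt1 : alpha < 1.
Proof. by have := s_lt; have := alpha_le_s; lra. Qed.

Let alpha_div : alpha / g <= 4 * (alpha * g).
Proof.
rewrite ler_pdivrMr//; have : alpha * 1 <= alpha * (4 * g * g).
  rewrite ler_wpM2l ?(ltW alpha_gt0)//.
  have h : 0 <= g - 1 / 2 by rewrite subr_ge0.
  by have := mulr_ge0 h h; have := g_ge; lra.
by lra.
Qed.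

Lemma rate_lt1 : rate < 1.
Proof. by rewrite /rate ltrBlDr ltrDl -mulrA mulr_gt0 ?divr_gt0. Qed.

Lemma rate_ge : 99 / 100 <= rate.
Proof. by rewrite /rate; have := alpha_div; have := ag; rewrite -mulrA; lra. Qed.

Let rate_tau : 1 / 2 <= rate ^+ tau.
Proof.
have := @bernoulli_le R (9 / 10 * alpha / g) tau.
have h1 : 0 <= alpha / g by rewrite divr_ge0 ?(ltW alpha_gt0) ?(ltW g_gt0).
have h2 : tau%:R * (alpha / g) <= 4 * (alpha * tau%:R * g).
  have := ler_wpM2l (ler0n R tau) alpha_div; lra.
move=> h; apply: le_trans (h _ _); have := rate_ge; have := rate_lt1; rewrite /rate.
- have -> : tau%:R * (9 / 10 * alpha / g) = 9 / 10 * (tau%:R * (alpha / g)) by ring.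
  by move: h2; have := gs; lra.
- by lra.
- by lra.
Qed.

(** With [s = alpha * tau], [(1 + 2.1 s)(1 - 2 s) >= 1] as soon as [s <= 1 / 42]. *)
Let pow_upper : (1 + alpha) ^+ (2 * tau) <= 1 + 21 / 10 * (alpha * tau%:R).
Proof.
have := @exp1D_le R alpha (2 * tau) (ltW alpha_gt0) (ltW alpha_lt1).
set p := _ ^+ _; rewrite natrM => h.
have s0 : 0 < alpha * tau%:R by apply: lt_le_trans alpha_le_s.
move: s0 s_lt h; rewrite mulrAC -mulrA; set s := alpha * _ => s0 s1 h.
have q0 : 0 < 1 - 2 * s by lra.
rewrite -(ler_pM2r q0); apply: (le_trans h).
have : s * s <= s * (1 / 950) by rewrite ler_wpM2l ?ltW.
by lra.
Qed.

Let pow_lower : 99 / 100 <= (1 - alpha) ^+ (2 * tau).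
Proof.
apply: le_trans (bernoulli_le _ (ltW alpha_gt0) (ltW alpha_lt1)).
by rewrite natrM -mulrA (mulrC tau%:R); have := s_lt; lra.
Qed.

(* The deviation of [x^T A^T Gam x + x^T Gam A x] from its mean [- |x|^2]. *)
Let N x := (A x)^T *m Gam + Gam *m A x + 1%:M.

Let Nb : bmeas_mx N.
Proof.
apply: bmeas_mxD; last exact: bmeas_mx_cst.
by apply: bmeas_mxD; apply: bmeas_mxM => //;
  first [exact: bmeas_mx_cst|exact: bmeas_mx_tr].
Qed.

Let N_bounded : forms_bounded N (4 * g).
Proof.
move=> x; apply: (@form_bounded_le _ _ _ (1 * g + g * 1 + 1)); first by have := g_ge; lra.
apply: form_boundedD; last exact: form_bounded1.
by apply: form_boundedD; apply: form_boundedM => //;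
  first [exact: ltW|exact: form_bounded_tr].
Qed.

Let iter_averaged_N n x : iter n (@averaged _ _ _ P d d) N x =
  (iter n (@averaged _ _ _ P d d) A x)^T *m Gam +
  Gam *m iter n (@averaged _ _ _ P d d) A x + 1%:M.
Proof.
elim: n => //= n IHn in x *; set An := iter n _ A in IHn *.
have Anb : bmeas_mx An by exact: bmeas_iter_averaged.
have -> : iter n (@averaged _ _ _ P d d) N =
    fun x => ((An x)^T *m Gam + Gam *m An x) + 1%:M.
  by apply/funext => y; exact: IHn.
have Gb := bmeas_mx_cst Gam.
have h1 : bmeas_mx (fun x => (An x)^T *m Gam).
  by apply: bmeas_mxM => //; exact: bmeas_mx_tr.
have h2 : bmeas_mx (fun x => Gam *m An x) by exact: bmeas_mxM.
rewrite averagedD; [|exact: bmeas_mxD|exact: bmeas_mx_cst].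
rewrite averagedD// averaged_cst; congr (_ + _ + _).
  rewrite /averaged expect_mxMr ?expect_mx_tr//.
  by apply: kernel_mx_integrable; exact: bmeas_mx_tr.
by rewrite /averaged expect_mxMl//; exact: kernel_mx_integrable.
Qed.

(** The identity in [N] cancels against the Lyapunov equation, so only [PA - Abar] remains, once on
    each side of [Gam]. *)
Let averaged_N_bounded x :
  form_bounded (iter tau (@averaged _ _ _ P d d) N x) (2 * (g * alpha)).
Proof.
rewrite iter_averaged_N; move: (mixing x); move: (iter _ _ _ x) => PA mPA.
have -> : PA^T *m Gam + Gam *m PA + 1%:M =
    (PA - Abar)^T *m Gam + Gam *m (PA - Abar).
  rewrite linearB/= mulmxBl mulmxBr addrACA -opprD lyapunov opprK.
  by [].
have -> : 2 * (g * alpha) = alpha * g + g * alpha by ring.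
have [g0 a0] := (ltW g_gt0, ltW alpha_gt0).
apply: form_boundedD; last exact: form_boundedM.
by apply: form_boundedM => //; exact: form_bounded_tr.
Qed.

Local Notation L := (quad_step P A alpha).

Let Gb := @bmeas_mx_cst _ _ X _ _ Gam.
Let Ib := @bmeas_mx_cst R _ X d d 1%:M.

(** [L^tau N] is within [((1 + alpha)^(2 tau) - 1) * 4 g] of the averaged [N], itself at most
    [2 g alpha]; together below [1 / 100]. The iterate of the identity is at least [99 / 100], so
    the error can be absorbed in it with room to spare. *)
Let iter_N_le : form_le (iter tau L N)
  (fun x => (1 / 20) *: iter tau L (fun=> 1%:M) x).
Proof.
have a0 := ltW alpha_gt0.
have g40 : 0 <= 4 * g by rewrite mulr_ge0 ?(ltW g_gt0).
move=> x v; rewrite -scalemxAl dotZr.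
have h1 := iter_quad_sub_averaged P Ab A1 a0 tau g40 Nb N_bounded x v v.
have h2 := averaged_N_bounded x v v.
have h3 := iter_quad1_ge P Ab A1 a0 tau (ltW alpha_lt1) x v.
move: h3; rewrite mul_scalar_mx dotZr => h3.
have h4 : 99 / 100 * dot v v <= dot v (iter tau L (fun=> 1%:M) x *m v).
  by apply: le_trans h3; rewrite ler_wpM2r ?dot_ge0 ?pow_lower.
have h5 : (((1 + alpha) ^+ (2 * tau) - 1) * (4 * g) + 2 * (g * alpha)) * dot v v
    <= 1 / 100 * dot v v.
  rewrite ler_wpM2r ?dot_ge0//.
  have := ler_wpM2r g40 pow_upper; have := gs; have := ag.
  by lra.
move: h1 h2; rewrite mulmxBl dotBr -!mulrA -expr2 sqr_eucl_norm.
rewrite !ler_norml => /andP[_ h1] /andP[_ h2].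
have := dot_ge0 v.
by move: h5 h1 h2; rewrite !mulrDl -!mulrA; lra.
Qed.

(** Expanding the step: the terms of order [alpha] are [-1 + N] by definition of [N], and
    [A^T Gam A] is at most [g]. *)
Let quad_step_Gam_le : form_le (L (fun=> Gam))
  (fun x => (Gam + (- (alpha * (1 - alpha * g))) *: 1%:M) + alpha *: N x).
Proof.
move=> x v; rewrite quad_step_form averaged_cst /step_mx /N.
rewrite !mulmxDl !mul1mx -!scalemxAl !mul1mx !mulmxDl mul1mx.
rewrite !mulmxDr -!scalemxAr !(dotDl, dotDr, dotZl, dotZr).
have -> : dot (A x *m v) (Gam *m v) = dot v ((A x)^T *m Gam *m v).
  by rewrite -mulmxA [RHS]dot_mulmx trmxK.
have -> : dot v (Gam *m (A x *m v)) = dot v (Gam *m A x *m v) by rewrite mulmxA.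
have h1 : dot (A x *m v) (Gam *m (A x *m v)) <= g * dot v v.
  apply: (le_trans (ler_norm _)); apply: (le_trans (Gamg _ _)).
  rewrite -mulrA ler_wpM2l ?(ltW g_gt0)// -expr2 -!sqr_eucl_norm.
  rewrite ler_pXn2r ?nnegrE ?eucl_norm_ge0//.
  by rewrite -[leRHS]mul1r form_bounded_mulmx.
have := ler_wpM2l (sqr_ge0 alpha) h1; rewrite expr2.
by lra.
Qed.

Let iter_Gam_le n : form_le (iter n L (fun=> Gam))
  (fun x => g *: iter n L (fun=> 1%:M) x).
Proof.
rewrite -iter_quadZ//; apply: iter_quad_le => //; first exact: bmeas_mxZ.
move=> x v; rewrite -scalemxAl mul1mx dotZr.
apply: (le_trans (ler_norm _)); apply: (le_trans (Gamg _ _)).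
by rewrite -mulrA -expr2 sqr_eucl_norm.
Qed.

(** The expanded step is the innermost one, so that [tau] iterations still act on [N] and average it
    out. The gain is [1 - alpha * g - 1 / 20 >= 9 / 10] times [alpha] on the iterated identity, and
    [Gam <= g] converts it into a fraction [1 / g] of the iterated [Gam]. *)
Let one_step : form_le (iter tau.+1 L (fun=> Gam))
  (fun x => rate *: iter tau L (fun=> Gam) x).
Proof.
have a0 := ltW alpha_gt0.
rewrite iterSr; move=> x v; rewrite -scalemxAl dotZr.
have GIb : bmeas_mx (fun _ : X => Gam + (- (alpha * (1 - alpha * g))) *: 1%:M).
  exact: bmeas_mx_cst.
have aNb := bmeas_mxZ alpha Nb.
have := iter_quad_le P alpha Ab tau (bmeas_quad_step P alpha Ab Gb)
   (bmeas_mxD GIb aNb) quad_step_Gam_le x v.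
rewrite iter_quadD// iter_quadZ// iter_quadD//; last exact: bmeas_mx_cst.
rewrite (iter_quadZ P alpha Ab tau _ Ib).
rewrite !mulmxDl -!scalemxAl !dotDr !dotZr.
have := iter_N_le x v; have := iter_Gam_le tau x v.
rewrite -!scalemxAl !dotZr.
set l1 := dot v (iter tau L (fun=> 1%:M) x *m v).
set lG := dot v (iter tau L (fun=> Gam) x *m v).
set lN := dot v (iter tau L N x *m v) => h1 h2 h3.
apply: (le_trans h3).
have l10 : 0 <= l1.
  apply: le_trans (iter_quad1_ge P Ab A1 a0 tau (ltW alpha_lt1) x v).
  rewrite mul_scalar_mx dotZr mulr_ge0 ?dot_ge0//.
  by apply: le_trans pow_lower; lra.
have := ler_wpM2l a0 h2.
have : alpha * (alpha * g * l1) <= alpha * (1 / 20 * l1).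
  by rewrite ler_wpM2l// ler_wpM2r//; have := ag; lra.
have : 9 / 10 * (alpha / g) * lG <= 9 / 10 * alpha * l1.
  have h4 : lG / g <= l1 by rewrite ler_pdivrMr// mulrC.
  by have := ler_wpM2l a0 h4; lra.
rewrite /rate; lra.
Qed.

(** The reference is [L^tau Gam], not [Gam]: the contraction inequality relates two iterates that
    have both run for at least [tau] steps, and monotonicity of [L] repeats it. *)
Let iter_Gam_decay j : form_le (iter (tau + j) L (fun=> Gam))
  (fun x => rate ^+ j *: iter tau L (fun=> Gam) x).
Proof.
have r0 : 0 <= rate by have := rate_ge; lra.
elim: j => [|j IHj]; first by move=> x v; rewrite addn0 expr0 scale1r.
have Gnb := bmeas_iter_quad P alpha Ab tau Gb.
rewrite addnS iterS.
have step := @quad_step_le _ _ _ P d A alpha _ _ (bmeas_iter_quad P alpha Ab _ Gb)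
  (bmeas_mxZ (rate ^+ j) Gnb) IHj.
apply: (form_le_trans step); rewrite quad_stepZ// => x v; rewrite -!scalemxAl !dotZr exprSr -mulrA.
rewrite ler_wpM2l ?exprn_ge0//.
by have := one_step x v; rewrite -scalemxAl dotZr.
Qed.

(** [1 <= 4 g Gam] reduces to [Gam]. Its first [tau] iterates grow at most to [2 g], and a further
    factor [2] pays for the missing decay since [rate ^+ tau >= 1 / 2]; hence [4 g] twice. *)
Lemma iter_quad1_decay n x v :
  dot v (iter n L (fun=> 1%:M) x *m v) <= (4 * g) ^+ 2 * rate ^+ n * dot v v.
Proof.
have a0 := ltW alpha_gt0; have g0 := ltW g_gt0.
have r0 : 0 <= rate by have := rate_ge; lra.
have [r1 r2] := (rate_lt1, rate_ge).
have init k y w : (k <= tau)%N ->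
    dot w (iter k L (fun=> Gam) y *m w) <= 2 * g * dot w w.
  move=> ktau; apply: (le_trans (ler_norm _)).
  apply: (le_trans (iter_quad_bounded P Ab A1 a0 k g0 Gb (fun=> Gamg) y w w)).
  rewrite -mulrA -expr2 sqr_eucl_norm ler_wpM2r ?dot_ge0// ler_wpM2r//.
  have : (1 + alpha) ^+ (2 * k) <= (1 + alpha) ^+ (2 * tau).
    by rewrite ler_weXn2l ?lerDl// leq_mul2l.
  by have := pow_upper; have := s_lt; lra.
have Gdecay : dot v (iter n L (fun=> Gam) x *m v) <= 4 * g * rate ^+ n * dot v v.
  case: (leqP n tau) => [ntau|/ltnW taun].
    apply: (le_trans (init _ _ _ ntau)); rewrite ler_wpM2r ?dot_ge0//.
    have : rate ^+ tau <= rate ^+ n by rewrite ler_wiXn2l// ltW.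
    have := rate_tau => h1 h2.
    have : 1 / 2 * g <= rate ^+ n * g by rewrite ler_wpM2r//; lra.
    by lra.
  rewrite -(subnKC taun); apply: (le_trans (iter_Gam_decay _ _ _)).
  rewrite -scalemxAl dotZr exprD.
  have e0 : 0 <= rate ^+ (n - tau) by rewrite exprn_ge0.
  apply: (le_trans (ler_wpM2l e0 (init _ _ _ (leqnn tau)))).
  have : 1 / 2 * (g * rate ^+ (n - tau) * dot v v) <=
      rate ^+ tau * (g * rate ^+ (n - tau) * dot v v).
    rewrite ler_wpM2r ?rate_tau//.
    by apply: mulr_ge0; [exact: mulr_ge0|exact: dot_ge0].
  by lra.
have low : form_le (fun=> 1%:M) (fun _ : X => (4 * g) *: Gam).
  by move=> y w; rewrite mul1mx -scalemxAl dotZr.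
have := iter_quad_le P alpha Ab n Ib (bmeas_mxZ (4 * g) Gb) low x v.
rewrite iter_quadZ// -scalemxAl dotZr => h.
apply: (le_trans h).
have g40 : 0 <= 4 * g by lra.
by apply: (le_trans (ler_wpM2l g40 Gdecay)); rewrite expr2; lra.
Qed.

End contraction.

(** * Decay of the coefficients of the backward functional *)

Section affine_moments.
Context (R : realType) dX (X : measurableType dX) (P : R.-pker X ~> X).
Context (d : nat) (A : X -> 'M[R]_d) (b : X -> 'cV[R]_d) (alpha : R).
Context (Q0 : 'M[R]_d) (q0 : 'cV[R]_d).

(* With [w_(k+1) = step_mx (x_k) w_k + alpha b(x_k)], the function
   [quad_coef k x], [lin_coef k x], [cst_coef k x] are the coefficients of
   [w |-> E(w_k^T Q0 w_k + q0^T w_k | x_0 = x, w_0 = w)]. *)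
Definition quad_coef k : X -> 'M[R]_d := iter k (quad_step P A alpha) (fun=> Q0).

(** The cross terms between [step_mx *m w] and [b] in the quadratic form; both [Q] and its transpose
    occur because [Q] may be nonsymmetric. *)
Definition forcing (Q : X -> 'M[R]_d) x : 'cV[R]_d :=
  (step_mx A alpha x)^T *m ((averaged P Q x + (averaged P Q x)^T) *m b x).

Fixpoint lin_coef k : X -> 'cV[R]_d :=
  if k is k'.+1 then
    fun x => lin_step P A alpha (lin_coef k') x +
             alpha *: forcing (quad_coef k') x
  else fun=> q0.

Fixpoint cst_coef k : X -> R :=
  if k is k'.+1 then
    fun x => \int[P x]_y cst_coef k' y +
      (alpha * dot (b x) (averaged P (lin_coef k') x) +
       alpha ^+ 2 * dot (b x) (averaged P (quad_coef k') x *m b x))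
  else fun=> 0.

Hypotheses (Ab : bmeas_mx A) (bb : bmeas_mx b).

Lemma bmeas_quad_coef k : bmeas_mx (quad_coef k).
Proof. exact: bmeas_iter_quad (bmeas_mx_cst _). Qed.

Lemma bmeas_forcing Q : bmeas_mx Q -> bmeas_mx (forcing Q).
Proof.
move=> Qb; have PQb := bmeas_averaged P Qb.
apply: bmeas_mxM; first exact/bmeas_mx_tr/bmeas_step_mx.
by apply: bmeas_mxM => //; apply: bmeas_mxD => //; exact: bmeas_mx_tr.
Qed.

Lemma bmeas_lin_coef k : bmeas_mx (lin_coef k).
Proof.
elim: k => [|k IHk] /=; first exact: bmeas_mx_cst.
apply: bmeas_mxD; first exact: bmeas_lin_step.
exact/bmeas_mxZ/bmeas_forcing/bmeas_quad_coef.
Qed.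

Lemma bmeas_cst_coef k : bmeas (cst_coef k).
Proof.
elim: k => [|k IHk] /=; first exact: bmeas_cst.
apply: bmeasD; first exact: bmeas_kernel.
apply: bmeasD; (apply: bmeasM; first exact: bmeas_cst); apply: bmeas_dot => //.
  exact/bmeas_averaged/bmeas_lin_coef.
by apply: bmeas_mxM => //; exact/bmeas_averaged/bmeas_quad_coef.
Qed.

Context (g h B c s : R).
Hypotheses (A1 : forall x, form_bounded (A x) 1).
Hypotheses (alpha_ge0 : 0 <= alpha) (alpha_le1 : alpha <= 1).
Hypotheses (g_ge0 : 0 <= g) (h_ge0 : 0 <= h) (B_ge0 : 0 <= B) (c_ge0 : 0 <= c).
Hypotheses (s_ge : 1 / 2 <= s) (s_le1 : s <= 1).
Hypothesis alpha_rate : alpha <= 3 * g * (1 - s).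
Hypothesis decay : forall n x v,
  dot v (iter n (quad_step P A alpha) (fun=> 1%:M) x *m v) <=
  (h * s ^+ n) ^+ 2 * dot v v.
Hypothesis b_bounded : forall x, eucl_norm (b x) <= B.
Hypothesis Q0_bounded : form_bounded Q0 c.

Let s_ge0 : 0 <= s. Proof. by have := s_ge; lra. Qed.

Lemma quad_coef_bounded k : forms_bounded (quad_coef k) ((h * s ^+ k) ^+ 2 * c).
Proof.
apply: iter_quad_decay => //; first by rewrite mulr_ge0// exprn_ge0.
exact: bmeas_mx_cst.
Qed.

(** The [4] is [2] for [1 + alpha <= 2] times [2] for the form plus its transpose. *)
Definition forcing_const := 4 * c * h ^+ 2 * B.

Let forcing_const_ge0 : 0 <= forcing_const.
Proof. by rewrite /forcing_const !mulr_ge0 ?sqr_ge0. Qed.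

Lemma forcing_bounded k x :
  eucl_norm (forcing (quad_coef k) x) <= forcing_const * (s ^+ k * s ^+ k).
Proof.
set e := (h * s ^+ k) ^+ 2 * c.
have e0 : 0 <= e by rewrite mulr_ge0 ?sqr_ge0.
have Qb := averaged_bounded P (bmeas_quad_coef k) (quad_coef_bounded k) x.
have h1 := form_bounded_mulmx ((averaged P (quad_coef k) x +
    (averaged P (quad_coef k) x)^T) *m b x)
  (form_bounded_tr (step_mx_bounded A1 alpha_ge0 x)).
have h2 := form_bounded_mulmx (b x) (form_boundedD Qb (form_bounded_tr Qb)).
have a1 : 0 <= 1 + alpha by rewrite addr_ge0.
apply: (le_trans (h1 a1)).
apply: (@le_trans _ _ (2 * ((e + e) * B))); last first.
  by rewrite /forcing_const /e le_eqVlt; apply/orP; left; apply/eqP; ring.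
apply: ler_pM; rewrite ?eucl_norm_ge0//; first by have := alpha_le1; lra.
apply: (le_trans (h2 _)); first by rewrite addr_ge0.
by rewrite ler_wpM2l// addr_ge0.
Qed.

(** From [alpha <= 3 * g * (1 - s)] and [1 <= 2 * s]: one forcing term costs at most
    [lin_const * s * (1 - s)]. *)
Definition lin_const := 6 * g * forcing_const.

Let lin_const_ge0 : 0 <= lin_const.
Proof. by rewrite /lin_const !mulr_ge0. Qed.

(** The induction is over all [n] at once: bounding one [lin_step] at a time would multiply the
    constant by [h] at each step, whereas here [h] is paid once for the whole iterate. The new
    forcing term fits in the increment from [1 - s ^+ k] to [1 - s ^+ k.+1]. *)
Lemma iter_lin_coef_bounded n k x :
  eucl_norm (iter n (lin_step P A alpha) (lin_coef k) x) <=
  h * s ^+ n * (s ^+ k * (eucl_norm q0 + lin_const * (1 - s ^+ k))).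
Proof.
have hs0 m : 0 <= h * s ^+ m by rewrite mulr_ge0 ?exprn_ge0.
elim: k n x => [|k IHk] n x.
  rewrite expr0 subrr mulr0 addr0 mul1r /=.
  by apply: iter_lin_decay => //; [exact: eucl_norm_ge0|exact: bmeas_mx_cst].
have qb := bmeas_lin_coef k; have Fb := bmeas_forcing (bmeas_quad_coef k).
have -> : iter n (lin_step P A alpha) (lin_coef k.+1) x =
    iter n.+1 (lin_step P A alpha) (lin_coef k) x +
    alpha *: iter n (lin_step P A alpha) (forcing (quad_coef k)) x.
  rewrite /= iter_linD//; last exact: bmeas_mxZ.
    by rewrite iter_linZ// -iterSr.
  exact: bmeas_lin_step.
apply: (le_trans (eucl_normD _ _)); rewrite eucl_normZ ger0_norm//.
have F0 : 0 <= forcing_const * (s ^+ k * s ^+ k).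
  by rewrite !mulr_ge0 ?exprn_ge0.
have h1 := IHk n.+1 x.
have h2 := iter_lin_decay Ab F0 (hs0 n) Fb (decay n) (forcing_bounded k) x.
have h3 := ler_wpM2l alpha_ge0 h2.
apply: (le_trans (lerD h1 h3)).
have h4 : alpha * forcing_const <= lin_const * (s * (1 - s)).
  have := ler_wpM2r forcing_const_ge0 alpha_rate.
  have s1 : 0 <= 1 - s by rewrite subr_ge0.
  have : 0 <= (s - 1 / 2) * (g * forcing_const * (1 - s)).
    by rewrite mulr_ge0 ?subr_ge0 ?mulr_ge0.
  by rewrite /lin_const; lra.
have h5 : 0 <= h * s ^+ n * (s ^+ k * s ^+ k) by rewrite !mulr_ge0 ?exprn_ge0.
have := ler_wpM2l h5 h4.
by rewrite !exprS; lra.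
Qed.

Lemma lin_coef_bounded k x :
  eucl_norm (lin_coef k x) <= h * (eucl_norm q0 + lin_const) * s ^+ k.
Proof.
apply: (le_trans (iter_lin_coef_bounded 0 k x)); rewrite expr0 mulr1 -mulrA.
rewrite ler_wpM2l// [leRHS]mulrC ler_wpM2l ?exprn_ge0// lerD2l.
by rewrite ler_piMr// gerBl exprn_ge0.
Qed.

Definition cst_const := B * (h * (eucl_norm q0 + lin_const)) + B * (h ^+ 2 * c) * B.

Let cst_const_ge0 : 0 <= cst_const.
Proof. by rewrite addr_ge0// !mulr_ge0 ?sqr_ge0 ?addr_ge0 ?eucl_norm_ge0. Qed.

(** Under the stationary mean the averaging in the recursion disappears and the increments add up.
    The [k]-th is at most [alpha * cst_const * s ^+ k], and their sum telescopes through
    [alpha <= 3 * g * (1 - s)]. *)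
Lemma cst_coef_bounded (pi : {measure set X -> \bar R}) k :
  pi setT = 1%E ->
  (forall f, bmeas f -> \int[pi]_x (\int[P x]_y f y) = \int[pi]_x f x) ->
  `|\int[pi]_x cst_coef k x| <= 3 * g * cst_const * (1 - s ^+ k).
Proof.
move=> pi1 piP; have pifin : (pi setT < +oo)%E by rewrite pi1 ltry.
have Pi := @bmeas_integrable _ _ _ pi _ pifin.
elim: k => [|k IHk] /=.
  by rewrite Rintegral_cst// mul0r normr0 expr0 subrr mulr0.
have rb := bmeas_cst_coef k; have Prb := bmeas_kernel P rb.
set e := fun x => alpha * dot (b x) (averaged P (lin_coef k) x) +
       alpha ^+ 2 * dot (b x) (averaged P (quad_coef k) x *m b x).
have eb : bmeas e.
  apply: bmeasD; (apply: bmeasM; first exact: bmeas_cst); apply: bmeas_dot => //.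
    exact/bmeas_averaged/bmeas_lin_coef.
  by apply: bmeas_mxM => //; exact/bmeas_averaged/bmeas_quad_coef.
rewrite (_ : (fun x => _) = (fun x => \int[P x]_y cst_coef k y + e x))//.
rewrite RintegralD//; [|exact: Pi|exact: Pi]; rewrite piP//.
have e_bounded x : `|e x| <= alpha * (cst_const * s ^+ k).
  have h1 : `|dot (b x) (averaged P (lin_coef k) x)| <=
      B * (h * (eucl_norm q0 + lin_const) * s ^+ k).
    apply: (le_trans (cauchy_schwarz _ _)).
    apply: ler_pM; rewrite ?eucl_norm_ge0//.
    set f := averaged P _ x; set C := h * _ * _.
    have C0 : 0 <= C by rewrite !mulr_ge0 ?addr_ge0 ?eucl_norm_ge0 ?exprn_ge0.
    (* Testing the averaged vector against itself reduces its norm to a scalar integral. *)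
    have : `|dot f f| <= C * eucl_norm f.
      rewrite [in X in dot _ X]/f averaged_dot; last exact: bmeas_lin_coef.
      apply: Rintegral_le_cst; first exact: prob_kernel.
        by apply: bmeas_dot; [exact: bmeas_mx_cst|exact: bmeas_lin_coef].
      move=> y; apply: (le_trans (cauchy_schwarz _ _)); rewrite mulrC.
      by rewrite ler_wpM2r ?eucl_norm_ge0//; exact: lin_coef_bounded.
    rewrite -sqr_eucl_norm ger0_norm ?sqr_ge0//.
    have := eucl_norm_ge0 f; rewrite le_eqVlt => /predU1P[<- _//|f0].
    by rewrite expr2 ler_pM2r.
  have h2 : `|dot (b x) (averaged P (quad_coef k) x *m b x)| <=
      B * (h ^+ 2 * c) * B * s ^+ k.
    have := averaged_bounded P (bmeas_quad_coef k) (quad_coef_bounded k) x (b x) (b x).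
    move=> /le_trans; apply.
    have n0 := eucl_norm_ge0 (b x).
    have t1 : eucl_norm (b x) * eucl_norm (b x) <= B * B by exact: ler_pM.
    have t2 : s ^+ k * s ^+ k <= s ^+ k.
      by rewrite ler_piMr ?exprn_ge0// exprn_ile1.
    have z0 : 0 <= h ^+ 2 * c by rewrite mulr_ge0 ?sqr_ge0.
    apply: (@le_trans _ _ ((h ^+ 2 * c) * ((s ^+ k * s ^+ k) * (B * B)))).
      rewrite [leLHS](_ : _ = (h ^+ 2 * c) * ((s ^+ k * s ^+ k) *
        (eucl_norm (b x) * eucl_norm (b x)))); last by ring.
      by rewrite ler_wpM2l// ler_wpM2l// mulr_ge0// exprn_ge0.
    rewrite [leRHS](_ : _ = (h ^+ 2 * c) * (s ^+ k * (B * B))); last by ring.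
    by rewrite ler_wpM2l// ler_wpM2r// mulr_ge0.
  apply: (le_trans (ler_normD _ _)); rewrite (normrM alpha) (normrM (alpha ^+ 2)).
  rewrite (ger0_norm alpha_ge0) (ger0_norm (sqr_ge0 alpha)).
  have a2 : alpha ^+ 2 <= alpha by rewrite expr2 ler_piMr.
  have := ler_wpM2l alpha_ge0 h1.
  have := ler_pM (sqr_ge0 alpha) (normr_ge0 _) a2 h2.
  by rewrite /cst_const; lra.
apply: (le_trans (ler_normD _ _)); apply: (le_trans (lerD IHk (Rintegral_le_cst pi1 eb e_bounded))).
have z0 : 0 <= cst_const * s ^+ k by rewrite mulr_ge0 ?exprn_ge0.
have := ler_wpM2r z0 alpha_rate.
by rewrite exprS; lra.
Qed.

End affine_moments.

(** * Integration against mixtures and densities *)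

Section mixtures.
Local Open Scope ereal_scope.
Context d1 d2 (T1 : measurableType d1) (T2 : measurableType d2) (R : realType).
Variables (mu : {measure set T1 -> \bar R}) (k : T1 -> {measure set T2 -> \bar R}).
Variable nu : {measure set T2 -> \bar R}.
Hypothesis mk : forall U, measurable U -> measurable_fun setT (k ^~ U).
Hypothesis nuE : forall U, measurable U -> nu U = \int[mu]_x k x U.

Import HBNNSimple.

Lemma integral_mixture_nnsfun (h : {nnsfun T2 >-> R}) :
  \int[nu]_y (h y)%:E = \int[mu]_x \int[k x]_y (h y)%:E.
Proof.
under [LHS]eq_integral do rewrite fimfunE -fsumEFin//.
under [RHS]eq_integral do under eq_integral do rewrite fimfunE -fsumEFin//.
have mh r : measurable_fun setT (fun y => (r * \1_(h @^-1` [set r]) y)%:E).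
  exact/measurable_EFinP/measurableT_comp.
have h0 r y : 0 <= (r * \1_(h @^-1` [set r]) y)%:E.
  by rewrite EFinM nnfun_muleindic_ge0.
have intE (m : {measure set T2 -> \bar R}) r :
    \int[m]_y (r * \1_(h @^-1` [set r]) y)%:E = r%:E * m (h @^-1` [set r]).
  rewrite (integralZl_indic _ (fun r => h @^-1` [set r]))//; last first.
    by move=> r0; rewrite preimage_nnfun0.
  by rewrite integral_indic// setIT.
rewrite ge0_integral_fsum//.
under [RHS]eq_integral => x _.
  rewrite ge0_integral_fsum//.
  under eq_fsbigr do rewrite intE.
  over.
rewrite ge0_integral_fsum//; last 2 first.
- by move=> r; apply: measurable_funeM; exact: mk.
- move=> r x _.
  by apply: (mulemu_ge0 (fun r => h @^-1` [set r])); exact: preimage_nnfun0.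
apply: eq_fsbigr => r _; rewrite intE nuE//.
have [r0|r0] := leP 0%R r; first by rewrite ge0_integralZl//; exact: mk.
rewrite preimage_nnfun0//.
rewrite integral0_eq ?mule0 => [|x _]; last by rewrite measure0.
by rewrite integral0_eq// => x _; rewrite measure0 mule0.
Qed.

Lemma ge0_integral_mixture (f : T2 -> \bar R) : (forall y, 0 <= f y) ->
  measurable_fun setT f -> \int[nu]_y f y = \int[mu]_x \int[k x]_y f y.
Proof.
move=> f0 mf; pose f_ := nnsfun_approx measurableT mf.
have f_f y : f y = lim ((f_ n y)%:E @[n --> \oo]).
  by apply/esym/cvg_lim => //; exact: cvg_nnsfun_approx.
have mf_ n : measurable_fun setT (fun y => (f_ n y)%:E) by exact/measurable_EFinP.
have f_0 n y : 0 <= (f_ n y)%:E by rewrite lee_fin.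
have ndf_ y : {homo (fun n => (f_ n y)%:E) : a b / (a <= b)%N >-> a <= b}.
  by move=> a b ab; rewrite lee_fin; exact/lefP/nd_nnsfun_approx.
have mcv (m : {measure set T2 -> \bar R}) :
    \int[m]_y f y = lim (\int[m]_y (f_ n y)%:E @[n --> \oo]).
  by under eq_integral do rewrite f_f; rewrite monotone_convergence.
rewrite mcv; under eq_fun do rewrite integral_mixture_nnsfun.
rewrite -monotone_convergence//; last 3 first.
- by move=> n; exact: measurable_fun_integral_kernel.
- by move=> n x _; exact: integral_ge0.
- by move=> x _ a b ab; apply: ge0_le_integral => // y _; exact: ndf_.
by apply: eq_integral => x _; rewrite mcv.
Qed.

End mixtures.

Lemma bmeas_integral_mixture (R : realType) dX (X : measurableType dX)
    (P : R.-pker X ~> X) (mu nu : {measure set X -> \bar R}) F :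
  (mu setT < +oo)%E -> (forall U, measurable U -> nu U = \int[mu]_y P y U)%E ->
  bmeas F -> \int[nu]_y F y = \int[mu]_y (\int[P y]_z F z).
Proof.
move=> mufin nuE Fb; have [mF [c Fc]] := Fb.
have nuT : nu setT = mu setT.
  rewrite nuE//; under eq_integral do rewrite prob_kernel.
  by rewrite integral_cst// mul1e.
have nufin : (nu setT < +oo)%E by rewrite nuT.
pose F' y := F y + c.
have F'b : bmeas F' by apply: bmeasD => //; exact: bmeas_cst.
have F'0 y : 0 <= F' y by have := Fc y; rewrite ler_norml /F' => /andP[h _]; lra.
have PF'E y : \int[P y]_z F' z = \int[P y]_z F z + c.
  have Pi := @bmeas_integrable _ _ _ (P y) _ (pker_fin P y).
  rewrite RintegralD//; [|exact: Pi|exact/Pi/bmeas_cst].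
  by rewrite Rintegral_cst// [P y setT]prob_kernel/= mulr1.
have mui := @bmeas_integrable _ _ _ mu _ mufin.
have nui := @bmeas_integrable _ _ _ nu _ nufin.
have h : \int[nu]_y F' y = \int[mu]_y (\int[P y]_z F' z).
  rewrite /Rintegral (@ge0_integral_mixture _ _ _ _ _ mu P nu).
  - congr fine; apply: eq_integral => y _; rewrite fineK//.
    exact: (integrable_fin_num _ (bmeas_integrable (pker_fin P y) F'b)).
  - by move=> U mU; exact: measurable_kernel.
  - exact: nuE.
  - by move=> y; rewrite lee_fin.
  - by apply/measurable_EFinP; case: F'b.
have PFb := bmeas_kernel P Fb.
move: h; under [in RHS]eq_Rintegral do rewrite PF'E.
rewrite !RintegralD//; [|exact: mui|exact/mui/bmeas_cst|exact: nui|exact/nui/bmeas_cst].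
by rewrite !Rintegral_cst// nuT => /addIr.
Qed.

Section density_measures.
Local Open Scope ereal_scope.
Context d (T : measurableType d) (R : realType).
Variables (mu : {measure set T -> \bar R}) (f : T -> R).
Hypotheses (f0 : forall x, (0 <= f x)%R) (mf : measurable_fun setT f).

(** The two proofs are arguments so that the measure structure can be inferred from the term
    itself. *)
Definition density of (forall x, (0 <= f x)%R) & measurable_fun setT f :=
  fun A : set T => \int[mu]_(x in A) (f x)%:E.

Local Notation nu := (density f0 mf).

Let density0 : nu set0 = 0. Proof. exact: integral_set0. Qed.

Let density_ge0 A : 0 <= nu A.
Proof. by apply: integral_ge0 => x _; rewrite lee_fin. Qed.

Let density_sigma_additive : semi_sigma_additive nu.
Proof.
apply: semi_sigma_additive_nng_induced; first exact/measurable_EFinP.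
by move=> x; rewrite lee_fin.
Qed.

HB.instance Definition _ :=
  isMeasure.Build d T R nu density0 density_ge0 density_sigma_additive.

Lemma integral_set_indic (g : T -> R) D :
  \int[mu]_(x in D) (g x)%:E = \int[mu]_x (\1_D x * g x)%:E.
Proof.
rewrite integral_mkcond; apply: eq_integral => x _.
by rewrite epatch_indic EFinM muleC.
Qed.

Lemma ge0_integral_density (Y : T -> R) : (forall x, (0 <= Y x)%R) ->
  measurable_fun setT Y -> \int[nu]_x (Y x)%:E = \int[mu]_x (Y x * f x)%:E.
Proof.
move=> Y0 mY.
(* A measure with density [f] is the mixture of the Dirac masses with weights [f x]. *)
pose k x : {measure set T -> \bar R} := mscale (NngNum (f0 x)) (dirac x).
rewrite (@ge0_integral_mixture _ _ T T R mu k nu).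
- apply: eq_integral => x _; rewrite /k ge0_integral_mscale//.
  - rewrite integral_dirac; [|by []|exact/measurable_EFinP].
    by rewrite diracT mul1e -EFinM mulrC.
  - exact/measurable_EFinP.
  - by move=> y _; rewrite lee_fin.
- move=> U mU; rewrite (_ : k^~ U = fun x => (f x * \1_U x)%:E).
    by apply/measurable_EFinP; apply: measurable_funM => //; exact: measurable_indic.
  by apply/funext => x; rewrite /k/= /mscale/= diracE indicE EFinM.
- move=> U mU; rewrite [LHS]integral_set_indic; apply: eq_integral => x _.
  by rewrite /k/= /mscale/= diracE indicE mulrC EFinM.
- by move=> y; rewrite lee_fin.
- exact/measurable_EFinP.
Qed.

End density_measures.

(** * Sub-sigma-algebras and conditional probabilities *)

Section integrals_on_sub_sigma_algebras.
Local Open Scope ereal_scope.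
Context d (T : measurableType d) (R : realType) (mu : {measure set T -> \bar R}).
Variables (G : set (set T)) (f1 f2 : T -> R).
Hypotheses (Gm : G `<=` measurable) (GI : setI_closed G) (GT : G setT).
Hypotheses (f10 : forall x, (0 <= f1 x)%R) (f20 : forall x, (0 <= f2 x)%R).
Hypotheses (mf1 : measurable_fun setT f1) (mf2 : measurable_fun setT f2).
Hypothesis f1_fin : \int[mu]_x (f1 x)%:E < +oo.
Hypothesis f12 : forall D, G D ->
  \int[mu]_(x in D) (f1 x)%:E = \int[mu]_(x in D) (f2 x)%:E.

Lemma sub_sigma_measurable (D : set T) : <<s G >> D -> measurable D.
Proof. by apply: smallest_sub => //; exact: sigma_algebra_measurable. Qed.

Lemma sub_sigma_measurable_fun d' (T' : measurableType d')
    (Y : g_sigma_algebraType G -> T') :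
  measurable_fun setT Y -> measurable_fun (setT : set T) (Y : T -> T').
Proof. by move=> mY _ S mS; apply: sub_sigma_measurable; exact: mY. Qed.

(** The measures with densities [f1] and [f2] agree on the intersection-stable [G], hence on the
    generated sigma-algebra; the integral of [Y] only sees its pushforward, which is determined
    there. *)
Lemma ge0_integral_eq_on (Y : g_sigma_algebraType G -> R) :
  (forall x, (0 <= Y x)%R) -> measurable_fun setT Y ->
  \int[mu]_x (Y x * f1 x)%:E = \int[mu]_x (Y x * f2 x)%:E.
Proof.
move=> Y0 mY; have mYT := sub_sigma_measurable_fun mY.
rewrite -(ge0_integral_density _ f10 mf1)// -(ge0_integral_density _ f20 mf2)//.
pose nu1 := density mu f10 mf1; pose nu2 := density mu f20 mf2.
have nu12 D : <<s G >> D -> nu1 D = nu2 D.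
  apply: (@g_sigma_algebra_measure_unique _ _ _ G Gm (fun=> setT) _ _ nu1 nu2) => //.
  by rewrite bigcup_const//; exists 0%N.
(* Restricting the image integral to [0 <= y] makes the identity function nonnegative. *)
have push (nu : {measure set T -> \bar R}) : \int[nu]_x (Y x)%:E =
    \int[pushforward nu Y]_(y in [set y | (0 <= y)%R]) y%:E.
  rewrite [RHS](ge0_integral_pushforward mYT)/=.
  - have -> : Y @^-1` [set y | (0 <= y)%R] = setT.
      by apply/seteqP; split => // x _; exact: Y0.
    by [].
  - rewrite (_ : [set y | (0 <= y)%R] = `[0%R, +oo[%classic)//.
    by apply/seteqP; split => y /=; rewrite in_itv/= andbT.
  - exact/measurable_funTS/measurable_EFinP.
  - by move=> y /[!inE]; rewrite lee_fin.
rewrite !push; apply: eq_measure_integral => S mS _.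
apply: nu12; rewrite -[X in <<s G >> X]setTI; exact: mY.
Qed.

End integrals_on_sub_sigma_algebras.

Section conditional_probabilities.
Context (R : realType) dO (Omega : measurableType dO) (Pr : probability Omega R).
Context dX (X : measurableType dX) (z : {RV Pr >-> X}) (B : set Omega).
Hypothesis mB : measurable B.
Local Open Scope ereal_scope.

Definition law_on of measurable B := fun V : set X => Pr (B `&` z @^-1` V).

Local Notation nu := (law_on mB).

Let measurable_preimage V : measurable V -> measurable (z @^-1` V).
Proof. by move=> mV; rewrite -[X in measurable X]setTI; exact: measurable_funPT. Qed.

Let law_on0 : nu set0 = 0.
Proof. by rewrite /law_on preimage_set0 setI0 measure0. Qed.

Let law_on_ge0 V : 0 <= nu V. Proof. exact: measure_ge0. Qed.

Let law_on_sigma_additive : semi_sigma_additive nu.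
Proof.
move=> F mF tF mUF; rewrite /law_on preimage_bigcup setI_bigcupr.
apply: measure_semi_sigma_additive.
- by move=> i; apply: measurableI => //; exact: measurable_preimage.
- apply/trivIsetP => i j _ _ ij; rewrite setIACA setIid -preimage_setI.
  by move/trivIsetP : tF => ->//; rewrite preimage_set0 setI0.
- by apply: bigcup_measurable => i _; apply: measurableI => //; exact: measurable_preimage.
Qed.

HB.instance Definition _ := isMeasure.Build dX X R nu
  law_on0 law_on_ge0 law_on_sigma_additive.

Let law_on_fin : fin_num_fun nu.
Proof.
move=> V mV; apply: fin_num_measure; apply: measurableI => //.
exact: measurable_preimage.
Qed.

HB.instance Definition _ := @Measure_isFinite.Build _ _ _ nu law_on_fin.

(** The Radon-Nikodym derivative of [law_on] with respect to the law of [z]. Conditional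
    independence is phrased through versions, so it can be exploited only once versions are known to
    exist. *)
Lemma exists_cond_prob : exists g : X -> R,
  (forall x, (0 <= g x)%R) /\ is_cond_prob Pr z B g.
Proof.
pose mu := distribution Pr z.
have numu : nu `<< mu.
  apply/null_content_dominatesP => V mV muV; apply/eqP.
  rewrite eq_le measure_ge0 andbT -muV; apply: le_measure; rewrite ?inE.
  - by apply: measurableI => //; exact: measurable_preimage.
  - exact: measurable_preimage.
  - by move=> w [].
pose f := Radon_Nikodym_SigmaFinite.f nu mu.
have f0 x : 0 <= f x by exact: Radon_Nikodym_SigmaFinite.f_ge0.
have ffin x : f x \is a fin_num by exact: Radon_Nikodym_SigmaFinite.f_fin_num.
have fi : mu.-integrable setT f by exact: Radon_Nikodym_SigmaFinite.f_integrable.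
have mf : measurable_fun setT f by exact: measurable_int fi.
have mz : measurable_fun setT z by exact: measurable_funPT.
have mg : measurable_fun setT (fine \o f).
  by apply: measurableT_comp mf; exact: fine_measurable.
have change V : measurable V ->
    \int[Pr]_(w in z @^-1` V) f (z w) = \int[mu]_(x in V) f x.
  move=> mV; rewrite [RHS](ge0_integral_pushforward mz)//.
  exact: measurable_funTS.
exists (fine \o f); split; first by move=> x; exact: fine_ge0.
split => // [|V mV].
  apply/integrableP; split.
    by apply/measurable_EFinP/measurableT_comp.
  rewrite (_ : (fun w => _) = f \o z); last first.
    apply/funext => w; rewrite (_ : ((EFin \o (fine \o f)) \o z) w = f (z w)).
      by rewrite gee0_abs.
    exact: fineK.
  have := change setT measurableT; rewrite preimage_setT => ->.
  by rewrite -ge0_fin_numE ?integral_ge0//; exact: integrable_fin_num.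
rewrite -/(nu V) (@Radon_Nikodym_SigmaFinite.f_integral _ _ _ nu mu)//.
by rewrite -change//; apply: eq_integral => w _; rewrite /= fineK.
Qed.

End conditional_probabilities.

Section sub_sigma_algebras.
Context d (T : measurableType d) (G : set (set T)).

Lemma measurable_fun_sub_comp d1 (T1 : measurableType d1) d2
    (T2 : measurableType d2) (z : T -> T1) (F : T1 -> T2) :
  (forall U, measurable U -> <<s G >> (z @^-1` U)) ->
  measurable_fun setT F ->
  measurable_fun (setT : set (g_sigma_algebraType G)) (F \o z).
Proof.
move=> zG mF _ S mS; rewrite setTI comp_preimage; apply: zG.
by rewrite -[X in measurable X]setTI; exact: mF.
Qed.

Lemma measurable_fun_sub_incl d' (T' : measurableType d') (H : set (set T))
    (Y : T -> T') : G `<=` <<s H >> ->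
  measurable_fun (setT : set (g_sigma_algebraType G)) Y ->
  measurable_fun (setT : set (g_sigma_algebraType H)) Y.
Proof.
move=> GH mY _ S mS; have := mY measurableT S mS.
by apply: smallest_sub => //; exact: smallest_sigma_algebra.
Qed.

Lemma measurable_fun_sub_indic (R : realType) (E : set T) : <<s G >> E ->
  measurable_fun (setT : set (g_sigma_algebraType G)) (\1_E : T -> R).
Proof. by move=> GE; exact: measurable_indic. Qed.

End sub_sigma_algebras.

(** * The Markov property in the presence of the initial iterate *)

Section markov_property.
Context (R : realType) dO (Omega : measurableType dO) (Pr : probability Omega R).
Context dX (X : measurableType dX) (P : R.-pker X ~> X).
Context (x : nat -> {RV Pr >-> X}) dT (T : measurableType dT) (th : {RV Pr >-> T}).
Hypothesis x_markov : markov_chain P x.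
Hypothesis th_indep : cond_independent Pr (x 0%N)
  (g_sigma_algebra_preimage th) (sigma_of x [set i | (1 <= i)%N]).
Local Open Scope ereal_scope.

Let past n := sigma_of x [set i | (i <= n)%N].

(* The events determined by [th] and [x 0, .., x n] are generated by these. *)
Definition history n : set (set Omega) :=
  [set D | exists B E, [/\ g_sigma_algebra_preimage th B, past n E & D = B `&` E]].

Let RV_preimage d' (T' : measurableType d') (z : {RV Pr >-> T'}) V :
  measurable V -> measurable (z @^-1` V).
Proof. by move=> mV; rewrite -[X in measurable X]setTI; exact: measurable_funPT. Qed.

Lemma sigma_of_measurable I : sigma_of x I `<=` measurable.
Proof.
apply: smallest_sub; first exact: sigma_algebra_measurable.
by move=> _ [i _ [V mV <-]]; rewrite setTI; exact: RV_preimage.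
Qed.

Lemma sigma_of_preimage I i U : I i -> measurable U ->
  sigma_of x I (x i @^-1` U).
Proof.
move=> Ii mU; apply: sub_sigma_algebra; exists i => //; exists U => //.
by rewrite setTI.
Qed.

Lemma sub_sigma_of I J : I `<=` J -> sigma_of x I `<=` sigma_of x J.
Proof.
by move=> IJ; apply: sub_smallest2r => //; apply: bigcup_subset.
Qed.

Lemma sigma_of_setI I : setI_closed (sigma_of x I).
Proof.
move=> D E; exact: (@measurableI _ (g_sigma_algebraType
  (\bigcup_(i in I) g_sigma_algebra_preimage (x i)))).
Qed.

Lemma sigma_of_setT I : sigma_of x I setT.
Proof.
exact: (@measurableT _ (g_sigma_algebraType
  (\bigcup_(i in I) g_sigma_algebra_preimage (x i)))).
Qed.

Let th_measurable : g_sigma_algebra_preimage th `<=` measurable.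
Proof. by move=> _ [V mV <-]; rewrite setTI; exact: RV_preimage. Qed.

Lemma history_measurable n : history n `<=` measurable.
Proof.
move=> _ [B [E [thB pE ->]]]; apply: measurableI; first exact: th_measurable.
exact: sigma_of_measurable pE.
Qed.

Lemma history_setI n : setI_closed (history n).
Proof.
move=> _ _ [B1 [E1 [[V1 mV1 <-] pE1 ->]]] [B2 [E2 [[V2 mV2 <-] pE2 ->]]].
exists (setT `&` th @^-1` (V1 `&` V2)), (E1 `&` E2); split.
- by exists (V1 `&` V2) => //; exact: measurableI.
- exact: sigma_of_setI.
- by rewrite preimage_setI !setTI setIACA.
Qed.

Lemma history_setT n : history n setT.
Proof.
exists setT, setT; split; [|exact: sigma_of_setT|by rewrite setTI].
by exists setT => //; rewrite preimage_setT setTI.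
Qed.

Lemma history_past n i U : (i <= n)%N -> measurable U -> history n (x i @^-1` U).
Proof.
move=> ni mU; exists setT, (x i @^-1` U); split; [|exact: sigma_of_preimage|by rewrite setTI].
by exists setT => //; rewrite preimage_setT setTI.
Qed.

Lemma history_init n V : measurable V -> history n (th @^-1` V).
Proof.
move=> mV; exists (th @^-1` V), setT; split; [|exact: sigma_of_setT|by rewrite setIT].
by exists V => //; rewrite setTI.
Qed.

Lemma history_sub m n : (m <= n)%N -> history m `<=` history n.
Proof.
move=> mn _ [B [E [thB pE ->]]]; exists B, E; split => //.
by move: pE; apply: sub_sigma_of => i /= /leq_trans; exact.
Qed.

Let indic_ge0 (D : set Omega) w : (0 <= \1_D w :> R)%R.
Proof. by rewrite indicE. Qed.

Let integral_indic_fin (D : set Omega) : measurable D ->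
  \int[Pr]_w (\1_D w)%:E < +oo.
Proof.
move=> mD; rewrite integral_indic// setIT.
by apply: le_lt_trans (probability_le1 Pr mD) _; rewrite ltry.
Qed.

(* A version [g] of P(B | x_0) stays one given the whole chain. *)
Lemma cond_prob_given_chain B : g_sigma_algebra_preimage th B ->
  exists g : X -> R, [/\ (forall y, (0 <= g y)%R), measurable_fun setT g,
    \int[Pr]_w (g (x 0%N w))%:E < +oo &
    forall Y : g_sigma_algebraType (sigma_of x setT) -> R,
      (forall w, (0 <= Y w)%R) -> measurable_fun setT Y ->
      \int[Pr]_w (Y w * \1_B w)%:E = \int[Pr]_w (Y w * g (x 0%N w))%:E].
Proof.
move=> thB; have mB := th_measurable thB.
have [g [g0 gB]] := exists_cond_prob (x 0%N) mB.
have [mg gi _] := gB.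
have mx0 : measurable_fun setT (x 0%N) by exact: measurable_funPT.
have mgx : measurable_fun setT (fun w => g (x 0%N w)) by exact: measurableT_comp.
exists g; split => //.
  rewrite -ge0_fin_numE; last by apply: integral_ge0 => w _; rewrite lee_fin.
  exact: (integrable_fin_num _ gi).
pose G0 := [set x 0%N @^-1` V | V in (measurable : set (set X))].
have G0m : G0 `<=` measurable by move=> _ [V mV <-]; exact: RV_preimage.
have G0I : setI_closed G0.
  move=> _ _ [V1 mV1 <-] [V2 mV2 <-]; exists (V1 `&` V2); last exact: preimage_setI.
  exact: measurableI.
have G0T : G0 setT by exists setT => //; rewrite preimage_setT.
(* Conditional independence speaks of events [E] of the strict future; intersected with events of
   [x 0] they form an intersection-stable generator of the whole chain. *)
pose G := [set D | exists V E, [/\ measurable V,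
  sigma_of x [set i | (1 <= i)%N] E & D = x 0%N @^-1` V `&` E]].
have Gm : G `<=` measurable.
  move=> _ [V [E [mV sE ->]]]; apply: measurableI; first exact: RV_preimage.
  exact: sigma_of_measurable sE.
have GI : setI_closed G.
  move=> _ _ [V1 [E1 [mV1 sE1 ->]]] [V2 [E2 [mV2 sE2 ->]]].
  exists (V1 `&` V2), (E1 `&` E2); split; [exact: measurableI|exact: sigma_of_setI|].
  by rewrite preimage_setI setIACA.
have GT : G setT.
  by exists setT, setT; split; [|exact: sigma_of_setT|rewrite preimage_setT setTI].
have eqG D : G D -> \int[Pr]_(w in D) (\1_B w)%:E = \int[Pr]_(w in D) (g (x 0%N w))%:E.
  move=> [V [E [mV sE ->]]]; have mE := sigma_of_measurable sE.
  have [h [h0 hE]] := exists_cond_prob (x 0%N) mE; have [mh hi hV] := hE.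
  have mhx : measurable_fun setT (fun w => h (x 0%N w)) by exact: measurableT_comp.
  have [_ _ /(_ V mV) ghE] := th_indep thB sE gB hE.
  rewrite integral_indic//; last by apply: measurableI => //; exact: RV_preimage.
  have -> : B `&` (x 0%N @^-1` V `&` E) = B `&` E `&` x 0%N @^-1` V.
    by rewrite -setIA (setIC E).
  etransitivity; first exact: ghE.
  rewrite [LHS]integral_set_indic [RHS]integral_set_indic.
  have compG0 (F : X -> R) : measurable_fun setT F ->
      measurable_fun (setT : set (g_sigma_algebraType G0)) (fun w => F (x 0%N w)).
    apply: measurable_fun_sub_comp => U mU.
    by apply: sub_sigma_algebra; exists U.
  pose Y w := (\1_V (x 0%N w) * g (x 0%N w))%R.
  have mY : measurable_fun (setT : set (g_sigma_algebraType G0)) Y.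
    apply: measurable_funM; last exact: compG0.
    by apply: (compG0 (\1_V)); exact: measurable_indic.
  (* Since [Y] depends on [x 0] only, the version [h] of the conditional probability of [E] may be
     replaced by its indicator. *)
  transitivity (\int[Pr]_w (Y w * h (x 0%N w))%:E).
    by apply: eq_integral => w _; rewrite /Y/= mulrA.
  transitivity (\int[Pr]_w (Y w * \1_E w)%:E).
    apply/esym/(@ge0_integral_eq_on _ _ _ Pr G0) => //.
    - exact: integral_indic_fin.
    - move=> _ [U mU <-]; rewrite integral_indic//; last exact: RV_preimage.
      exact: hV.
    - by move=> w; rewrite mulr_ge0// indicE.
  apply: eq_integral => w _; rewrite /Y !indicE in_setI.
  rewrite (_ : (w \in x 0%N @^-1` V) = (x 0%N w \in V))//.
  by rewrite -mulnb natrM mulrAC.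
move=> Y Y0 mY; apply: (@ge0_integral_eq_on _ _ _ Pr G) => //.
- exact: integral_indic_fin.
- apply: measurable_fun_sub_incl mY; apply: smallest_sub.
    exact: smallest_sigma_algebra.
  move=> _ [i _ [U mU <-]]; rewrite setTI; apply: sub_sigma_algebra.
  case: i => [|i].
    by exists U, setT; split => //; [exact: sigma_of_setT|rewrite setIT].
  exists setT, (x i.+1 @^-1` U); split => //; last by rewrite preimage_setT setTI.
  exact: sigma_of_preimage.
Qed.

Let transition_fin U y : measurable U -> P y U \is a fin_num.
Proof. by move=> mU; exact: finite_kernel_measure. Qed.

Let measurable_transition U : measurable U -> measurable_fun setT (fun y => fine (P y U)).
Proof.
move=> mU; apply: measurableT_comp; first exact: fine_measurable.
exact: measurable_kernel.
Qed.

Let chain_comp I i (F : X -> R) : I i -> measurable_fun setT F ->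
  measurable_fun (setT : set (g_sigma_algebraType (sigma_of x I))) (fun w => F (x i w)).
Proof.
move=> Ii; apply: measurable_fun_sub_comp => U mU.
by apply: sub_sigma_algebra; exact: sigma_of_preimage.
Qed.

(** The Markov property is assumed relative to the chain alone. To include an event [B] of [th], its
    indicator is traded for [g (x 0)], which belongs to the past of the chain; the Markov property
    is applied, and the trade is reversed. *)
Lemma history_transition n D U : history n D -> measurable U ->
  Pr (D `&` x n.+1 @^-1` U) = \int[Pr]_(w in D) P (x n w) U.
Proof.
move=> [B [E [thB pE ->]]] mU.
have mB := th_measurable thB; have mE := sigma_of_measurable pE.
have mU' := RV_preimage (x n.+1) mU.
have [g [g0 mg gfin gY]] := cond_prob_given_chain thB.
have mxn m : measurable_fun setT (x m) by exact: measurable_funPT.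
have mgx : measurable_fun setT (fun w => g (x 0%N w)) by exact: measurableT_comp.
pose p w := fine (P (x n w) U).
have p0 w : (0 <= p w)%R by exact: fine_ge0.
have mp : measurable_fun setT p.
  by apply: (measurableT_comp (measurable_transition mU)).
have pE' D' : \int[Pr]_(w in D') P (x n w) U = \int[Pr]_(w in D') (p w)%:E.
  by apply: eq_integral => w _; rewrite fineK// transition_fin.
have indE I : past n `<=` sigma_of x I ->
    measurable_fun (setT : set (g_sigma_algebraType (sigma_of x I))) (\1_E : Omega -> R).
  by move=> pI; apply: measurable_fun_sub_indic; apply: sub_sigma_algebra; exact: pI.
have pT : past n `<=` sigma_of x setT by exact: sub_sigma_of.
have indI C C' w : (\1_(C `&` C') w = \1_C w * \1_C' w :> R)%R.
  by rewrite !indicE in_setI -mulnb natrM.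
rewrite pE' [RHS]integral_set_indic.
have -> : Pr (B `&` E `&` x n.+1 @^-1` U) =
    \int[Pr]_w (\1_(B `&` E `&` x n.+1 @^-1` U) w)%:E.
  by rewrite integral_indic ?setIT//; do 2?apply: measurableI.
transitivity (\int[Pr]_w ((\1_E w * \1_(x n.+1 @^-1` U) w) * \1_B w)%:E).
  by apply: eq_integral => w _; rewrite !indI -mulrA mulrC.
rewrite gY; last 2 first.
- by move=> w; rewrite mulr_ge0// indicE.
- apply: measurable_funM; first exact: indE.
  by apply: (@chain_comp setT n.+1 (\1_U)) => //; exact: measurable_indic.
transitivity (\int[Pr]_w ((\1_E w * g (x 0%N w)) * \1_(x n.+1 @^-1` U) w)%:E).
  by apply: eq_integral => w _; rewrite mulrAC.
rewrite (@ge0_integral_eq_on _ _ _ Pr (past n) _ p); first last.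
- apply: measurable_funM; first exact: indE.
  exact: chain_comp.
- by move=> w; rewrite mulr_ge0// indicE.
- move=> C pC; rewrite integral_indic//; last exact: sigma_of_measurable pC.
  by rewrite setIC -pE'; exact: x_markov.
- exact: integral_indic_fin.
- exact: mp.
- exact: measurable_indic.
- exact: p0.
- by move=> w; rewrite indicE.
- exact: sigma_of_setT.
- exact: sigma_of_setI.
- exact: sigma_of_measurable.
transitivity (\int[Pr]_w ((\1_E w * p w) * g (x 0%N w))%:E).
  by apply: eq_integral => w _; rewrite mulrAC.
rewrite -gY; last 2 first.
- by move=> w; rewrite mulr_ge0// indicE.
- apply: measurable_funM; first exact: indE.
  by apply: (@chain_comp setT n (fun y => fine (P y U))) => //; exact: measurable_transition.
by apply: eq_integral => w _; rewrite indI mulrC mulrA.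
Qed.

Lemma history_kernel n D (F : X -> R) : history n D -> (forall y, (0 <= F y)%R) ->
  bmeas F ->
  \int[Pr]_(w in D) (F (x n.+1 w))%:E =
  \int[Pr]_(w in D) (\int[P (x n w)]_y F y)%R%:E.
Proof.
move=> hD F0 Fb; have mD := history_measurable hD; have [mF _] := Fb.
have mxn m : measurable_fun setT (x m) by exact: measurable_funPT.
have mi : measurable_fun setT (\1_D : Omega -> R) by exact: measurable_indic.
pose mu := density Pr (indic_ge0 D) mi.
have restr (f : Omega -> R) : (forall w, (0 <= f w)%R) -> measurable_fun setT f ->
    \int[mu]_w (f w)%:E = \int[Pr]_(w in D) (f w)%:E.
  move=> f0 mf; rewrite ge0_integral_density// [RHS]integral_set_indic.
  by apply: eq_integral => w _; rewrite mulrC.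
have [mPF _] := bmeas_kernel P Fb.
have PF0 y : (0 <= \int[P y]_z F z)%R by exact: Rintegral_ge0.
rewrite -!restr//; [|exact: (measurableT_comp mPF)|exact: (measurableT_comp mF)].
pose nu := pushforward mu (x n.+1).
transitivity (\int[nu]_y (F y)%:E).
  rewrite [RHS](ge0_integral_pushforward (mxn n.+1))//; first exact/measurable_EFinP.
  by move=> y _; rewrite lee_fin.
rewrite (@ge0_integral_mixture _ _ _ _ _ mu (fun w => P (x n w)) nu)//.
- apply: eq_integral => w _; rewrite fineK//.
  exact: (integrable_fin_num _ (bmeas_integrable (pker_fin P _) Fb)).
- move=> U mU; apply: (measurableT_comp (measurable_kernel P U mU)).
  exact: mxn.
- move=> U mU.
  transitivity (\int[Pr]_(w in x n.+1 @^-1` U) (\1_D w)%:E); first by [].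
  rewrite integral_indic//; last exact: RV_preimage.
  etransitivity; first exact: history_transition hD mU.
  rewrite (_ : (fun w => P (x n w) U) = fun w => (fine (P (x n w) U))%:E).
    have p0 w : (0 <= fine (P (x n w) U))%R by exact: fine_ge0.
    rewrite restr//.
    exact: (measurableT_comp (measurable_transition mU) (mxn n)).
  by apply/funext => w; rewrite fineK// transition_fin.
- exact/measurable_EFinP.
Qed.

Lemma ge0_history_expectation n (Y : g_sigma_algebraType (history n) -> R) (F : X -> R) :
  (forall w, (0 <= Y w)%R) -> measurable_fun setT Y ->
  (forall y, (0 <= F y)%R) -> bmeas F ->
  \int[Pr]_w (Y w * F (x n.+1 w))%:E =
  \int[Pr]_w (Y w * \int[P (x n w)]_y F y)%R%:E.
Proof.
move=> Y0 mY F0 Fb; have [mF [c Fc]] := Fb.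
have mxn m : measurable_fun setT (x m) by exact: measurable_funPT.
have [mPF _] := bmeas_kernel P Fb.
apply: (@ge0_integral_eq_on _ _ _ Pr (history n) (fun w => F (x n.+1 w))
  (fun w => \int[P (x n w)]_y F y)%R) => //.
- exact: history_measurable.
- exact: history_setI.
- exact: history_setT.
- by move=> w; exact: Rintegral_ge0.
- exact: (measurableT_comp mF).
- exact: (measurableT_comp mPF).
- have Fxb : bmeas (fun w => F (x n.+1 w)).
    by split; [exact: (measurableT_comp mF)|exists c].
  have Prfin : Pr setT < +oo by rewrite probability_setT ltry.
  rewrite -ge0_fin_numE; last by apply: integral_ge0 => w _; rewrite lee_fin.
  exact: (integrable_fin_num _ (bmeas_integrable Prfin Fxb)).
- by move=> D hD; exact: history_kernel.
Qed.

Lemma integrableM_bmeas (Y F : Omega -> R) :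
  Pr.-integrable setT (EFin \o Y) -> bmeas F ->
  Pr.-integrable setT (EFin \o (fun w => (Y w * F w)%R)).
Proof.
move=> Yi [mF [c Fc]].
have := integrableMl measurableT Yi mF; apply.
exists c; split; [exact: num_real|move=> e ce w _; exact: le_trans (Fc w) (ltW ce)].
Qed.

Lemma history_expectation n (Y : g_sigma_algebraType (history n) -> R) (F : X -> R) :
  measurable_fun setT Y -> Pr.-integrable setT (EFin \o (Y : Omega -> R)) ->
  bmeas F ->
  (\int[Pr]_w (Y w * F (x n.+1 w)) =
   \int[Pr]_w (Y w * \int[P (x n w)]_y F y))%R.
Proof.
move=> mY Yi Fb; have [mF [c Fc]] := Fb.
have mxn m : measurable_fun setT (x m) by exact: measurable_funPT.
have forget (Z : g_sigma_algebraType (history n) -> R) :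
    measurable_fun setT Z -> measurable_fun (setT : set Omega) (Z : Omega -> R).
  by apply: sub_sigma_measurable_fun; exact: history_measurable.
have mYO := forget _ mY.
have compb (H : X -> R) m : bmeas H -> bmeas (fun w => H (x m w)).
  by move=> [mH [e He]]; split; [exact: (measurableT_comp mH)|exists e].
(* Two reductions to the nonnegative case: [F] is shifted by its bound, and [Y] is split into
   positive and negative parts. The shift contributes [c * Y] on both sides. *)
pose F' y := (F y + c)%R.
have F'b : bmeas F' by apply: bmeasD => //; exact: bmeas_cst.
have F'0 y : (0 <= F' y)%R by have := Fc y; rewrite ler_norml /F' => /andP[h _]; lra.
have PF'E y : (\int[P y]_z F' z = \int[P y]_z F z + c)%R.
  have Pi := @bmeas_integrable _ _ _ (P y) _ (pker_fin P y).
  rewrite RintegralD//; [|exact: Pi|exact/Pi/bmeas_cst].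
  by rewrite Rintegral_cst// [P y setT]prob_kernel/= mulr1.
pose Yp w := Num.max (Y w) 0%R; pose Yn w := Num.max (- Y w)%R 0%R.
have YE w : Y w = (Yp w - Yn w)%R.
  by rewrite /Yp /Yn; case: (lerP (Y w) 0) => h; case: (lerP (- Y w)%R 0%R) => h'; lra.
have Yp0 w : (0 <= Yp w)%R by rewrite le_max lexx orbT.
have Yn0 w : (0 <= Yn w)%R by rewrite le_max lexx orbT.
have mYp : measurable_fun (setT : set (g_sigma_algebraType (history n))) Yp.
  by apply: measurable_maxr => //; exact: measurable_cst.
have mYn : measurable_fun (setT : set (g_sigma_algebraType (history n))) Yn.
  by apply: measurable_maxr; [exact: measurable_funN|exact: measurable_cst].
have Ypi : Pr.-integrable setT (EFin \o (Yp : Omega -> R)).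
  apply: le_integrable Yi => //.
    exact/measurable_EFinP/forget.
  move=> w _; rewrite lee_fin /= ger0_norm// /Yp ge_max normr_ge0 andbT.
  exact: ler_norm.
have Yni : Pr.-integrable setT (EFin \o (Yn : Omega -> R)).
  apply: le_integrable Yi => //.
    exact/measurable_EFinP/forget.
  move=> w _; rewrite lee_fin /= ger0_norm// /Yn ge_max normr_ge0 andbT.
  by rewrite -normrN; exact: ler_norm.
have split_int (H : Omega -> R) : bmeas H -> (\int[Pr]_w (Y w * H w) =
    \int[Pr]_w (Yp w * (H w + c)) - \int[Pr]_w (Yn w * (H w + c)) -
    \int[Pr]_w (c * Y w))%R.
  move=> Hb; have Hcb := bmeasD Hb (bmeas_cst c).
  have i1 := integrableM_bmeas Ypi Hcb; have i2 := integrableM_bmeas Yni Hcb.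
  have i12 : Pr.-integrable setT (EFin \o (fun w =>
      (Yp w * (H w + c) - Yn w * (H w + c))%R)) := integrableB measurableT i1 i2.
  have i3 := integrableZlR c Yi.
  rewrite -RintegralB// -RintegralB//.
  by apply: eq_Rintegral => w _; rewrite (YE w); ring.
have PFb := bmeas_kernel P Fb.
rewrite (split_int _ (compb _ n.+1 Fb)) (split_int _ (compb _ n PFb)).
have swap (Z : g_sigma_algebraType (history n) -> R) : (forall w, (0 <= Z w)%R) ->
    measurable_fun setT Z ->
    (\int[Pr]_w (Z w * (F (x n.+1 w) + c)) =
     \int[Pr]_w (Z w * (\int[P (x n w)]_y F y + c)))%R.
  move=> Z0 mZ; rewrite /Rintegral; congr fine.
  have := ge0_history_expectation Z0 mZ F'0 F'b => ->.
  by apply: eq_integral => w _; rewrite PF'E.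
by rewrite (swap _ Yp0 mYp) (swap _ Yn0 mYn).
Qed.

End markov_property.

(** * Moments of the iterates along the chain *)

Section matrix_coordinates.
Context (R : realType) (m n : nat).

Lemma measurable_coord i j :
  measurable_fun setT (fun M : 'M[R]_(m, n) => M i j).
Proof.
apply: (measurability _ (RGenOInfty.measurableE R)) => //.
move=> _ [_ [a ->] <-]; rewrite setTI; apply: sub_sigma_algebra.
apply: open_comp; last exact: interval_open.
by move=> M _; exact: coord_continuous.
Qed.

Lemma measurable_coord_comp d (T : measurableType d) (f : T -> 'M[R]_(m, n)) i j :
  measurable_fun setT f -> measurable_fun setT (fun x => f x i j).
Proof. by move=> mf; apply: (measurableT_comp (measurable_coord i j)). Qed.

End matrix_coordinates.

Definition affine_mean (R : realType) dO (Omega : measurableType dO)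
    (mu : {measure set Omega -> \bar R}) d (t : Omega -> 'cV[R]_d)
    (Q : 'M[R]_d) (q : 'cV[R]_d) :=
  \int[mu]_w dot (t w) (Q *m t w) + \int[mu]_w dot (t w) q.

Section linear_stochastic_approximation.
Context (R : realType) dO (Omega : measurableType dO) (Pr : probability Omega R).
Context dX (X : measurableType dX) (P : R.-pker X ~> X) (pi : probability X R).
Context (d : nat) (A : X -> 'M[R]_d) (b : X -> 'cV[R]_d) (alpha : R).
Context (x : nat -> {RV Pr >-> X}) (theta : nat -> {RV Pr >-> 'cV[R]_d}).
Hypothesis x_markov : markov_chain P x.
Hypothesis x0_law : forall U, measurable U -> distribution Pr (x 0%N) U = pi U.
Hypothesis pi_stationary : stationary P pi.
Hypothesis theta_indep : cond_independent Pr (x 0%N)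
  (g_sigma_algebra_preimage (theta 0%N)) (sigma_of x [set i | (1 <= i)%N]).
Hypothesis theta_rec : forall k w,
  theta k.+1 w = theta k w + alpha *: (A (x k w) *m theta k w + b (x k w)).
Hypothesis theta0_moment :
  (\int[Pr]_w (eucl_norm (theta 0%N w) ^+ 2)%:E < +oo)%E.
Hypotheses (Ab : bmeas_mx A) (bb : bmeas_mx b).
Hypotheses (A1 : forall y, form_bounded (A y) 1).
Context (B : R).
Hypotheses (b_bounded : forall y, eucl_norm (b y) <= B).
Hypotheses (alpha_ge0 : 0 <= alpha) (alpha_le1 : alpha <= 1).

Local Notation hist n := (@history _ _ _ Pr _ _ x _ _ (theta 0%N) n).

Let theta_step k w :
  theta k.+1 w = step_mx A alpha (x k w) *m theta k w + alpha *: b (x k w).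
Proof.
by rewrite theta_rec /step_mx mulmxDl mul1mx -scalemxAl scalerDr addrA.
Qed.

Let hist_comp n (F : X -> R) : measurable_fun setT F ->
  measurable_fun (setT : set (g_sigma_algebraType (hist n))) (fun w => F (x n w)).
Proof.
apply: measurable_fun_sub_comp => U mU.
by apply: sub_sigma_algebra; exact: history_past.
Qed.

(** The shift of index is essential: [theta n.+1] involves the chain only up to [x n], so [x n.+1]
    can be averaged out while [theta n.+1] is kept. *)
Let theta_next_adapted n :
  (forall i, measurable_fun (setT : set (g_sigma_algebraType (hist n)))
    (fun w => theta n w i ord0)) ->
  forall i, measurable_fun (setT : set (g_sigma_algebraType (hist n)))
    (fun w => theta n.+1 w i ord0).
Proof.
move=> IH i.
have -> : (fun w => theta n.+1 w i ord0) = fun w => theta n w i ord0 +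
    alpha * (\sum_j A (x n w) i j * theta n w j ord0 + b (x n w) i ord0).
  by apply/funext => w; rewrite theta_rec !mxE.
apply: measurable_funD; first exact: IH.
apply: measurable_funM; first exact: measurable_cst.
apply: measurable_funD; last by apply: (hist_comp (F := fun y => b y i ord0)); case: (bb i ord0).
apply: measurable_sum => j; apply: measurable_funM; last exact: IH.
by apply: (hist_comp (F := fun y => A y i j)); case: (Ab i j).
Qed.

Lemma theta_adapted n i :
  measurable_fun (setT : set (g_sigma_algebraType (hist n)))
    (fun w => theta n w i ord0).
Proof.
elim: n => [|n IHn] in i *.
  apply: (@measurable_fun_sub_comp _ _ (hist 0%N) _ _ _ _ (theta 0%N)
    (fun v : 'cV[R]_d => v i ord0)); last exact: measurable_coord.
  by move=> V mV; apply: sub_sigma_algebra; exact: history_init.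
apply: (@measurable_fun_sub_incl _ _ (hist n)); last exact: theta_next_adapted.
by move=> D hD; apply: sub_sigma_algebra; exact: history_sub hD.
Qed.

Let mtheta n i : measurable_fun setT (fun w => theta n w i ord0).
Proof. exact: measurable_coord_comp. Qed.

Let mdot n : measurable_fun setT (fun w => dot (theta n w) (theta n w)).
Proof.
under eq_fun do rewrite dotE.
by apply: measurable_sum => i; apply: measurable_funM.
Qed.

Lemma integrable_sq n :
  Pr.-integrable setT (EFin \o (fun w => dot (theta n w) (theta n w))).
Proof.
elim: n => [|n IHn].
  apply/integrableP; split; first exact/measurable_EFinP.
  under eq_integral do rewrite /= ger0_norm ?dot_ge0// -sqr_eucl_norm.
  exact: theta0_moment.
have Prfin : (Pr setT < +oo)%E by rewrite probability_setT ltry.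
(* One step at most doubles the norm and adds [B], and [(2 u + B)^2 <= 8 u^2 + 2 B^2]. *)
have h1 : Pr.-integrable setT (EFin \o (fun w => 8 * dot (theta n w) (theta n w) + 2 * B ^+ 2)).
  apply: integrableDR; first exact: integrableZlR.
  exact: (bmeas_integrable Prfin (bmeas_cst _)).
apply: le_integrable h1 => //; first exact/measurable_EFinP.
move=> w _; rewrite lee_fin /= !ger0_norm ?dot_ge0//; last first.
  by have := sqr_ge0 B; have := dot_ge0 (theta n w); lra.
rewrite -!sqr_eucl_norm theta_step.
set u := eucl_norm (theta n w); have u0 : 0 <= u := eucl_norm_ge0 _.
have n0 := eucl_norm_ge0 (b (x n w)).
have B0 : 0 <= B by apply: le_trans (b_bounded (x n w)).
have h : eucl_norm (step_mx A alpha (x n w) *m theta n w + alpha *: b (x n w)) <= 2 * u + B.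
  apply: (le_trans (eucl_normD _ _)); apply: lerD.
    apply: (le_trans (form_bounded_mulmx _ (step_mx_bounded A1 alpha_ge0 _) _)).
      by rewrite addr_ge0.
    by rewrite ler_wpM2r//; move: alpha_le1; lra.
  rewrite eucl_normZ ger0_norm//.
  apply: le_trans (b_bounded (x n w)).
  by rewrite ler_piMl.
apply: (@le_trans _ _ ((2 * u + B) ^+ 2)).
  by rewrite ler_pXn2r ?nnegrE ?eucl_norm_ge0// addr_ge0 ?mulr_ge0.
by have := sqr_ge0 (2 * u - B); rewrite !expr2; lra.
Qed.

Let le_dot n w i : theta n w i ord0 ^+ 2 <= dot (theta n w) (theta n w).
Proof.
rewrite -sqr_eucl_norm -real_normK ?num_real//.
by rewrite ler_pXn2r ?nnegrE ?eucl_norm_ge0 ?coord_le_eucl_norm.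
Qed.

Lemma integrable_coordM n i j :
  Pr.-integrable setT (EFin \o (fun w => theta n w i ord0 * theta n w j ord0)).
Proof.
apply: le_integrable (integrable_sq n) => //.
  by apply/measurable_EFinP; exact: measurable_funM.
move=> w _; rewrite lee_fin /= normrM [leRHS]ger0_norm ?dot_ge0//.
have hi := le_dot n w i; have hj := le_dot n w j.
have := sqr_ge0 (`|theta n w i ord0| - `|theta n w j ord0|).
rewrite sqrrB !real_normK ?num_real//.
by move: hi hj; lra.
Qed.

Lemma integrable_coord n i : Pr.-integrable setT (EFin \o (fun w => theta n w i ord0)).
Proof.
have Prfin : (Pr setT < +oo)%E by rewrite probability_setT ltry.
have h1 : Pr.-integrable setT (EFin \o (fun w => dot (theta n w) (theta n w) + 1)).
  apply: integrableDR; first exact: integrable_sq.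
  exact: (bmeas_integrable Prfin (bmeas_cst _)).
apply: le_integrable h1 => //; first exact/measurable_EFinP.
move=> w _; rewrite lee_fin /= [leRHS]ger0_norm ?addr_ge0 ?dot_ge0//.
have := le_dot n w i; have := sqr_ge0 (`|theta n w i ord0| - 1).
rewrite sqrrB real_normK ?num_real//.
have := normr_ge0 (theta n w i ord0).
by lra.
Qed.

Let bmeas_chain (F : X -> R) m : bmeas F -> bmeas (fun w => F (x m w)).
Proof.
move=> [mF [e Fe]]; split; last by exists e.
by apply: (measurableT_comp mF).
Qed.

Lemma stationary_Rintegral F : bmeas F ->
  \int[pi]_y (\int[P y]_z F z) = \int[pi]_y F y.
Proof.
move=> Fb; have pifin : (pi setT < +oo)%E by rewrite probability_setT ltry.
by apply/esym/bmeas_integral_mixture => // U mU; rewrite pi_stationary.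
Qed.

Lemma chain_stationary n F : bmeas F ->
  \int[Pr]_w F (x n w) = \int[pi]_y F y.
Proof.
elim: n F => [|n IHn] F Fb.
  have [mF _] := Fb.
  have Prfin : (Pr setT < +oo)%E by rewrite probability_setT ltry.
  rewrite /Rintegral; congr fine.
  rewrite (eq_measure_integral (distribution Pr (x 0%N))); last first.
    by move=> U mU _; exact/esym/x0_law.
  rewrite integral_pushforward//.
  - by apply/measurable_EFinP.
  - by rewrite preimage_setT; apply: (bmeas_integrable Prfin (bmeas_chain 0 Fb)).
have one_adapted : measurable_fun (setT : set (g_sigma_algebraType (hist n)))
  (fun=> 1 : R) by exact: measurable_cst.
have Prfin : (Pr setT < +oo)%E by rewrite probability_setT ltry.
have := history_expectation x_markov theta_indep one_adapted
  (bmeas_integrable Prfin (bmeas_cst 1)) Fb.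
under eq_Rintegral do rewrite mul1r.
under [in RHS]eq_Rintegral do rewrite mul1r.
by move=> ->; rewrite (IHn _ (bmeas_kernel P Fb)) stationary_Rintegral.
Qed.

Let form_sum (u : 'cV[R]_d) (G : 'M[R]_d) :
  dot u (G *m u) = \sum_i \sum_j (u i ord0 * u j ord0) * G i j.
Proof.
rewrite dotE; apply: eq_bigr => i _; rewrite mxE mulr_sumr.
by apply: eq_bigr => j _; rewrite [G i j * _]mulrC mulrA.
Qed.

Lemma integrable_form_theta n m Q : bmeas_mx Q ->
  Pr.-integrable setT (EFin \o (fun w => dot (theta n w) (Q (x m w) *m theta n w))).
Proof.
move=> Qb; under [X in _.-integrable _ (EFin \o X)]eq_fun do rewrite form_sum.
apply: integrable_sumEFin => i; apply: integrable_sumEFin => j.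
apply: integrableM_bmeas; first exact: integrable_coordM.
exact: (bmeas_chain m (Qb i j)).
Qed.

Lemma integrable_dot_theta n m q : bmeas_mx q ->
  Pr.-integrable setT (EFin \o (fun w => dot (theta n w) (q (x m w)))).
Proof.
move=> qb; under [X in _.-integrable _ (EFin \o X)]eq_fun do rewrite dotE.
apply: integrable_sumEFin => i.
apply: integrableM_bmeas; first exact: integrable_coord.
exact: (bmeas_chain m (qb i ord0)).
Qed.

Lemma form_step n Q : bmeas_mx Q ->
  \int[Pr]_w dot (theta n.+1 w) (Q (x n.+1 w) *m theta n.+1 w) =
  \int[Pr]_w dot (theta n.+1 w) (averaged P Q (x n w) *m theta n.+1 w).
Proof.
move=> Qb; have PQb := bmeas_averaged P Qb.
have int_ij (m : nat) (F : X -> R) i j : bmeas F -> Pr.-integrable setT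
    (EFin \o (fun w => (theta n.+1 w i ord0 * theta n.+1 w j ord0) * F (x m w))).
  by move=> Fb; apply: integrableM_bmeas; [exact: integrable_coordM|exact: bmeas_chain].
under eq_Rintegral do rewrite form_sum.
under [in RHS]eq_Rintegral do rewrite form_sum.
rewrite !Rintegral_sum; last 2 first.
- by move=> i; apply: integrable_sumEFin => j; apply: (int_ij n (fun y => averaged P Q y i j)).
- by move=> i; apply: integrable_sumEFin => j; apply: (int_ij n.+1 (fun y => Q y i j)).
apply: eq_bigr => i _; rewrite !Rintegral_sum; last 2 first.
- by move=> j; apply: (int_ij n (fun y => averaged P Q y i j)).
- by move=> j; apply: (int_ij n.+1 (fun y => Q y i j)).
apply: eq_bigr => j _.
have mY : measurable_fun (setT : set (g_sigma_algebraType (hist n)))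
    (fun w => theta n.+1 w i ord0 * theta n.+1 w j ord0).
  by apply: measurable_funM; apply: theta_next_adapted => k; exact: theta_adapted.
rewrite (history_expectation x_markov theta_indep mY (integrable_coordM _ _ _) (Qb i j)).
by apply: eq_Rintegral => w _; rewrite /averaged mxE.
Qed.

Lemma dot_step n q : bmeas_mx q ->
  \int[Pr]_w dot (theta n.+1 w) (q (x n.+1 w)) =
  \int[Pr]_w dot (theta n.+1 w) (averaged P q (x n w)).
Proof.
move=> qb; have Pqb := bmeas_averaged P qb.
under eq_Rintegral do rewrite dotE.
under [in RHS]eq_Rintegral do rewrite dotE.
rewrite !Rintegral_sum; last 2 first.
- move=> i; apply: integrableM_bmeas; first exact: integrable_coord.
  exact: (bmeas_chain n (Pqb i ord0)).
- move=> i; apply: integrableM_bmeas; first exact: integrable_coord.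
  exact: (bmeas_chain n.+1 (qb i ord0)).
apply: eq_bigr => i _.
have mY : measurable_fun (setT : set (g_sigma_algebraType (hist n)))
    (fun w => theta n.+1 w i ord0).
  by apply: theta_next_adapted => k; exact: theta_adapted.
rewrite (history_expectation x_markov theta_indep mY (integrable_coord _ _) (qb i ord0)).
by apply: eq_Rintegral => w _; rewrite /averaged mxE.
Qed.

Section moments.
Context (Q0 : 'M[R]_d) (q0 : 'cV[R]_d).

Local Notation Q k := (quad_coef P A alpha Q0 k).
Local Notation q k := (lin_coef P A b alpha Q0 q0 k).
Local Notation r k := (cst_coef P A b alpha Q0 q0 k).

Local Notation affine_moment n := (affine_mean Pr (theta n) Q0 q0).

Let backward k n :=
  \int[Pr]_w dot (theta n w) (Q k (x n w) *m theta n w) +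
  \int[Pr]_w dot (theta n w) (q k (x n w)) + \int[Pr]_w r k (x n w).

Let Prfin : (Pr setT < +oo)%E. Proof. by rewrite probability_setT ltry. Qed.

(** The quadratic and linear parts are averaged over [x n.+1], then [theta n.+1] is expanded. Only
    the mean of the constant part matters, so stationarity suffices to move it back by one step. *)
Let backward_step k n : backward k n.+1 = backward k.+1 n.
Proof.
have Qb := bmeas_quad_coef P alpha Q0 Ab k.
have qb := bmeas_lin_coef P alpha Q0 q0 Ab bb k.
have rb := bmeas_cst_coef P alpha Q0 q0 Ab bb k.
have Qb' := bmeas_quad_coef P alpha Q0 Ab k.+1.
have qb' := bmeas_lin_coef P alpha Q0 q0 Ab bb k.+1.
have rb' := bmeas_cst_coef P alpha Q0 q0 Ab bb k.+1.
rewrite /backward form_step// dot_step//.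
rewrite (chain_stationary n.+1 rb) -(stationary_Rintegral rb).
rewrite -(chain_stationary n (bmeas_kernel P rb)).
have Pi := @bmeas_integrable _ _ _ Pr _ Prfin.
rewrite -!RintegralD//; first last.
- exact: integrable_dot_theta (bmeas_averaged P qb).
- exact: integrable_form_theta (bmeas_averaged P Qb).
- exact: (Pi _ (bmeas_chain n (bmeas_kernel P rb))).
- apply: integrableDR.
    exact: integrable_form_theta (bmeas_averaged P Qb).
  exact: integrable_dot_theta (bmeas_averaged P qb).
- exact: integrable_dot_theta qb'.
- exact: integrable_form_theta Qb'.
- exact: (Pi _ (bmeas_chain n rb')).
- apply: integrableDR; first exact: integrable_form_theta Qb'.
  exact: integrable_dot_theta qb'.
apply: eq_Rintegral => w _; rewrite theta_step [in RHS]/=.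
set y := x n w; set t := theta n w; set Ph := step_mx A alpha y.
set G := averaged P (Q k) y.
have -> : dot t (Q k.+1 y *m t) = dot (Ph *m t) (G *m (Ph *m t)).
  by rewrite /quad_coef /= quad_step_form.
rewrite mulmxDr -scalemxAr !(dotDl, dotDr, dotZl, dotZr).
rewrite /lin_step /forcing -/Ph -/G !(dot_mulmx t Ph^T) trmxK (mulmxDl G) dotDr.
have -> : dot (b y) (G *m (Ph *m t)) = dot (Ph *m t) (G^T *m b y).
  by rewrite dot_mulmx dotC.
by ring.
Qed.

Lemma affine_moment_backward n k : affine_moment (n + k) = backward k n.
Proof.
elim: k n => [|k IHk] n; last by rewrite addnS -addSn IHk backward_step.
by rewrite addn0 /backward /affine_mean /= Rintegral_cst// mul0r addr0.
Qed.

Context (g h c s : R).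
Hypotheses (g_ge0 : 0 <= g) (h_ge0 : 0 <= h) (B_ge0 : 0 <= B) (c_ge0 : 0 <= c).
Hypotheses (s_ge : 1 / 2 <= s) (s_le1 : s <= 1).
Hypothesis alpha_rate : alpha <= 3 * g * (1 - s).
Hypothesis decay : forall n y v,
  dot v (iter n (quad_step P A alpha) (fun=> 1%:M) y *m v) <=
  (h * s ^+ n) ^+ 2 * dot v v.
Hypothesis Q0_bounded : form_bounded Q0 c.

Definition sq_moment n := \int[Pr]_w dot (theta n w) (theta n w).

Definition coef_const := h ^+ 2 * c + h * (eucl_norm q0 + lin_const g h B c).

Lemma coef_const_ge0 : 0 <= coef_const.
Proof.
by rewrite addr_ge0 ?mulr_ge0 ?addr_ge0 ?sqr_ge0 ?eucl_norm_ge0// /lin_const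
  /forcing_const ?mulr_ge0 ?sqr_ge0.
Qed.

(* The constant coefficient does not depend on [theta], and its mean does not
   depend on the starting time, by stationarity. *)
Lemma affine_moment_centered n k :
  `|affine_moment (n + k) - \int[pi]_y r k y| <=
  coef_const * (1 + sq_moment n) * s ^+ k.
Proof.
have Qb := bmeas_quad_coef P alpha Q0 Ab k.
have qb := bmeas_lin_coef P alpha Q0 q0 Ab bb k.
have rb := bmeas_cst_coef P alpha Q0 q0 Ab bb k.
have s0 : 0 <= s by move: s_ge; lra.
rewrite affine_moment_backward /backward (chain_stationary n rb) addrK.
rewrite -RintegralD//; [|exact: integrable_form_theta|exact: integrable_dot_theta].
have -> : coef_const * (1 + sq_moment n) * s ^+ k =
    \int[Pr]_w (coef_const * s ^+ k * (1 + dot (theta n w) (theta n w))).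
  have oi := bmeas_integrable Prfin (bmeas_cst 1).
  have sqi := integrable_sq n.
  rewrite RintegralZl//; last exact: integrableDR.
  have -> : \int[Pr]_w (1 + dot (theta n w) (theta n w)) = 1 + sq_moment n.
    rewrite RintegralD//; congr (_ + _).
    by rewrite Rintegral_cst// mul1r [X in fine X](_ : _ = 1%E)//; exact: probability_setT.
  by rewrite mulrAC.
have fi : Pr.-integrable setT (EFin \o (fun w =>
    dot (theta n w) (Q k (x n w) *m theta n w) + dot (theta n w) (q k (x n w)))).
  by apply: integrableDR; [exact: integrable_form_theta|exact: integrable_dot_theta].
apply: (le_trans (le_normr_Rintegral _ fi)) => //.
apply: le_Rintegral => //.
- have := integrable_abse fi; apply: eq_integrable => //.
- apply: integrableZlR; apply: integrableDR; last exact: integrable_sq.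
  exact: (bmeas_integrable Prfin (bmeas_cst 1)).
move=> w _; apply: (le_trans (ler_normD _ _)).
set t := theta n w; set C := eucl_norm q0 + lin_const g h B c.
have C0 : 0 <= C.
  by rewrite addr_ge0 ?eucl_norm_ge0// /lin_const /forcing_const !mulr_ge0 ?sqr_ge0.
have h1 : `|dot t (Q k (x n w) *m t)| <= h ^+ 2 * c * s ^+ k * (1 + dot t t).
  have := quad_coef_bounded Ab h_ge0 c_ge0 s_ge decay Q0_bounded k (x n w) t t.
  move=> /le_trans; apply; rewrite -mulrA -expr2 sqr_eucl_norm.
  apply: ler_pM; rewrite ?dot_ge0 ?mulr_ge0 ?sqr_ge0 ?exprn_ge0 ?lerDr//.
  have -> : (h * s ^+ k) ^+ 2 * c = h ^+ 2 * c * (s ^+ k * s ^+ k) by ring.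
  rewrite ler_wpM2l ?mulr_ge0 ?sqr_ge0//.
  by rewrite ler_piMr ?exprn_ge0// exprn_ile1.
have h2 : `|dot t (q k (x n w))| <= h * C * s ^+ k * (1 + dot t t).
  apply: (le_trans (cauchy_schwarz _ _)); rewrite mulrC.
  apply: ler_pM; rewrite ?eucl_norm_ge0//.
    exact: (lin_coef_bounded q0 Ab bb A1 alpha_ge0 alpha_le1 g_ge0 h_ge0 B_ge0
      c_ge0 s_ge s_le1 alpha_rate decay b_bounded Q0_bounded).
  rewrite -sqr_eucl_norm; have := sqr_ge0 (eucl_norm t - 1).
  by have := eucl_norm_ge0 t; rewrite sqrrB; lra.
by rewrite /coef_const -/C; move: (lerD h1 h2); lra.
Qed.

Lemma affine_moment_cauchy n k :
  `|affine_moment k - affine_moment (n + k)| <=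
  coef_const * (2 + sq_moment 0 + sq_moment n) * s ^+ k.
Proof.
have h1 := affine_moment_centered 0 k; have h2 := affine_moment_centered n k.
rewrite add0n distrC in h1; rewrite distrC.
have := ler_normD (affine_moment (n + k) - \int[pi]_y r k y)
  (\int[pi]_y r k y - affine_moment k).
by rewrite addrA subrK; move: h1 h2; lra.
Qed.

(** Meant for [Q0 = 1] and [q0 = 0], where it bounds the second moments uniformly in time. *)
Lemma affine_moment_bounded k : `|affine_moment k| <=
  coef_const * (1 + sq_moment 0) + 3 * g * cst_const q0 g h B c.
Proof.
have h1 := affine_moment_centered 0 k.
have h2 := cst_coef_bounded q0 Ab bb A1 alpha_ge0 alpha_le1 g_ge0 h_ge0 B_ge0
      c_ge0 s_ge s_le1 alpha_rate decay b_bounded Q0_bounded k (probability_setT pi)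
      stationary_Rintegral.
have s0 : 0 <= s by move: s_ge; lra.
have s1 : s ^+ k <= 1 by rewrite exprn_ile1.
have m0 : 0 <= coef_const * (1 + sq_moment 0).
  rewrite mulr_ge0 ?coef_const_ge0// addr_ge0//.
  by apply: Rintegral_ge0 => w _; exact: dot_ge0.
have c0 : 0 <= 3 * g * cst_const q0 g h B c.
  by rewrite /cst_const /lin_const /forcing_const ?(addr_ge0, mulr_ge0) ?eucl_norm_ge0 ?sqr_ge0.
have h3 := ler_wpM2l m0 s1.
have h4 : 3 * g * cst_const q0 g h B c * (1 - s ^+ k) <= 3 * g * cst_const q0 g h B c.
  by rewrite ler_piMr// gerBl exprn_ge0.
have := ler_normD (affine_moment k - \int[pi]_y r k y) (\int[pi]_y r k y).
by rewrite subrK; move: h1 h2 h3 h4; rewrite add0n mulr1; lra.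
Qed.

End moments.

End linear_stochastic_approximation.

(** * Wasserstein-2 convergence and the first two moments *)

Section wasserstein_limits.
Context (R : realType).

(* Holds without measurability: the integral of a nonnegative function is a
   supremum over the simple functions below it. *)
Lemma ge0_le_integral_any dT (T : measurableType dT)
    (mu : {measure set T -> \bar R}) (f g : T -> \bar R) :
  (forall t, 0 <= f t)%E -> (forall t, f t <= g t)%E ->
  (\int[mu]_t f t <= \int[mu]_t g t)%E.
Proof.
move=> f0 fg; have g0 t : (0 <= g t)%E by exact: le_trans (f0 t) (fg t).
rewrite !ge0_integralTE//; apply: le_ereal_sup => _ [h hf <-]; exists h => //.
by move=> t; exact: le_trans (hf t) (fg t).
Qed.

Section square_integrable_vectors.
Context dZ (Z : measurableType dZ) (mu : {measure set Z -> \bar R}) (d : nat).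
Hypothesis mufin : (mu setT < +oo)%E.

Lemma measurable_dot (f h : Z -> 'cV[R]_d) :
  (forall i, measurable_fun setT (fun z => f z i ord0)) ->
  (forall i, measurable_fun setT (fun z => h z i ord0)) ->
  measurable_fun setT (fun z => dot (f z) (h z)).
Proof.
move=> mf mh; under eq_fun do rewrite dotE.
by apply: measurable_sum => i; exact: measurable_funM.
Qed.

Lemma measurable_mulmx (f : Z -> 'cV[R]_d) (Q : 'M[R]_d) :
  (forall i, measurable_fun setT (fun z => f z i ord0)) ->
  forall i, measurable_fun setT (fun z => (Q *m f z) i ord0).
Proof.
move=> mf i; under eq_fun do rewrite mxE.
by apply: measurable_sum => j; apply: measurable_funM => //; exact: measurable_cst.
Qed.

Context (f : Z -> 'cV[R]_d).
Hypothesis mf : forall i, measurable_fun setT (fun z => f z i ord0).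
Hypothesis fi : mu.-integrable setT (EFin \o (fun z => dot (f z) (f z))).

Lemma sq_integrable_form Q c : form_bounded Q c ->
  mu.-integrable setT (EFin \o (fun z => dot (f z) (Q *m f z))).
Proof.
move=> Qc; apply: (le_integrable _ _ _ (integrableZlR c fi)) => //.
  by apply/measurable_EFinP; apply: measurable_dot => //; exact: measurable_mulmx.
move=> z _; rewrite lee_fin /=; apply: (le_trans (Qc _ _)).
by rewrite -mulrA -expr2 sqr_eucl_norm ler_norm.
Qed.

Lemma sq_integrable_dot q : mu.-integrable setT (EFin \o (fun z => dot (f z) q)).
Proof.
have h : mu.-integrable setT (EFin \o (fun z => eucl_norm q * (1 + dot (f z) (f z)))).
  apply: integrableZlR; apply: integrableDR => //.
  exact: (bmeas_integrable mufin (bmeas_cst 1)).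
apply: le_integrable h => //.
  by apply/measurable_EFinP; apply: measurable_dot => // i; exact: measurable_cst.
move=> z _; rewrite lee_fin /= [leRHS]ger0_norm ?mulr_ge0 ?addr_ge0 ?dot_ge0 ?eucl_norm_ge0//.
apply: (le_trans (cauchy_schwarz _ _)); rewrite mulrC ler_wpM2l ?eucl_norm_ge0//.
rewrite -sqr_eucl_norm; have := sqr_ge0 (eucl_norm (f z) - 1).
by have := eucl_norm_ge0 (f z); rewrite sqrrB; lra.
Qed.

End square_integrable_vectors.

Section coupled_moments.
Context dZ (Z : measurableType dZ) (kappa : probability Z R) (d : nat).
Context (u v : Z -> 'cV[R]_d) (e : R).
Hypotheses (mu : measurable_fun setT u) (mv : measurable_fun setT v).
Hypothesis ui : kappa.-integrable setT (EFin \o (fun z => dot (u z) (u z))).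
Hypotheses (e_gt0 : 0 < e) (e_le1 : e <= 1).
Hypothesis uv : (\int[kappa]_z (dot (u z - v z) (u z - v z))%:E <= (e ^+ 2)%:E)%E.

Let mui i : measurable_fun setT (fun z => u z i ord0).
Proof. exact: measurable_coord_comp. Qed.

Let mvi i : measurable_fun setT (fun z => v z i ord0).
Proof. exact: measurable_coord_comp. Qed.

Let mDi i : measurable_fun setT (fun z => (u z - v z) i ord0).
Proof. by under eq_fun do rewrite !mxE; exact: measurable_funB. Qed.

Let Di : kappa.-integrable setT (EFin \o (fun z => dot (u z - v z) (u z - v z))).
Proof.
apply/integrableP; split; first by apply/measurable_EFinP; exact: measurable_dot.
under eq_integral do rewrite /= ger0_norm ?dot_ge0//.
by apply: le_lt_trans uv _; rewrite ltry.
Qed.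

Lemma coupled_integrable : kappa.-integrable setT (EFin \o (fun z => dot (v z) (v z))).
Proof.
have h : kappa.-integrable setT (EFin \o (fun z =>
    2 * dot (u z) (u z) + 2 * dot (u z - v z) (u z - v z))).
  by apply: integrableDR; exact: integrableZlR.
apply: le_integrable h => //; first by apply/measurable_EFinP; exact: measurable_dot.
move=> z _; rewrite lee_fin /= !ger0_norm ?addr_ge0 ?mulr_ge0 ?dot_ge0//.
(* [2 |u|^2 + 2 |u - v|^2 - |v|^2] is the square [|2 u - v|^2]. *)
have := dot_ge0 (2 *: u z - v z).
by rewrite !(dotBl, dotBr, dotZl, dotZr) (dotC (v z)); lra.
Qed.

(** The difference is expanded around [u], so only the second moment of [u] enters. Weighting the
    products by [e] and [1 / e] balances a coupling cost of [e ^+ 2] into an error of order [e]. *)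
Lemma coupled_affine_mean Q q c : 0 <= c -> form_bounded Q c ->
  `|affine_mean kappa u Q q - affine_mean kappa v Q q| <=
  e * (c * (\int[kappa]_z dot (u z) (u z) + 2) + eucl_norm q).
Proof.
move=> c0 Qc; have vi := coupled_integrable.
have n0 := eucl_norm_ge0 q.
have kfin : (kappa setT < +oo)%E by rewrite probability_setT ltry.
have iu1 := sq_integrable_form mui ui Qc; have iu2 := sq_integrable_dot kfin mui ui q.
have iv1 := sq_integrable_form mvi vi Qc; have iv2 := sq_integrable_dot kfin mvi vi q.
have iu := integrableDR iu1 iu2; have iv := integrableDR iv1 iv2.
rewrite /affine_mean -!RintegralD// -RintegralB//.
have iuv : kappa.-integrable setT (EFin \o (fun z =>
   (dot (u z) (Q *m u z) + dot (u z) q) - (dot (v z) (Q *m v z) + dot (v z) q))).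
  exact: (integrableB measurableT iu iv).
apply: (le_trans (le_normr_Rintegral _ iuv)) => //.
have oi := bmeas_integrable kfin (bmeas_cst (eucl_norm q * e / 2)).
pose D z := dot (u z - v z) (u z - v z).
have D_le : \int[kappa]_z D z <= e ^+ 2.
  by rewrite -lee_fin /Rintegral fineK//; exact: (integrable_fin_num _ Di).
have i1 := integrableZlR (c * e) ui.
have i2 := integrableZlR (c / e + c + eucl_norm q / e / 2) Di.
apply: (@le_trans _ _ (\int[kappa]_z (c * e * dot (u z) (u z) +
    (c / e + c + eucl_norm q / e / 2) * D z + eucl_norm q * e / 2))).
  apply: le_Rintegral => //.
  - by have := integrable_abse iuv; apply: eq_integrable.
  - by apply: integrableDR => //; exact: integrableDR.
  move=> z _.
  set a := eucl_norm (u z); set dl := eucl_norm (u z - v z).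
  have a0 : 0 <= a := eucl_norm_ge0 _; have dl0 : 0 <= dl := eucl_norm_ge0 _.
  have -> : dot (u z) (Q *m u z) + dot (u z) q - (dot (v z) (Q *m v z) + dot (v z) q) =
    dot (u z - v z) (Q *m u z) + dot (u z) (Q *m (u z - v z)) -
    dot (u z - v z) (Q *m (u z - v z)) + dot (u z - v z) q.
    by rewrite !mulmxBr !(dotBl, dotBr); ring.
  have t1 := Qc (u z - v z) (u z); have t2 := Qc (u z) (u z - v z).
  have t3 := Qc (u z - v z) (u z - v z); have t4 := cauchy_schwarz (u z - v z) q.
  rewrite -/a -/dl in t1 t2 t3 t4.
  have tri : `|dot (u z - v z) (Q *m u z) + dot (u z) (Q *m (u z - v z)) -
      dot (u z - v z) (Q *m (u z - v z)) + dot (u z - v z) q| <=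
      c * (2 * (dl * a)) + c * (dl * dl) + eucl_norm q * dl.
    apply: (le_trans (ler_normD _ _)); apply: lerD; last by rewrite mulrC.
    apply: (le_trans (ler_normB _ _)); apply: lerD; last by rewrite mulrA.
    apply: (le_trans (ler_normD _ _)).
    by move: (lerD t1 t2); lra.
  apply: (le_trans tri); rewrite /D -!sqr_eucl_norm -/a -/dl.
  have am1 : 2 * (dl * a) <= e * a ^+ 2 + dl ^+ 2 / e.
    have := mulr_ge0 (ltW (divr_gt0 ltr01 e_gt0)) (sqr_ge0 (e * a - dl)).
    have -> : 1 / e * (e * a - dl) ^+ 2 = e * a ^+ 2 - 2 * (dl * a) + dl ^+ 2 / e.
      by field; rewrite gt_eqF.
    by lra.
  have am2 : dl <= e / 2 + dl ^+ 2 / e / 2.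
    have := mulr_ge0 (ltW (divr_gt0 ltr01 e_gt0)) (sqr_ge0 (e - dl)).
    have -> : 1 / e * (e - dl) ^+ 2 = e - 2 * dl + dl ^+ 2 / e.
      by field; rewrite gt_eqF.
    by lra.
  have := lerD (ler_wpM2l c0 am1) (ler_wpM2l n0 am2).
  by rewrite -expr2; lra.
rewrite RintegralD//; last exact: integrableDR.
rewrite (RintegralD measurableT i1 i2) (RintegralZl _ measurableT ui).
rewrite (RintegralZl _ measurableT Di).
have k1 : fine (kappa setT) = 1 by rewrite probability_setT.
rewrite Rintegral_cst// k1.
have e0 := ltW e_gt0.
have k0 : 0 <= c / e + c + eucl_norm q / e / 2.
  by rewrite !addr_ge0// !divr_ge0.
have := ler_wpM2l k0 D_le; rewrite mulr1.
have -> : (c / e + c + eucl_norm q / e / 2) * e ^+ 2 = c * e + c * e ^+ 2 + eucl_norm q * e / 2.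
  by field; rewrite gt_eqF.
have : c * e ^+ 2 <= c * e by rewrite ler_wpM2l// expr2 ler_piMr.
rewrite -/D.
by lra.
Qed.

End coupled_moments.

Lemma same_law_expectation d1 (T1 : measurableType d1) d2 (T2 : measurableType d2)
    dS (S : measurableType dS) (mu1 : {measure set T1 -> \bar R})
    (mu2 : {measure set T2 -> \bar R}) (p1 : T1 -> S) (p2 : T2 -> S) (F : S -> R) :
  measurable_fun setT p1 -> measurable_fun setT p2 -> measurable_fun setT F ->
  (forall U, measurable U -> mu1 (p1 @^-1` U) = mu2 (p2 @^-1` U)) ->
  mu1.-integrable setT (EFin \o (fun z => F (p1 z))) ->
  mu2.-integrable setT (EFin \o (fun z => F (p2 z))) /\
  \int[mu1]_z F (p1 z) = \int[mu2]_z F (p2 z).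
Proof.
move=> mp1 mp2 mF law Fi; have mEF := (measurable_EFinP _ _).2 mF.
have lawE (G : S -> \bar R) :
    (\int[pushforward mu1 p1]_s G s = \int[pushforward mu2 p2]_s G s)%E.
  by apply: eq_measure_integral => U mU _; exact: law.
have Fi' : mu2.-integrable setT (EFin \o (fun z => F (p2 z))).
  apply/integrableP; split; first by apply/measurable_EFinP; exact: measurableT_comp.
  have /integrableP[_] := Fi.
  have mabs : measurable_fun setT (fun s => `|(F s)%:E|)%E by exact: measurableT_comp.
  have abs0 : {in (setT : set S), forall s, (0 <= `|(F s)%:E|)%E} by move=> s _.
  have := ge0_integral_pushforward mp1 mu1 measurableT mabs abs0.
  have := ge0_integral_pushforward mp2 mu2 measurableT mabs abs0.
  by rewrite !preimage_setT /= => <- e1; rewrite -lawE e1.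
split => //; rewrite /Rintegral; congr fine.
have := integral_pushforward mp1 mEF (mu := mu1) (D := setT).
rewrite preimage_setT => /(_ Fi measurableT) /= <-.
have := integral_pushforward mp2 mEF (mu := mu2) (D := setT).
by rewrite preimage_setT => /(_ Fi' measurableT) /= <-.
Qed.

Section wasserstein_affine_means.
Context dX (X : measurableType dX) (d : nat).
Context dO (Omega : measurableType dO) (Pr : probability Omega R).
Context dO' (Omega' : measurableType dO') (Pr' : probability Omega' R).
Context (x : nat -> {RV Pr >-> X}) (theta : nat -> {RV Pr >-> 'cV[R]_d}).
Context (xinf : {RV Pr' >-> X}) (thetainf : {RV Pr' >-> 'cV[R]_d}).
Hypothesis W2_cvg : wasserstein2 (@joint_dist R dX X d)
  (distribution Pr (rv_pair (x k) (theta k)))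
  (distribution Pr' (rv_pair xinf thetainf)) @[k --> \oo] --> 0%E.
Hypothesis theta_sq : forall k,
  Pr.-integrable setT (EFin \o (fun w => dot (theta k w) (theta k w))).

Let S := (X * 'cV[R]_d)%type.

Lemma near_optimal_coupling e : 0 < e -> \forall k \near \oo,
  exists2 kappa : probability (S * S)%type R,
    is_coupling (distribution Pr (rv_pair (x k) (theta k)))
                (distribution Pr' (rv_pair xinf thetainf)) kappa &
    (\int[kappa]_z (dot (z.1.2 - z.2.2) (z.1.2 - z.2.2))%:E <= (e ^+ 2)%:E)%E.
Proof.
move=> e0.
have e0E : (0 < e%:E)%E by rewrite lte_fin.
have : \forall k \near \oo, (wasserstein2 (@joint_dist R dX X d)
    (distribution Pr (rv_pair (x k) (theta k)))
    (distribution Pr' (rv_pair xinf thetainf)) < e%:E)%E.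
  have N : nbhs (0%E : \bar R) [set y | (y < e%:E)%E].
    by apply: open_nbhs_nbhs; split => //; exact: open_ereal_lt_ereal.
  by have /= := W2_cvg N.
apply: filterS => k; rewrite /wasserstein2; set I := ereal_inf _ => Ie.
have I0 : (0 <= I)%E.
  apply: le_ereal_inf_tmp => _ [kappa _ <-].
  by apply: integral_ge0 => z _; rewrite lee_fin sqr_ge0.
have : (I < (e ^+ 2)%:E)%E.
  move: I I0 Ie => [r| |]//; last by rewrite poweRyr ?invr_neq0.
  rewrite !lee_fin poweR_EFin !lte_fin => r0.
  rewrite powR12_sqrt// -{2}(sqr_sqrtr r0).
  by rewrite ltr_pXn2r ?nnegrE ?sqrtr_ge0 ?(ltW e0).
move=> /ereal_inf_lt[_ [kappa ck <-] ke]; exists kappa => //.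
(* The cost contains the indicator of distinct states, for which no measurability is at hand
   here. *)
apply: le_trans (ltW ke); apply: ge0_le_integral_any => z.
  by rewrite lee_fin dot_ge0.
rewrite lee_fin /joint_dist sqr_sqrtr ?addr_ge0 ?sqr_ge0//.
by rewrite sqr_eucl_norm lerDr.
Qed.

(** A finite second moment of the limit is not assumed; one coupling of finite cost transfers it
    from some [theta k]. *)
Lemma wasserstein_sq_integrable :
  Pr'.-integrable setT (EFin \o (fun w => dot (thetainf w) (thetainf w))).
Proof.
have [k _ /(_ k (leqnn k)) [kappa ck ke]] := near_optimal_coupling ltr01.
have mp1 : measurable_fun setT (fst : S * S -> S) by exact: measurable_fst.
have mp2 : measurable_fun setT (snd : S * S -> S) by exact: measurable_snd.
have mth : measurable_fun setT (snd : S -> 'cV[R]_d) by exact: measurable_snd.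
have mF0 : measurable_fun setT (fun s : S => dot s.2 s.2).
  by apply: measurable_dot => i; exact: measurable_coord_comp.
have mu : measurable_fun setT (fun z : S * S => z.1.2) by exact: measurableT_comp mp1.
have mv : measurable_fun setT (fun z : S * S => z.2.2) by exact: measurableT_comp mp2.
have mpair1 : measurable_fun setT (rv_pair (x k) (theta k)) by exact: measurable_funPT.
have mpair2 : measurable_fun setT (rv_pair xinf thetainf) by exact: measurable_funPT.
have law1 U : measurable U -> Pr (rv_pair (x k) (theta k) @^-1` U) = kappa (fst @^-1` U).
  by move=> mU; rewrite (ck U mU).1.
have law2 U : measurable U -> kappa (snd @^-1` U) = Pr' (rv_pair xinf thetainf @^-1` U).
  by move=> mU; rewrite (ck U mU).2.
have [ui _] := same_law_expectation mpair1 mp1 mF0 law1 (theta_sq k).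
have vi := coupled_integrable mu mv ui ke.
by have [] := same_law_expectation mp2 mpair2 mF0 law2 vi.
Qed.

Lemma wasserstein_affine_mean Q q c m : 0 <= c -> form_bounded Q c ->
  (forall k, \int[Pr]_w dot (theta k w) (theta k w) <= m) ->
  forall e, 0 < e -> \forall k \near \oo,
  `|affine_mean Pr (theta k) Q q - affine_mean Pr' thetainf Q q| <= e.
Proof.
move=> c0 Qc mb e e0.
have n0 := eucl_norm_ge0 q.
have m0 : 0 <= m.
  by apply: le_trans (mb 0%N); apply: Rintegral_ge0 => w _; exact: dot_ge0.
(* The factor of [e] in the coupling estimate, plus [1] to make it positive for the division. *)
pose K := c * (m + 2) + eucl_norm q + 1.
have K0 : 0 < K by rewrite ltr_wpDl// addr_ge0// mulr_ge0// addr_ge0.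
pose e' := Num.min 1 (e / K).
have e'0 : 0 < e' by rewrite lt_min ltr01 divr_gt0.
have e'1 : e' <= 1 by rewrite ge_min lexx.
have e'K : e' * K <= e by rewrite -ler_pdivlMr// ge_min lexx orbT.
have := near_optimal_coupling e'0; apply: filterS => k [kappa ck ke].
have mp1 : measurable_fun setT (fst : S * S -> S) by exact: measurable_fst.
have mp2 : measurable_fun setT (snd : S * S -> S) by exact: measurable_snd.
have mth : measurable_fun setT (snd : S -> 'cV[R]_d) by exact: measurable_snd.
have mc (i : 'I_d) : measurable_fun setT (fun s : S => s.2 i ord0).
  exact: measurable_coord_comp.
have Prfin : (Pr setT < +oo)%E by rewrite probability_setT ltry.
have kfin : (kappa setT < +oo)%E by rewrite probability_setT ltry.
have law1 U : measurable U -> Pr (rv_pair (x k) (theta k) @^-1` U) = kappa (fst @^-1` U).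
  by move=> mU; rewrite (ck U mU).1.
have law2 U : measurable U -> kappa (snd @^-1` U) = Pr' (rv_pair xinf thetainf @^-1` U).
  by move=> mU; rewrite (ck U mU).2.
have mF0 : measurable_fun setT (fun s : S => dot s.2 s.2) by exact: measurable_dot.
have mF1 : measurable_fun setT (fun s : S => dot s.2 (Q *m s.2)).
  by apply: measurable_dot => //; exact: measurable_mulmx.
have mF2 : measurable_fun setT (fun s : S => dot s.2 q).
  by apply: measurable_dot => // i; exact: measurable_cst.
have mpair1 : measurable_fun setT (rv_pair (x k) (theta k)) by exact: measurable_funPT.
have mpair2 : measurable_fun setT (rv_pair xinf thetainf) by exact: measurable_funPT.
have mu : measurable_fun setT (fun z : S * S => z.1.2) by exact: measurableT_comp mp1.
have mv : measurable_fun setT (fun z : S * S => z.2.2) by exact: measurableT_comp mp2.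
have mui i : measurable_fun setT (fun z : S * S => z.1.2 i ord0).
  exact: measurable_coord_comp.
have mvi i : measurable_fun setT (fun z : S * S => z.2.2 i ord0).
  exact: measurable_coord_comp.
have mti i : measurable_fun setT (fun w => theta k w i ord0).
  by apply: measurable_coord_comp; exact: measurable_funPT.
have tk := theta_sq k.
have [ui uE] := same_law_expectation mpair1 mp1 mF0 law1 tk.
have [_ uE1] := same_law_expectation mpair1 mp1 mF1 law1 (sq_integrable_form mti tk Qc).
have [_ uE2] := same_law_expectation mpair1 mp1 mF2 law1 (sq_integrable_dot Prfin mti tk q).
have vi := coupled_integrable mu mv ui ke.
have [_ vE1] := same_law_expectation mp2 mpair2 mF1 law2 (sq_integrable_form mvi vi Qc).
have [_ vE2] := same_law_expectation mp2 mpair2 mF2 law2 (sq_integrable_dot kfin mvi vi q).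
have := coupled_affine_mean mu mv ui e'0 e'1 ke q c0 Qc.
rewrite /affine_mean -uE1 -uE2 vE1 vE2 -uE => /le_trans; apply.
apply: le_trans e'K; rewrite ler_wpM2l ?(ltW e'0)//.
have := ler_wpM2l c0 (mb k).
by rewrite /K; lra.
Qed.

End wasserstein_affine_means.

End wasserstein_limits.

(** * Recovering the moments from affine-quadratic means *)

Section rank_one_forms.
Context (R : realType) (d : nat).
Implicit Types (u v : 'cV[R]_d).

Lemma dot_rank_one u v (s t : 'cV[R]_d) :
  dot s (u *m v^T *m t) = dot s u * dot v t.
Proof.
rewrite -mulmxA; have -> : v^T *m t = (dot v t)%:M by exact: mx11_scalar.
by rewrite mul_mx_scalar dotZr mulrC.
Qed.

Lemma form_bounded_rank_one u v :
  form_bounded (u *m v^T) (eucl_norm u * eucl_norm v).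
Proof.
move=> s t; rewrite dot_rank_one normrM.
have -> : eucl_norm u * eucl_norm v * eucl_norm s * eucl_norm t =
  (eucl_norm s * eucl_norm u) * (eucl_norm v * eucl_norm t) by ring.
by rewrite ler_pM ?cauchy_schwarz.
Qed.

Lemma dot_delta (v : 'cV[R]_d) i : dot v (delta_mx i ord0) = v i ord0.
Proof.
rewrite dotE (bigD1 i)//= big1 ?addr0 => [|j ji]; rewrite mxE ?eqxx ?mulr1//.
by rewrite (negbTE ji) mulr0.
Qed.

Lemma matrix_entry (Q : 'M[R]_d) i j :
  Q i j = dot (delta_mx i ord0) (Q *m delta_mx j ord0).
Proof. by rewrite dotC dot_delta -colE mxE. Qed.

End rank_one_forms.

Section moments_of_affine_means.
Context (R : realType) dZ (Z : measurableType dZ) (mu : probability Z R) (d : nat).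
Context (t : Z -> 'cV[R]_d).
Hypothesis mt : forall i, measurable_fun setT (fun z => t z i ord0).
Hypothesis ti : mu.-integrable setT (EFin \o (fun z => dot (t z) (t z))).

Lemma dot_mean u : dot u (expect_mx mu t) = affine_mean mu t 0 u.
Proof.
have mufin : (mu setT < +oo)%E by rewrite probability_setT ltry.
rewrite dot_expect_mx; last first.
  move=> i j; rewrite (ord1 j).
  under [X in _.-integrable _ (EFin \o X)]eq_fun do rewrite -dot_delta.
  exact: sq_integrable_dot.
rewrite /affine_mean; under [X in _ = X + _]eq_Rintegral do rewrite mul0mx /dot mulmx0 mxE.
rewrite Rintegral_cst// mul0r add0r.
by apply: eq_Rintegral => z _; rewrite dotC.
Qed.

Lemma form_second_moment u v :
  dot u (expect_mx mu (fun z => t z *m (t z)^T) *m v) = affine_mean mu t (u *m v^T) 0.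
Proof.
have mufin : (mu setT < +oo)%E by rewrite probability_setT ltry.
rewrite form_expect_mx; last first.
  move=> i j.
  have -> : (fun z => (t z *m (t z)^T) i j) =
      fun z => dot (t z) (delta_mx i ord0 *m (delta_mx j (ord0 : 'I_1))^T *m t z).
    by apply/funext => z; rewrite matrix_entry !dot_rank_one dotC [X in _ * X]dotC.
  by apply: (sq_integrable_form mt ti); exact: form_bounded_rank_one.
rewrite /affine_mean; under [X in _ = _ + X]eq_Rintegral do rewrite /dot mulmx0 mxE.
rewrite Rintegral_cst// mul0r addr0.
by apply: eq_Rintegral => z _; rewrite !dot_rank_one (dotC u) (dotC v).
Qed.

End moments_of_affine_means.

(** * Kernel powers and uniform bounds *)

Section kernel_powers.
Context (R : realType) dX (X : measurableType dX) (P : R.-pker X ~> X).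

Lemma kpow_setT n x : kpow P n x setT = 1%E.
Proof.
elim: n => [|n IHn]; first exact: diracT.
rewrite [LHS](_ : _ = \int[kpow P n x]_y P y setT)%E//.
under eq_integral do rewrite prob_kernel.
by rewrite integral_cst// IHn mule1.
Qed.

Lemma expect_mx_kpow m n k (G : X -> 'M[R]_(m, n)) x : bmeas_mx G ->
  expect_mx (kpow P k x) G = iter k (@averaged _ _ _ P m n) G x.
Proof.
elim: k G => [|k IHk] G Gb.
  apply/matrixP => i j; rewrite mxE /Rintegral integral_dirac//; last first.
    by apply/measurable_EFinP; case: (Gb i j).
  by rewrite diracT mul1e.
(* [kpow] applies [P] last in time, so the innermost averaging is the one peeled off. *)
rewrite iterSr -IHk; last exact: bmeas_averaged.
apply/matrixP => i j; rewrite !mxE.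
under [RHS]eq_Rintegral do rewrite mxE.
have kfin : (kpow P k x setT < +oo)%E by rewrite kpow_setT ltry.
exact: (@bmeas_integral_mixture _ _ _ P (kpow P k x) (kpow P k.+1 x)).
Qed.

End kernel_powers.

Section uniform_bounds.
Context (R : realType) dX (X : measurableType dX).

Lemma sup_spectral_form_bounded d (A : X -> 'M[R]_d) c x :
  (sup_spectral A <= c%:E)%E -> form_bounded (A x) c.
Proof.
move=> Ac; apply: spectral_norm_form_bounded.
by rewrite -lee_fin; apply: le_trans Ac; apply: ereal_sup_ubound; exists x.
Qed.

Lemma sup_eucl_bounded d (b : X -> 'cV[R]_d) : (sup_eucl b < +oo)%E ->
  exists2 B, 0 <= B & forall x, eucl_norm (b x) <= B.
Proof.
move=> bfin; exists (Num.max 0 (fine (sup_eucl b))); first by rewrite le_max lexx.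
move=> x; rewrite le_max; apply/orP; right.
have : ((eucl_norm (b x))%:E <= sup_eucl b)%E by apply: ereal_sup_ubound; exists x.
by case: (sup_eucl b) bfin => [r| |]//= _; rewrite lee_fin.
Qed.

Lemma bmeas_form_bounded d (A : X -> 'M[R]_d) c : measurable_fun setT A ->
  (forall x, form_bounded (A x) c) -> bmeas_mx A.
Proof.
move=> mA Ac i j; split; first exact: measurable_coord_comp.
by eexists => x; rewrite matrix_entry; exact: Ac.
Qed.

Lemma bmeas_eucl_bounded d (b : X -> 'cV[R]_d) B : measurable_fun setT b ->
  (forall x, eucl_norm (b x) <= B) -> bmeas_mx b.
Proof.
move=> mb bB i j; split; first exact: measurable_coord_comp.
by exists B => x; rewrite (ord1 j); exact: le_trans (coord_le_eucl_norm _ _) (bB x).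
Qed.

Lemma expect_mx_bounded d (mu : {measure set X -> \bar R}) (A : X -> 'M[R]_d) c :
  mu setT = 1%E -> bmeas_mx A -> (forall x, form_bounded (A x) c) ->
  form_bounded (expect_mx mu A) c.
Proof.
move=> mu1 Ab Ac u v; have mufin : (mu setT < +oo)%E by rewrite mu1 ltry.
rewrite form_expect_mx; last exact: bmeas_mx_integrable.
by apply: Rintegral_le_cst => // [|x]; [exact: bmeas_form|exact: Ac].
Qed.

Lemma powR_half (r : R) k : 0 <= r -> r `^ (k%:R / 2) = Num.sqrt r ^+ k.
Proof. by move=> r0; rewrite mulrC powRrM powR12_sqrt// powR_mulrn// sqrtr_ge0. Qed.

End uniform_bounds.

Definition sq_moment_const (R : realType) d (g h B m : R) : R :=
  coef_const B (0 : 'cV[R]_d) g h 1 * (1 + m) + 3 * g * cst_const (0 : 'cV[R]_d) g h B 1.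

(** * Passage to the limit and rates for both moments *)

Section convergence_rate.
Context (R : realType) dO (Omega : measurableType dO) (Pr : probability Omega R).
Context dX (X : measurableType dX) (P : R.-pker X ~> X) (pi : probability X R).
Context (d : nat) (A : X -> 'M[R]_d) (b : X -> 'cV[R]_d) (alpha : R).
Context (x : nat -> {RV Pr >-> X}) (theta : nat -> {RV Pr >-> 'cV[R]_d}).
Context dO' (Omega' : measurableType dO') (Pr' : probability Omega' R).
Context (xinf : {RV Pr' >-> X}) (thetainf : {RV Pr' >-> 'cV[R]_d}).
Context (M B g h s : R).
Hypothesis x_markov : markov_chain P x.
Hypothesis x0_law : forall U, measurable U -> distribution Pr (x 0%N) U = pi U.
Hypothesis pi_stationary : stationary P pi.
Hypothesis theta_indep : cond_independent Pr (x 0%N)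
  (g_sigma_algebra_preimage (theta 0%N)) (sigma_of x [set i | (1 <= i)%N]).
Hypothesis theta_rec : forall k w,
  theta k.+1 w = theta k w + alpha *: (A (x k w) *m theta k w + b (x k w)).
Hypothesis theta0_moment :
  (\int[Pr]_w (eucl_norm (theta 0%N w) ^+ 2)%:E <= M%:E)%E.
Hypotheses (Ab : bmeas_mx A) (bb : bmeas_mx b).
Hypotheses (A1 : forall y, form_bounded (A y) 1).
Hypotheses (b_bounded : forall y, eucl_norm (b y) <= B).
Hypotheses (alpha_ge0 : 0 <= alpha) (alpha_le1 : alpha <= 1).
Hypotheses (g_ge0 : 0 <= g) (h_ge0 : 0 <= h) (B_ge0 : 0 <= B).
Hypotheses (s_ge : 1 / 2 <= s) (s_le1 : s <= 1).
Hypothesis alpha_rate : alpha <= 3 * g * (1 - s).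
Hypothesis decay : forall n y v,
  dot v (iter n (quad_step P A alpha) (fun=> 1%:M) y *m v) <=
  (h * s ^+ n) ^+ 2 * dot v v.
Hypothesis W2_cvg : wasserstein2 (@joint_dist R dX X d)
  (distribution Pr (rv_pair (x k) (theta k)))
  (distribution Pr' (rv_pair xinf thetainf)) @[k --> \oo] --> 0%E.

Local Notation m' := (sq_moment_const d g h B M).

Let s_ge0 : 0 <= s. Proof. by have := s_ge; lra. Qed.

Let theta0_fin : (\int[Pr]_w (eucl_norm (theta 0%N w) ^+ 2)%:E < +oo)%E.
Proof. by apply: le_lt_trans theta0_moment _; rewrite ltry. Qed.

Let theta_sq k : Pr.-integrable setT (EFin \o (fun w => dot (theta k w) (theta k w))).
Proof. exact: (integrable_sq theta_rec theta0_fin A1 b_bounded). Qed.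

Let sq0_le : \int[Pr]_w dot (theta 0%N w) (theta 0%N w) <= M.
Proof.
rewrite -lee_fin /Rintegral fineK//; last exact: (integrable_fin_num _ (theta_sq 0)).
by apply: le_trans theta0_moment; under [leRHS]eq_integral do rewrite sqr_eucl_norm.
Qed.

Let sq_le k : \int[Pr]_w dot (theta k w) (theta k w) <= m'.
Proof.
have := affine_moment_bounded x_markov x0_law pi_stationary theta_indep theta_rec
  theta0_fin Ab bb A1 b_bounded alpha_ge0 alpha_le1 0 g_ge0 h_ge0 B_ge0 ler01
  s_ge s_le1 alpha_rate decay (@form_bounded1 R d) k.
have -> : affine_mean Pr (theta k) 1%:M 0 = \int[Pr]_w dot (theta k w) (theta k w).
  rewrite /affine_mean; under [X in _ + X = _]eq_Rintegral do rewrite /dot mulmx0 mxE.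
  rewrite Rintegral_cst// mul0r addr0.
  by apply: eq_Rintegral => w _; rewrite mul1mx.
move=> /(le_trans (ler_norm _))/le_trans; apply; rewrite lerD2r.
by rewrite ler_wpM2l ?coef_const_ge0// lerD2l.
Qed.

Let moments_ge0 : 0 <= 2 + M + m'.
Proof.
have sq0 k : 0 <= \int[Pr]_w dot (theta k w) (theta k w).
  by apply: Rintegral_ge0 => w _; exact: dot_ge0.
have M0 := le_trans (sq0 0) sq0_le; have m0 := le_trans (sq0 0) (sq_le 0).
by apply: addr_ge0 => //; exact: addr_ge0.
Qed.

(** With [k] fixed, the comparison of times [k] and [N + k] is uniform in [N] thanks to the bound on
    second moments; [N] is then taken so large that time [N + k] is within [e] of the limit. *)
Lemma affine_mean_limit Q q c k : 0 <= c -> form_bounded Q c ->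
  `|affine_mean Pr (theta k) Q q - affine_mean Pr' thetainf Q q| <=
  coef_const B q g h c * (2 + M + m') * s ^+ k.
Proof.
move=> c0 Qc; apply/ler_addgt0Pr => e e0.
have [N _ hN] := wasserstein_affine_mean W2_cvg theta_sq q c0 Qc sq_le e0.
have h1 := hN (N + k)%N (leq_addr _ _).
have h2 := affine_moment_cauchy x_markov x0_law pi_stationary theta_indep theta_rec
  theta0_fin Ab bb A1 b_bounded alpha_ge0 alpha_le1 q g_ge0 h_ge0 B_ge0 c0
  s_ge s_le1 alpha_rate decay Qc N k.
rewrite -(subrK (affine_mean Pr (theta (N + k)) Q q) (affine_mean Pr (theta k) Q q)).
rewrite -addrA; apply: (le_trans (ler_normD _ _)); apply: lerD => //.
apply: (le_trans h2); rewrite ler_wpM2r ?exprn_ge0//.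
rewrite ler_wpM2l ?coef_const_ge0// lerD//; first by rewrite lerD2l.
exact: sq_le.
Qed.

Let mtheta k i : measurable_fun setT (fun w => theta k w i ord0).
Proof. exact: measurable_coord_comp. Qed.

Let mthetainf i : measurable_fun setT (fun w => thetainf w i ord0).
Proof. exact: measurable_coord_comp. Qed.

Let thetainf_sq :
  Pr'.-integrable setT (EFin \o (fun w => dot (thetainf w) (thetainf w))).
Proof. exact: wasserstein_sq_integrable W2_cvg theta_sq. Qed.

Lemma mean_rate k :
  eucl_norm (expect_mx Pr (theta k) - expect_mx Pr' thetainf) <=
  h * (2 + M + m') * s ^+ k.
Proof.
set D := _ - _.
(* The difference of means is tested against itself. With [Q = 0] and [c = 0] the constant is linear
   in [|D|], and one factor cancels. *)
have := @affine_mean_limit 0 D 0 k (lexx _).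
have -> : coef_const B D g h 0 = h * eucl_norm D.
  by rewrite /coef_const /lin_const /forcing_const; ring.
rewrite -!dot_mean// -dotBr -/D -sqr_eucl_norm ger0_norm ?sqr_ge0//.
have := eucl_norm_ge0 D; rewrite le_eqVlt => /predU1P[<- _|D0 hD].
  by apply: mulr_ge0; [exact: mulr_ge0|exact: exprn_ge0].
rewrite -(ler_pM2r D0) -expr2; apply: (le_trans (hD _)).
  by move=> u v; rewrite mul0mx /dot mulmx0 mxE normr0 !mul0r.
by rewrite le_eqVlt; apply/orP; left; apply/eqP; ring.
Qed.

Lemma second_moment_rate k :
  spectral_norm (expect_mx Pr (fun w => theta k w *m (theta k w)^T) -
                 expect_mx Pr' (fun w => thetainf w *m (thetainf w)^T)) <=
  (h ^+ 2 + h * lin_const g h B 1) * (2 + M + m') * s ^+ k.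
Proof.
have l0 : 0 <= lin_const g h B 1 by rewrite /lin_const /forcing_const !mulr_ge0 ?sqr_ge0.
apply: form_bounded_spectral_norm.
  apply: mulr_ge0; last exact: exprn_ge0.
  by apply: mulr_ge0 => //; apply: addr_ge0; [exact: sqr_ge0|exact: mulr_ge0].
move=> u v; rewrite mulmxBl dotBr !form_second_moment//.
have c0 := mulr_ge0 (eucl_norm_ge0 u) (eucl_norm_ge0 v).
apply: (le_trans (affine_mean_limit 0 k c0 (form_bounded_rank_one u v))).
rewrite le_eqVlt; apply/orP; left; apply/eqP.
by rewrite /coef_const /lin_const /forcing_const eucl_norm0; ring.
Qed.

End convergence_rate.
Theorem corollary4p2 (R : realType)
  (dX : measure_display) (X : measurableType dX) (pi : probability X R)
  (d : nat) (A : X -> 'M[R]_d) (b : X -> 'cV[R]_d)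
  (Gam : 'M[R]_d) (gmax : R) (M : R)
  (X_borel : borel_space R X)
  (d_gt0 : (0 < d)%N)
  (A_meas : measurable_fun [set: X] A)
  (b_meas : measurable_fun [set: X] b)
  (A_max : (sup_spectral A <= 1)%E)
  (b_max : (sup_eucl b < +oo)%E)
  (Abar_hurwitz : hurwitz (expect_mx pi A))
  (Gam_posdef : sym_posdef Gam)
  (Gam_lyapunov :
    (expect_mx pi A)^T *m Gam + Gam *m expect_mx pi A = - 1%:M)
  (gmax_max : is_max_eigenvalue Gam gmax) :
  exists C C' : R,
  forall (P : R.-pker X ~> X),
    unique_stationary P pi ->
    uniformly_ergodic P pi ->
  forall (alpha : R) (tau : nat),
    0 < alpha ->
    is_mixing_time A b pi P alpha tau ->
    alpha * tau%:R < (5 / 100) / (95 * gmax) ->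
  forall (dO : measure_display) (Omega : measurableType dO)
    (Pr : probability Omega R)
    (x : nat -> {RV Pr >-> X}) (theta : nat -> {RV Pr >-> 'cV[R]_d}),
    markov_chain P x ->
    (forall U : set X, measurable U -> distribution Pr (x 0%N) U = pi U) ->
    cond_independent Pr (x 0%N)
      (g_sigma_algebra_preimage (theta 0%N))
      (sigma_of x [set i | (1 <= i)%N]) ->
    (\int[Pr]_w (eucl_norm (theta 0%N w) ^+ 2)%:E <= M%:E)%E ->
    (forall (k : nat) (w : Omega),
      theta k.+1 w =
        theta k w + alpha *: (A (x k w) *m theta k w + b (x k w))) ->
  forall (dO' : measure_display) (Omega' : measurableType dO')
    (Pr' : probability Omega' R)
    (xinf : {RV Pr' >-> X}) (thetainf : {RV Pr' >-> 'cV[R]_d}),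
    wasserstein2 (@joint_dist R dX X d)
      (distribution Pr (rv_pair (x k) (theta k)))
      (distribution Pr' (rv_pair xinf thetainf)) @[k --> \oo] --> 0%E ->
  forall k : nat, (tau <= k)%N ->
    eucl_norm (expect_mx Pr (theta k) - expect_mx Pr' thetainf)
      <= C * (1 - 9 / 10 * alpha / gmax) `^ (k%:R / 2) /\
    spectral_norm
      (expect_mx Pr (fun w => theta k w *m (theta k w)^T) -
       expect_mx Pr' (fun w => thetainf w *m (thetainf w)^T))
      <= C' * (1 - 9 / 10 * alpha / gmax) `^ (k%:R / 2).
Proof.
have A1 y : form_bounded (A y) 1 by exact: sup_spectral_form_bounded.
have Ab := bmeas_form_bounded A_meas A1.
have [B B0 bB] := sup_eucl_bounded b_max.
have bb := bmeas_eucl_bounded b_meas bB.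
have Abar1 := expect_mx_bounded (probability_setT pi) Ab A1.
have g_ge := max_eigenvalue_ge d_gt0 Gam_posdef Gam_lyapunov gmax_max Abar1.
have Gamg := posdef_form_bounded Gam_posdef gmax_max.
have lower := lyapunov_lower_bound Gam_posdef Gam_lyapunov gmax_max Abar1.
have g0 : 0 < gmax := max_eigenvalue_gt0 Gam_posdef gmax_max.
(* [h ^+ 2] is the prefactor in [iter_quad1_decay]; [K] bounds [2] plus the second moments at time
   [0] and at any later time. Both are fixed before [P], [alpha] and [tau] are introduced. *)
pose h := 4 * gmax; pose K := 2 + M + sq_moment_const d gmax h B M.
exists (h * K), ((h ^+ 2 + h * lin_const gmax h B 1) * K).
move=> P [P_pi _] _ alpha tau alpha0 [tau0 tau_mixed _] small dO Omega Pr x theta.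
move=> x_markov x0_law theta_indep theta0_moment theta_rec dO' Omega' Pr' xinf thetainf W2 k _.
have mixing y : form_bounded (iter tau (@averaged _ _ _ P d d) A y - expect_mx pi A) alpha.
  apply: spectral_norm_form_bounded; rewrite -expect_mx_kpow// -lee_fin.
  have [+ _] := tau_mixed y tau (leqnn tau); move=> /le_trans; apply.
  by rewrite -[leRHS]mule1 lee_pmul2l// lte_fin.
have r1 := rate_lt1 alpha0 g_ge.
have r_ge := rate_ge alpha0 tau0 small g_ge.
have r0 : 0 <= rate alpha gmax by lra.
(* Powers of [s] are the half powers of the rate in the conclusion. *)
pose s := Num.sqrt (rate alpha gmax).
have s0 : 0 <= s := sqrtr_ge0 _.
have sE : s ^+ 2 = 1 - 9 / 10 * alpha / gmax := sqr_sqrtr r0.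
have s1 : s <= 1 by rewrite -sqrtr1 ler_wsqrtr// ltW.
have s_ge : 1 / 2 <= s.
  rewrite -(@ler_pXn2r _ 2)// ?nnegrE// ?divr_ge0// sE -/(rate alpha gmax) expr2; lra.
(* [9 / 10 * alpha = gmax * (1 - s)(1 + s)] and [1 + s <= 2], so even [20 / 9] in place of [3] would
   do. *)
have alpha_rate : alpha <= 3 * gmax * (1 - s).
  have : 9 / 10 * alpha <= 2 * gmax * (1 - s).
    have -> : 9 / 10 * alpha = gmax * (1 - s ^+ 2) by rewrite sE; field; rewrite gt_eqF.
    have := mulr_ge0 (ltW g0) (sqr_ge0 (1 - s)); rewrite sqrrB; lra.
  have : 0 <= gmax * (1 - s) by rewrite mulr_ge0 ?(ltW g0)// subr_ge0.
  by lra.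
have alpha1 : alpha <= 1.
  have : alpha * 1 <= alpha * tau%:R by rewrite ler_pM2l// ler1n.
  move: small; rewrite ltr_pdivlMr ?mulr_gt0//.
  have : alpha * tau%:R * (1 / 2) <= alpha * tau%:R * gmax.
    by rewrite ler_wpM2l// mulr_ge0// ltW.
  by lra.
have decay n y v : dot v (iter n (quad_step P A alpha) (fun=> 1%:M) y *m v) <=
    (h * s ^+ n) ^+ 2 * dot v v.
  have := iter_quad1_decay Ab A1 alpha0 tau0 small g_ge Gamg lower Gam_lyapunov mixing n y v.
  by have -> : (h * s ^+ n) ^+ 2 = (4 * gmax) ^+ 2 * rate alpha gmax ^+ n
    by rewrite exprMn exprAC sE.
have h0 : 0 <= h by rewrite mulr_ge0// ltW.
rewrite powR_half//; split.
  exact: (mean_rate x_markov x0_law P_pi theta_indep theta_rec theta0_moment Ab bb A1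
    bB (ltW alpha0) alpha1 (ltW g0) h0 B0 s_ge s1 alpha_rate decay W2).
exact: (second_moment_rate x_markov x0_law P_pi theta_indep theta_rec theta0_moment Ab bb A1
    bB (ltW alpha0) alpha1 (ltW g0) h0 B0 s_ge s1 alpha_rate decay W2).
Qed.
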